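(* Let $n,m\ge 1$ and let $p\in\mathbb{C}[z_1,z_2,z_3]$ have multidegree at most $(n,m,1)$ and no zeros on the closed tridisk $\overline{\mathbb{D}}^3$. Let $\tilde p(z)=z_1^{n}z_2^{m}z_3\,\overline{p(1/\bar z_1,1/\bar z_2,1/\bar z_3)}$. Then there exist integers $r,s\ge 0$ such that the function \[ \frac{z_1^r z_2^s\,\tilde p(z_1,z_2,z_3)}{p(z_1,z_2,z_3)} \] belongs to the Schur-Agler class of $\mathbb{D}^3$.
   Context: $\mathbb{D}$ is the open unit disk, $\mathbb{T}$ the unit circle. A polynomial has multidegree at most $(d_1,\dots,d_n)$ if its degree in $z_j$ is at most $d_j$ for each $j$. A holomorphic function $f:\mathbb{D}^n\to\overline{\mathbb{D}}$ is in the Schur-Agler class if for every commuting $n$-tuple $(T_1,\dots,T_n)$ of strict contractions on a separable Hilbert space one has $\|f(T_1,\dots,T_n)\|\le 1$. *)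

(* Defs.v *)
From Stdlib Require Import Reals.
Open Scope R_scope.

Record C := mkC { Cre : R ; Cim : R }.
Definition C0 : C := mkC 0 0.
Definition C1 : C := mkC 1 0.
Definition Cadd (a b : C) : C := mkC (Cre a + Cre b) (Cim a + Cim b).
Definition Cmul (a b : C) : C :=
  mkC (Cre a * Cre b - Cim a * Cim b) (Cre a * Cim b + Cim a * Cre b).
Definition Cconj (a : C) : C := mkC (Cre a) (- Cim a).
Definition Cmod (a : C) : R := sqrt (Cre a * Cre a + Cim a * Cim a).
Definition Cinv (a : C) : C :=
  let d := Cre a * Cre a + Cim a * Cim a in mkC (Cre a / d) (- Cim a / d).
Definition Cdiv (a b : C) : C := Cmul a (Cinv b).
Fixpoint Cpow (a : C) (k : nat) : C :=
  match k with O => C1 | S k' => Cmul a (Cpow a k') end.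
Fixpoint Csum (f : nat -> C) (N : nat) : C :=
  match N with O => f O | S N' => Cadd (Csum f N') (f N) end.

Definition gen_norm {X : Type} (inn : X -> X -> C) (x : X) : R :=
  sqrt (Cre (inn x x)).

Record HilbertSpace := {
  hcar :> Type;
  hz : hcar;
  hadd : hcar -> hcar -> hcar;
  hopp : hcar -> hcar;
  hscal : C -> hcar -> hcar;
  hinner : hcar -> hcar -> C;
  hadd_assoc : forall x y w, hadd x (hadd y w) = hadd (hadd x y) w;
  hadd_comm : forall x y, hadd x y = hadd y x;
  hadd_0 : forall x, hadd hz x = x;
  hadd_opp : forall x, hadd x (hopp x) = hz;
  hscal_1 : forall x, hscal C1 x = x;
  hscal_assoc : forall a b x, hscal a (hscal b x) = hscal (Cmul a b) x;
  hscal_distr_v : forall a x y, hscal a (hadd x y) = hadd (hscal a x) (hscal a y);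
  hscal_distr_s : forall a b x, hscal (Cadd a b) x = hadd (hscal a x) (hscal b x);
  hinner_add_l : forall x y w, hinner (hadd x y) w = Cadd (hinner x w) (hinner y w);
  hinner_scal_l : forall a x y, hinner (hscal a x) y = Cmul a (hinner x y);
  hinner_sym : forall x y, hinner y x = Cconj (hinner x y);
  hinner_pos : forall x, 0 <= Cre (hinner x x);
  hinner_def : forall x, Cre (hinner x x) = 0 -> x = hz;
  hcomplete : forall u : nat -> hcar,
    (forall eps, 0 < eps -> exists N, forall a b, (N <= a)%nat -> (N <= b)%nat ->
        gen_norm hinner (hadd (u a) (hopp (u b))) < eps) ->
    exists l, forall eps, 0 < eps -> exists N, forall a, (N <= a)%nat ->
        gen_norm hinner (hadd (u a) (hopp l)) < eps;
  hseparable : exists d : nat -> hcar, forall x eps, 0 < eps ->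
    exists k, gen_norm hinner (hadd x (hopp (d k))) < eps
}.

Definition hnorm {H : HilbertSpace} (x : H) : R := gen_norm (hinner H) x.

Fixpoint hsum {H : HilbertSpace} (f : nat -> H) (N : nat) : H :=
  match N with O => f O | S N' => hadd H (hsum f N') (f N) end.

Definition is_linear_op {H : HilbertSpace} (T : H -> H) : Prop :=
  (forall x y, T (hadd H x y) = hadd H (T x) (T y)) /\
  (forall a x, T (hscal H a x) = hscal H a (T x)).

Definition strict_contraction {H : HilbertSpace} (T : H -> H) : Prop :=
  is_linear_op T /\
  exists c, 0 <= c < 1 /\ forall x, hnorm (T x) <= c * hnorm x.

Definition op_pow {H : HilbertSpace} (T : H -> H) (k : nat) : H -> H :=
  Nat.iter k T.

(* A polynomial is given by its coefficient array; c i j k is the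
   coefficient of z1^i z2^j z3^k. *)
Definition coef3 := nat -> nat -> nat -> C.

Definition multideg_le (c : coef3) (d1 d2 d3 : nat) : Prop :=
  forall i j k, c i j k <> C0 -> (i <= d1)%nat /\ (j <= d2)%nat /\ (k <= d3)%nat.

Definition eval3 (n m : nat) (c : coef3) (z1 z2 z3 : C) : C :=
  Csum (fun i => Csum (fun j => Csum (fun k =>
     Cmul (c i j k) (Cmul (Cpow z1 i) (Cmul (Cpow z2 j) (Cpow z3 k)))) 1) m) n.

Definition opeval3 {H : HilbertSpace} (n m : nat) (c : coef3)
    (T1 T2 T3 : H -> H) : H -> H :=
  fun x => hsum (fun i => hsum (fun j => hsum (fun k =>
     hscal H (c i j k) (op_pow T1 i (op_pow T2 j (op_pow T3 k x)))) 1) m) n.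

(* ptilde(z) = z1^n z2^m z3 * conj(p(1/conj z1, 1/conj z2, 1/conj z3)),
   i.e. coefficient (a,b,k) is conj of p's coefficient (n-a, m-b, 1-k). *)
Definition reflect3 (n m : nat) (c : coef3) : coef3 :=
  fun a b k => if (Nat.leb a n && Nat.leb b m && Nat.leb k 1)%bool
               then Cconj (c (n - a) (m - b) (1 - k))%nat else C0.

Definition in_D (z : C) : Prop := Cmod z < 1.
Definition in_closedD (z : C) : Prop := Cmod z <= 1.

(* The rational function f(z) = z1^r z2^s q(z) / p(z) (q, p of multidegree
   <= (n,m,1), p zero-free on the open tridisk) belongs to the Schur-Agler
   class of D^3: f maps D^3 into the closed disk, and for every commuting
   triple T of strict contractions on a separable Hilbert space,
   f(T) = T1^r T2^s q(T) p(T)^{-1} (p(T) invertible) has norm <= 1. *)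
Definition SchurAgler_rat (r s n m : nat) (q p : coef3) : Prop :=
  (forall z1 z2 z3, in_D z1 -> in_D z2 -> in_D z3 ->
     eval3 n m p z1 z2 z3 <> C0 /\
     Cmod (Cdiv (Cmul (Cpow z1 r) (Cmul (Cpow z2 s) (eval3 n m q z1 z2 z3)))
                (eval3 n m p z1 z2 z3)) <= 1) /\
  (forall (H : HilbertSpace) (T1 T2 T3 : H -> H),
     strict_contraction T1 -> strict_contraction T2 -> strict_contraction T3 ->
     (forall x, T1 (T2 x) = T2 (T1 x)) ->
     (forall x, T1 (T3 x) = T3 (T1 x)) ->
     (forall x, T2 (T3 x) = T3 (T2 x)) ->
     exists X : H -> H,
       (forall x, opeval3 n m p T1 T2 T3 (X x) = x) /\
       (forall x, X (opeval3 n m p T1 T2 T3 x) = x) /\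
       (forall x, hnorm (op_pow T1 r (op_pow T2 s
                    (opeval3 n m q T1 T2 T3 (X x)))) <= hnorm x)).

(* Main.v *)
From Stdlib Require Import Reals Lra Lia Ring List Arith.
From Stdlib Require Import ClassicalEpsilon FunctionalExtensionality ProofIrrelevance.
From Coquelicot Require Compactness.
Require Import Defs.
Import ListNotations.
Open Scope R_scope.

(* Write p = a + b z3. Absence of zeros means |b| < |a| on the closed bidisk, so by a Fejer
   kernel argument |a|^2 - |b|^2 = sum |E_l|^2 on the torus for polynomials E_l of degree at
   most L in each variable. Then [[z^r b~, z^L E*], [E, -b]] / a, with z^r = z1^(L-n) z2^(L-m)
   clearing the denominators of E*, is analytic and contractive on the torus, and
   z^r p~/p is its transfer function in z3. Ando's theorem turns contractivity on the torus
   into contractivity at commuting contractions T1, T2; applied to the vector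
   (p(T)x, T3 E(T)x) it gives |T^r p~(T)x|^2 + |Ex|^2 <= |p(T)x|^2 + |T3 Ex|^2, whence the bound.

   Instead of functional calculus, an isometry V is compared with the scalars of the circle
   through the approximate eigenvectors sum_l z^(-l) V^l x, and the division by a is
   justified by the method of continuity along a(t z1, t z2). *)

(** Ando's theorem has no analogue for three commuting contractions, so [T3] is never dilated.
    Because p has degree one in z3, the norm bound needs only that [T3] is a contraction commuting
    with polynomials in [T1], [T2]; its strictness serves the invertibility of p(T). The Fejer
    argument requires a gap: compactness of the closed bidisk yields d > 0 with
    [|a|^2 - |b|^2 >= d], and L is chosen large in terms of d. Hence r and s are not determined by n
    and m alone. Ando's theorem is proved here in vector spaces whose form may be degenerate and
    which need not be complete. Defect spaces and sequence spaces can then be written down without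
    square roots of operators, adjoints of the given maps or completions. The price is that a(V)
    need not be invertible on the dilation space: it is bounded below with dense range there, and
    every division by a is an approximation with an error sent to zero. *)

Lemma C_eq (a b : C) : Cre a = Cre b -> Cim a = Cim b -> a = b.
Proof. destruct a, b; simpl; intros -> ->; reflexivity. Qed.

Ltac c_ring :=
  apply C_eq; unfold Cdiv, Cinv, Cconj, Cadd, Cmul, C0, C1; simpl; ring.

Definition Copp (a : C) : C := mkC (- Cre a) (- Cim a).
Definition Csub (a b : C) : C := Cadd a (Copp b).
Definition RtoC (r : R) : C := mkC r 0.
Definition Cnorm2 (a : C) : R := Cre a * Cre a + Cim a * Cim a.

Lemma C_ring_theory : ring_theory C0 C1 Cadd Cmul Csub Copp eq.
Proof. constructor; intros; try reflexivity; unfold Csub, Copp; c_ring. Qed.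
Add Ring Cring : C_ring_theory.

Lemma Cnorm2_mul a b : Cnorm2 (Cmul a b) = Cnorm2 a * Cnorm2 b.
Proof. unfold Cnorm2, Cmul; simpl; ring. Qed.

Lemma Cnorm2_ge0 a : 0 <= Cnorm2 a.
Proof. unfold Cnorm2; nra. Qed.

Lemma Cnorm2_eq0 a : Cnorm2 a = 0 -> a = C0.
Proof. unfold Cnorm2; intros; apply C_eq; simpl; nra. Qed.

Lemma Cconj_mul a b : Cconj (Cmul a b) = Cmul (Cconj a) (Cconj b).
Proof. c_ring. Qed.

Lemma Cconj_add a b : Cconj (Cadd a b) = Cadd (Cconj a) (Cconj b).
Proof. c_ring. Qed.

Lemma Cconj_conj a : Cconj (Cconj a) = a.
Proof. c_ring. Qed.

Lemma Cmul_conj a : Cmul a (Cconj a) = RtoC (Cnorm2 a).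
Proof. unfold RtoC, Cnorm2; c_ring. Qed.

Lemma Cnorm2_conj a : Cnorm2 (Cconj a) = Cnorm2 a.
Proof. unfold Cnorm2; simpl; ring. Qed.

Lemma Cconj_pow a k : Cconj (Cpow a k) = Cpow (Cconj a) k.
Proof.
  induction k as [|k IH]; simpl; [c_ring|]. rewrite Cconj_mul, IH; reflexivity.
Qed.

Lemma Cpow_add a j k : Cpow a (j + k) = Cmul (Cpow a j) (Cpow a k).
Proof. induction j as [|j IH]; simpl; [|rewrite IH]; ring. Qed.

Lemma Cpow_mul_base a b k : Cpow (Cmul a b) k = Cmul (Cpow a k) (Cpow b k).
Proof. induction k as [|k IH]; simpl; [|rewrite IH]; ring. Qed.

Lemma Cnorm2_pow a k : Cnorm2 (Cpow a k) = Cnorm2 a ^ k.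
Proof.
  induction k as [|k IH]; simpl; [unfold Cnorm2; simpl; ring|].
  rewrite Cnorm2_mul, IH; reflexivity.
Qed.

(** * Complex vector spaces with a real semi-inner product *)

(* [ip] is the real part of a sesquilinear form, which is not assumed definite. *)
Record PH := {
  car :> Type;
  vz : car;
  vadd : car -> car -> car;
  vopp : car -> car;
  vscal : C -> car -> car;
  ip : car -> car -> R;
  vadd_assoc : forall x y w, vadd x (vadd y w) = vadd (vadd x y) w;
  vadd_comm : forall x y, vadd x y = vadd y x;
  vadd_0 : forall x, vadd vz x = x;
  vadd_opp : forall x, vadd x (vopp x) = vz;
  vscal_1 : forall x, vscal C1 x = x;
  vscal_assoc : forall a b x, vscal a (vscal b x) = vscal (Cmul a b) x;
  vscal_distr_v : forall a x y, vscal a (vadd x y) = vadd (vscal a x) (vscal a y);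
  vscal_distr_s : forall a b x, vscal (Cadd a b) x = vadd (vscal a x) (vscal b x);
  ip_add : forall x y w, ip (vadd x y) w = ip x w + ip y w;
  ip_sym : forall x y, ip y x = ip x y;
  ip_real : forall r x y, ip (vscal (RtoC r) x) y = r * ip x y;
  ip_adj : forall c x y, ip (vscal c x) y = ip x (vscal (Cconj c) y);
  ip_pos : forall x, 0 <= ip x x
}.
Arguments vz {p}. Arguments vadd {p}. Arguments vopp {p}. Arguments vscal {p}.
Arguments ip {p}.

Definition vsub {K : PH} (x y : K) : K := vadd x (vopp y).
Definition q {K : PH} (x : K) : R := ip x x.

(** * Vector identities by reflection *)

Section ModuleReflection.
Context {K : PH}.

Lemma vadd_0r (x : K) : vadd x vz = x.
Proof. rewrite vadd_comm; apply vadd_0. Qed.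

Lemma vadd_idem (x : K) : vadd x x = x -> x = vz.
Proof.
  intros H. rewrite <- (vadd_0 _ x), <- (vadd_opp _ x), (vadd_comm _ x (vopp x)),
    <- vadd_assoc, H. reflexivity.
Qed.

Lemma vscal_0 (x : K) : vscal C0 x = vz.
Proof.
  apply vadd_idem. rewrite <- vscal_distr_s. f_equal; c_ring.
Qed.

Lemma vscal_z c : vscal c (vz : K) = vz.
Proof. apply vadd_idem. rewrite <- vscal_distr_v, vadd_0; reflexivity. Qed.

Lemma vadd_cancel (x y w : K) : vadd x w = vadd y w -> x = y.
Proof.
  intros H. rewrite <- (vadd_0r x), <- (vadd_0r y), <- (vadd_opp _ w), !vadd_assoc, H.
  reflexivity.
Qed.

Lemma vopp_scal (x : K) : vopp x = vscal (Copp C1) x.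
Proof.
  apply (vadd_cancel _ _ x). rewrite (vadd_comm _ (vopp x)), vadd_opp.
  rewrite <- (vscal_1 _ x) at 2. rewrite <- vscal_distr_s, <- (vscal_0 x).
  f_equal; unfold Copp; c_ring.
Qed.

Inductive vexp := VV (n : nat) | VZ | VA (e f : vexp) | VO (e : vexp) | VS (c : C) (e : vexp).

Fixpoint vden (env : list K) (e : vexp) : K :=
  match e with
  | VV n => nth n env vz
  | VZ => vz
  | VA e f => vadd (vden env e) (vden env f)
  | VO e => vopp (vden env e)
  | VS c e => vscal c (vden env e)
  end.

Fixpoint vcoef (e : vexp) (i : nat) : C :=
  match e with
  | VV n => if Nat.eqb n i then C1 else C0
  | VZ => C0
  | VA e f => Cadd (vcoef e i) (vcoef f i)
  | VO e => Cmul (Copp C1) (vcoef e i)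
  | VS c e => Cmul c (vcoef e i)
  end.

Fixpoint vlin (env : list K) (f : nat -> C) : K :=
  match env with
  | nil => vz
  | x :: l => vadd (vscal (f 0%nat) x) (vlin l (fun i => f (S i)))
  end.

Lemma vlin_ext env f g :
  (forall i, (i < length env)%nat -> f i = g i) -> vlin env f = vlin env g.
Proof.
  revert f g; induction env as [|x l IH]; simpl; intros f g H; [reflexivity|].
  rewrite (H 0%nat) by lia. f_equal. apply IH; intros; apply H; lia.
Qed.

Lemma vadd_swap (a b c d : K) :
  vadd (vadd a b) (vadd c d) = vadd (vadd a c) (vadd b d).
Proof.
  rewrite <- !vadd_assoc. f_equal. rewrite !vadd_assoc. f_equal. apply vadd_comm.
Qed.

Lemma vlin_add env f g :
  vlin env (fun i => Cadd (f i) (g i)) = vadd (vlin env f) (vlin env g).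
Proof.
  revert f g; induction env as [|x l IH]; simpl; intros f g; [rewrite vadd_0; reflexivity|].
  rewrite (IH (fun i => f (S i)) (fun i => g (S i))), vscal_distr_s; apply vadd_swap.
Qed.

Lemma vlin_scal env c f : vlin env (fun i => Cmul c (f i)) = vscal c (vlin env f).
Proof.
  revert f; induction env as [|x l IH]; simpl; intros f; [rewrite vscal_z; reflexivity|].
  rewrite (IH (fun i => f (S i))), vscal_distr_v, vscal_assoc; reflexivity.
Qed.

Lemma vlin_0 env : vlin env (fun _ => C0) = vz.
Proof.
  induction env as [|x l IH]; simpl; [reflexivity|].
  rewrite IH, vscal_0, vadd_0; reflexivity.
Qed.

Lemma vlin_var env n : vlin env (fun i => if Nat.eqb n i then C1 else C0) = nth n env vz.
Proof.
  revert n; induction env as [|x l IH]; simpl; intros [|n]; try reflexivity.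
  - rewrite vscal_1, (vlin_ext l _ (fun _ => C0)), vlin_0 by reflexivity; apply vadd_0r.
  - rewrite vscal_0, vadd_0, (vlin_ext l _ (fun i => if Nat.eqb n i then C1 else C0))
      by reflexivity; apply IH.
Qed.

Lemma vden_lin env e : vden env e = vlin env (vcoef e).
Proof.
  induction e as [n| |e IHe f IHf|e IH|c e IH]; simpl.
  - symmetry; apply vlin_var.
  - symmetry; apply vlin_0.
  - rewrite vlin_add, IHe, IHf; reflexivity.
  - rewrite vlin_scal, <- IH; apply vopp_scal.
  - rewrite vlin_scal, IH; reflexivity.
Qed.

Fixpoint all_below (n : nat) (P : nat -> Prop) : Prop :=
  match n with O => True | S n => P n /\ all_below n P end.

(** Each side is a linear combination of the atoms in [env], so comparing coefficients atom by atom
    suffices. [v_ring] leaves one identity between complex numbers for each atom. *)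
Lemma vden_eq env e f :
  all_below (length env) (fun i => vcoef e i = vcoef f i) -> vden env e = vden env f.
Proof.
  intros H. rewrite !vden_lin. apply vlin_ext. revert H. generalize (length env).
  induction n as [|n IH]; simpl; intros H i Hi; [lia|].
  destruct (Nat.eq_dec i n) as [->|]; [apply H|apply IH; [apply H|lia]].
Qed.

End ModuleReflection.

Ltac v_index x l :=
  lazymatch l with
  | x :: _ => constr:(O)
  | _ :: ?l => let n := v_index x l in constr:(S n)
  end.
Ltac v_insert x l :=
  match l with
  | _ => let n := v_index x l in l
  | _ => constr:(x :: l)
  end.
Ltac v_atoms t l :=
  lazymatch t with
  | vadd ?a ?b => let l := v_atoms a l in v_atoms b l
  | vsub ?a ?b => let l := v_atoms a l in v_atoms b l
  | vopp ?a => v_atoms a l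
  | vscal _ ?a => v_atoms a l
  | vz => l
  | _ => v_insert t l
  end.
Ltac v_reify t l :=
  lazymatch t with
  | vadd ?a ?b => let a := v_reify a l in let b := v_reify b l in constr:(VA a b)
  | vsub ?a ?b => let a := v_reify a l in let b := v_reify b l in constr:(VA a (VO b))
  | vopp ?a => let a := v_reify a l in constr:(VO a)
  | vscal ?c ?a => let a := v_reify a l in constr:(VS c a)
  | vz => constr:(VZ)
  | _ => let n := v_index t l in constr:(VV n)
  end.

Ltac v_pre :=
  lazymatch goal with
  | |- @eq ?T ?x ?y =>
    let l := v_atoms x (@nil T) in
    let l := v_atoms y l in
    let e := v_reify x l in
    let f := v_reify y l in
    change (vden l e = vden l f); apply vden_eq; cbn [all_below length vcoef Nat.eqb];
    repeat split
  end.
Ltac v_ring := v_pre; try (unfold RtoC, Copp; c_ring).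

(** * Inequalities for a degenerate form *)

Lemma quadratic_discriminant a b c :
  (forall t, 0 <= a + 2 * t * b + t * t * c) -> 0 <= c -> b * b <= a * c.
Proof.
  intros H Hc. destruct (Rle_lt_or_eq_dec _ _ Hc) as [Hp|He].
  - specialize (H (- b / c)).
    assert (0 <= c * (a + 2 * (- b / c) * b + - b / c * (- b / c) * c))
      by (apply Rmult_le_pos; lra).
    replace (c * (a + 2 * (- b / c) * b + - b / c * (- b / c) * c))
      with (a * c - b * b) in H0 by (field; lra). lra.
  - subst c. rewrite Rmult_0_r. destruct (Req_dec b 0) as [->|Hn]; [lra|].
    (* For [c = 0] the polynomial is affine in [t], and this [t] gives it the value -1. *)
    specialize (H (- (a + 1) / (2 * b))).
    replace (a + 2 * (- (a + 1) / (2 * b)) * b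
       + - (a + 1) / (2 * b) * (- (a + 1) / (2 * b)) * 0) with (-1) in H
      by (field; lra). lra.
Qed.

Section SemiInner.
Context {K : PH}.
Implicit Types x y : K.

Lemma ip_add_r x y w : ip x (vadd y w) = ip x y + ip x w.
Proof. rewrite ip_sym, ip_add, (ip_sym _ y), (ip_sym _ w); reflexivity. Qed.

Lemma ip_real_r r x y : ip x (vscal (RtoC r) y) = r * ip x y.
Proof. rewrite ip_sym, ip_real, ip_sym; reflexivity. Qed.

Lemma ip_opp x y : ip (vopp x) y = - ip x y.
Proof.
  rewrite vopp_scal. replace (Copp C1) with (RtoC (-1)) by (unfold RtoC, Copp; c_ring).
  rewrite ip_real; ring.
Qed.

Lemma ip_opp_r x y : ip x (vopp y) = - ip x y.
Proof. rewrite ip_sym, ip_opp, ip_sym; reflexivity. Qed.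

Lemma ip_z x : ip vz x = 0.
Proof.
  rewrite <- (vscal_0 x). replace C0 with (RtoC 0) by reflexivity. rewrite ip_real; ring.
Qed.

Lemma ip_z_r x : ip x vz = 0.
Proof. rewrite ip_sym; apply ip_z. Qed.

Lemma q_ge0 x : 0 <= q x.
Proof. apply ip_pos. Qed.

Lemma q_z : q (vz : K) = 0.
Proof. apply ip_z. Qed.

Lemma q_scal c x : q (vscal c x) = Cnorm2 c * q x.
Proof.
  unfold q. rewrite ip_adj, vscal_assoc.
  replace (Cmul (Cconj c) c) with (RtoC (Cnorm2 c)) by (unfold RtoC, Cnorm2; c_ring).
  rewrite ip_real_r; reflexivity.
Qed.

Lemma q_add x y : q (vadd x y) = q x + 2 * ip x y + q y.
Proof. unfold q. rewrite ip_add, !ip_add_r, (ip_sym _ x y); ring. Qed.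

Lemma q_opp x : q (vopp x) = q x.
Proof. unfold q; rewrite ip_opp, ip_opp_r; ring. Qed.

Lemma q_sub_sym x y : q (vsub x y) = q (vsub y x).
Proof. rewrite <- q_opp. f_equal. v_ring. Qed.

(** Expand [0 <= q (eta x - y)]. For small [eta] the main term keeps a factor close to 1, and the
    large factor [1 + / eta] falls on an error term that is bounded or can be made small. *)
Lemma q_young eta x y : 0 < eta ->
  q (vadd x y) <= (1 + eta) * q x + (1 + / eta) * q y.
Proof.
  intros He. rewrite q_add.
  pose proof (q_ge0 (vadd (vscal (RtoC eta) x) (vopp y))) as H.
  rewrite q_add, q_scal, q_opp, ip_real, ip_opp_r in H.
  unfold Cnorm2 in H; simpl in H.
  assert (2 * ip x y <= eta * q x + / eta * q y); [|lra].
  apply (Rmult_le_reg_l eta); [lra|].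
  replace (eta * (eta * q x + / eta * q y)) with (eta * eta * q x + q y) by (field; lra).
  lra.
Qed.

Lemma q_add_le x y : q (vadd x y) <= 2 * q x + 2 * q y.
Proof. pose proof (q_young 1 x y ltac:(lra)). rewrite Rinv_1 in H. lra. Qed.

Lemma cauchy_schwarz x y : ip x y * ip x y <= q x * q y.
Proof.
  apply quadratic_discriminant; [|apply q_ge0].
  intros t. pose proof (q_ge0 (vadd x (vscal (RtoC t) y))) as H.
  rewrite q_add, q_scal, ip_real_r in H. unfold Cnorm2 in H; simpl in H. lra.
Qed.

End SemiInner.

(** * Linear maps and finite sums *)

Definition is_lin {K L : PH} (f : K -> L) : Prop :=
  (forall x y, f (vadd x y) = vadd (f x) (f y)) /\ (forall c x, f (vscal c x) = vscal c (f x)).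

Lemma lin_z {K L : PH} (f : K -> L) : is_lin f -> f vz = vz.
Proof. intros [_ H]. rewrite <- (vscal_0 vz), H, vscal_0; reflexivity. Qed.

Lemma lin_opp {K L : PH} (f : K -> L) x : is_lin f -> f (vopp x) = vopp (f x).
Proof. intros [_ H]. rewrite !vopp_scal; apply H. Qed.

Lemma lin_sub {K L : PH} (f : K -> L) x y : is_lin f -> f (vsub x y) = vsub (f x) (f y).
Proof. intros H. unfold vsub. rewrite (proj1 H), lin_opp by exact H; reflexivity. Qed.

Lemma lin_comp {K L M : PH} (f : K -> L) (g : L -> M) :
  is_lin f -> is_lin g -> is_lin (fun x => g (f x)).
Proof. intros [Fa Fs] [Ga Gs]; split; intros; [rewrite Fa, Ga|rewrite Fs, Gs]; reflexivity. Qed.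

Lemma lin_scal {K : PH} c : is_lin (vscal c : K -> K).
Proof. split; intros; v_ring. Qed.

Fixpoint vsum {K : PH} (f : nat -> K) (n : nat) : K :=
  match n with O => vz | S n => vadd (vsum f n) (f n) end.

Fixpoint rsum (f : nat -> R) (n : nat) : R :=
  match n with O => 0 | S n => rsum f n + f n end.

Section Sums.
Context {K : PH}.

Lemma vsum_ext (f g : nat -> K) n :
  (forall i, (i < n)%nat -> f i = g i) -> vsum f n = vsum g n.
Proof.
  induction n as [|n IH]; simpl; intros H; [reflexivity|].
  rewrite IH, H by (intros; try apply H; lia). reflexivity.
Qed.

Lemma lin_vsum {L : PH} (h : K -> L) f n :
  is_lin h -> h (vsum f n) = vsum (fun i => h (f i)) n.
Proof.
  intros H; induction n as [|n IH]; simpl; [apply lin_z, H|].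
  rewrite (proj1 H), IH; reflexivity.
Qed.

Lemma vsum_add (f g : nat -> K) n :
  vsum (fun i => vadd (f i) (g i)) n = vadd (vsum f n) (vsum g n).
Proof.
  induction n as [|n IH]; simpl; [v_ring|]. rewrite IH. v_ring.
Qed.

Lemma rsum_ext f g n : (forall i, (i < n)%nat -> f i = g i) -> rsum f n = rsum g n.
Proof.
  induction n as [|n IH]; simpl; intros H; [reflexivity|].
  rewrite IH, H by (intros; try apply H; lia). reflexivity.
Qed.

Lemma rsum_le f g n : (forall i, (i < n)%nat -> f i <= g i) -> rsum f n <= rsum g n.
Proof.
  induction n as [|n IH]; simpl; intros H; [lra|].
  pose proof (H n ltac:(lia)). assert (rsum f n <= rsum g n) by (apply IH; intros; apply H; lia).
  lra.
Qed.

Lemma rsum_add f g n : rsum (fun i => f i + g i) n = rsum f n + rsum g n.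
Proof. induction n as [|n IH]; simpl; [|rewrite IH]; ring. Qed.

Lemma rsum_scal c f n : rsum (fun i => c * f i) n = c * rsum f n.
Proof. induction n as [|n IH]; simpl; [|rewrite IH]; ring. Qed.

Lemma rsum_const c n : rsum (fun _ => c) n = INR n * c.
Proof. induction n as [|n IH]; [simpl; ring|]. simpl rsum. rewrite IH, S_INR; ring. Qed.

Lemma rsum_swap (f : nat -> nat -> R) n m :
  rsum (fun i => rsum (fun j => f i j) m) n = rsum (fun j => rsum (fun i => f i j) n) m.
Proof.
  induction n as [|n IH]; simpl.
  - induction m as [|m IHm]; simpl; [|rewrite <- IHm]; ring.
  - rewrite IH, <- rsum_add. reflexivity.
Qed.

Lemma rsum_ge0 f n : (forall i, (i < n)%nat -> 0 <= f i) -> 0 <= rsum f n.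
Proof.
  intros H. rewrite <- (Rmult_0_r (INR n)), <- rsum_const. apply rsum_le, H.
Qed.

Lemma ip_vsum (f : nat -> K) n y : ip (vsum f n) y = rsum (fun i => ip (f i) y) n.
Proof. induction n as [|n IH]; simpl; [apply ip_z|]. rewrite ip_add, IH; reflexivity. Qed.

Lemma ip_vsum_r (f : nat -> K) n y : ip y (vsum f n) = rsum (fun i => ip y (f i)) n.
Proof. induction n as [|n IH]; simpl; [apply ip_z_r|]. rewrite ip_add_r, IH; reflexivity. Qed.

Lemma rsum_delta (f : nat -> R) n i :
  (i < n)%nat -> rsum (fun j => if Nat.eqb i j then f j else 0) n = f i.
Proof.
  intros Hi. assert (forall m, (m <= i)%nat ->
    rsum (fun j => if Nat.eqb i j then f j else 0) m = 0) as Hm.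
  { induction m as [|m IH]; simpl; intros; [reflexivity|].
    rewrite IH by lia. destruct (Nat.eqb_spec i m); [lia|ring]. }
  induction n as [|n IH]; [lia|]; simpl.
  destruct (Nat.eqb_spec i n) as [->|]; [rewrite Hm by lia; ring|rewrite IH by lia; ring].
Qed.

End Sums.

(** * Roots of unity and Parseval's identity *)

Fixpoint csum (f : nat -> C) (n : nat) : C :=
  match n with O => C0 | S n => Cadd (csum f n) (f n) end.

Lemma csum_ext f g n : (forall i, (i < n)%nat -> f i = g i) -> csum f n = csum g n.
Proof.
  induction n as [|n IH]; simpl; intros H; [reflexivity|].
  rewrite IH, H by (intros; try apply H; lia). reflexivity.
Qed.

Lemma csum_scal c f n : csum (fun i => Cmul c (f i)) n = Cmul c (csum f n).
Proof. induction n as [|n IH]; simpl; [|rewrite IH]; ring. Qed.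

Lemma csum_scal_r c f n : csum (fun i => Cmul (f i) c) n = Cmul (csum f n) c.
Proof. induction n as [|n IH]; simpl; [|rewrite IH]; ring. Qed.

Lemma csum_add f g n : csum (fun i => Cadd (f i) (g i)) n = Cadd (csum f n) (csum g n).
Proof. induction n as [|n IH]; simpl; [|rewrite IH]; ring. Qed.

Lemma csum_swap (f : nat -> nat -> C) n m :
  csum (fun i => csum (fun j => f i j) m) n = csum (fun j => csum (fun i => f i j) n) m.
Proof.
  induction n as [|n IH]; simpl.
  - induction m as [|m IHm]; simpl; [|rewrite <- IHm]; ring.
  - rewrite IH, <- csum_add. reflexivity.
Qed.

Lemma csum_const c n : csum (fun _ => c) n = Cmul (RtoC (INR n)) c.
Proof.
  induction n as [|n IH]; [unfold RtoC; c_ring|]. simpl csum. rewrite IH, S_INR.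
  unfold RtoC; c_ring.
Qed.

Lemma csum_conj f n : Cconj (csum f n) = csum (fun i => Cconj (f i)) n.
Proof. induction n as [|n IH]; simpl; [c_ring|]. rewrite Cconj_add, IH; reflexivity. Qed.

Lemma vscal_csum {K : PH} f (x : K) n :
  vscal (csum f n) x = vsum (fun i => vscal (f i) x) n.
Proof. induction n as [|n IH]; simpl; [apply vscal_0|]. rewrite vscal_distr_s, IH; reflexivity. Qed.

Lemma geometric_sum w n :
  Cmul (Csub w C1) (csum (Cpow w) n) = Csub (Cpow w n) C1.
Proof.
  induction n as [|n IH]; simpl; [ring|].
  transitivity (Cadd (Cmul (Csub w C1) (csum (Cpow w) n)) (Cmul (Csub w C1) (Cpow w n))); [ring|].
  rewrite IH. ring.
Qed.

Lemma Cmul_eq0 a b : Cmul a b = C0 -> a <> C0 -> b = C0.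
Proof.
  intros H Ha. apply Cnorm2_eq0. assert (Cnorm2 (Cmul a b) = 0) by (rewrite H; unfold Cnorm2; simpl; ring).
  rewrite Cnorm2_mul in H0. apply Rmult_integral in H0 as [H0|H0]; [|exact H0].
  elim Ha; apply Cnorm2_eq0, H0.
Qed.

Definition cis (t : R) : C := mkC (cos t) (sin t).

Lemma Cnorm2_cis t : Cnorm2 (cis t) = 1.
Proof. unfold Cnorm2, cis; simpl. pose proof (sin2_cos2 t). unfold Rsqr in H. lra. Qed.

Lemma cis_add s t : cis (s + t) = Cmul (cis s) (cis t).
Proof. unfold cis. rewrite cos_plus, sin_plus. c_ring. Qed.

Lemma cis_pow t k : Cpow (cis t) k = cis (INR k * t).
Proof.
  induction k as [|k IH].
  - simpl. rewrite Rmult_0_l. unfold cis. rewrite cos_0, sin_0. reflexivity.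
  - simpl Cpow. rewrite IH, <- cis_add. f_equal. rewrite S_INR. ring.
Qed.

Lemma cis_neq1 t : 0 < t < 2 * PI -> cis t <> C1.
Proof.
  intros Ht H. apply (f_equal Cre) in H. simpl in H.
  replace t with (2 * (t / 2)) in H by field. rewrite cos_2a_sin in H.
  assert (0 < sin (t / 2)) by (apply sin_gt_0; lra). nra.
Qed.

Lemma cis_2PI_mul k : cis (INR k * (2 * PI)) = C1.
Proof.
  rewrite <- cis_pow. unfold cis. rewrite cos_2PI, sin_2PI.
  change (mkC 1 0) with C1. induction k as [|k IH]; simpl; [|rewrite IH]; c_ring.
Qed.

Definition root (L k : nat) : C := cis (2 * PI * INR k / INR L).

Lemma Cnorm2_root L k : Cnorm2 (root L k) = 1.
Proof. apply Cnorm2_cis. Qed.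

Lemma Cconj_pow_mul_pow z d : Cnorm2 z = 1 -> Cmul (Cpow z d) (Cpow (Cconj z) d) = C1.
Proof.
  intros H. rewrite <- Cpow_mul_base, Cmul_conj, H.
  induction d as [|d IH]; simpl; [|rewrite IH]; unfold RtoC; c_ring.
Qed.

Lemma root_sum_pow L d : (0 < d < L)%nat -> csum (fun k => Cpow (root L k) d) L = C0.
Proof.
  intros Hd. assert (HL : 0 < INR L) by (apply lt_0_INR; lia).
  set (w := cis (2 * PI * INR d / INR L)).
  rewrite (csum_ext _ (Cpow w)).
  - apply (Cmul_eq0 (Csub w C1)).
    + rewrite geometric_sum. unfold w. rewrite cis_pow.
      replace (INR L * (2 * PI * INR d / INR L)) with (INR d * (2 * PI)) by (field; lra).
      rewrite cis_2PI_mul. ring.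
    + intros H. apply (cis_neq1 (2 * PI * INR d / INR L)).
      * assert (0 < INR d) by (apply lt_0_INR; lia).
        assert (INR d < INR L) by (apply lt_INR; lia). pose proof PI_RGT_0. split.
        -- apply Rdiv_lt_0_compat; nra.
        -- apply (Rmult_lt_reg_r (INR L)); [lra|].
           unfold Rdiv. rewrite Rmult_assoc, Rinv_l by lra. nra.
      * fold w. transitivity (Cadd (Csub w C1) C1); [ring|rewrite H; ring].
  - intros k _. unfold root, w. rewrite !cis_pow. f_equal. field; lra.
Qed.

(** The hypotheses say [|u - v| < L], so that no two distinct exponents agree modulo L. The case
    [u < v] is the conjugate of the case [v < u]. *)
Lemma root_orthogonal L u v : (u < v + L)%nat -> (v < u + L)%nat ->
  csum (fun k => Cmul (Cpow (root L k) u) (Cpow (Cconj (root L k)) v)) L =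
  if Nat.eqb u v then RtoC (INR L) else C0.
Proof.
  intros Hu Hv.
  assert (H : forall u v, (v < u < v + L)%nat ->
    csum (fun k => Cmul (Cpow (root L k) u) (Cpow (Cconj (root L k)) v)) L = C0).
  { clear. intros u v H. rewrite <- (root_sum_pow L (u - v)) by lia.
    apply csum_ext; intros k _. replace u with ((u - v) + v)%nat at 1 by lia.
    rewrite Cpow_add. pose proof (Cconj_pow_mul_pow (root L k) v (Cnorm2_root L k)) as E.
    transitivity (Cmul (Cpow (root L k) (u - v))
      (Cmul (Cpow (root L k) v) (Cpow (Cconj (root L k)) v))); [ring|rewrite E; ring]. }
  destruct (Nat.eqb_spec u v) as [->|Hn].
  - rewrite (csum_ext _ (fun _ => C1)).
    + rewrite csum_const. unfold RtoC; c_ring.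
    + intros k _; apply Cconj_pow_mul_pow, Cnorm2_root.
  - destruct (Nat.lt_ge_cases v u); [apply H; lia|].
    rewrite <- (Cconj_conj (csum _ L)), csum_conj.
    rewrite (csum_ext _ (fun k => Cmul (Cpow (root L k) v) (Cpow (Cconj (root L k)) u))).
    + rewrite H by lia. c_ring.
    + intros k _. rewrite Cconj_mul, !Cconj_pow, Cconj_conj. ring.
Qed.

(** Finite Fourier analysis with vector coefficients. Averaging over roots of unity takes the place
    of integration over the circle. *)
Lemma parseval {K : PH} L (y : nat -> K) :
  rsum (fun k => q (vsum (fun l => vscal (Cpow (Cconj (root L k)) l) (y l)) L)) L =
  INR L * rsum (fun l => q (y l)) L.
Proof.
  transitivity (rsum (fun l => rsum (fun l' => rsum (fun k =>
     ip (y l) (vscal (Cmul (Cpow (root L k) l) (Cpow (Cconj (root L k)) l')) (y l'))) L) L) L).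
  - rewrite (rsum_ext _ (fun k => rsum (fun l => rsum (fun l' =>
     ip (y l) (vscal (Cmul (Cpow (root L k) l) (Cpow (Cconj (root L k)) l')) (y l'))) L) L)).
    + rewrite rsum_swap. apply rsum_ext; intros l _. apply rsum_swap.
    + intros k _. unfold q. rewrite ip_vsum. apply rsum_ext; intros l _.
      rewrite ip_vsum_r. apply rsum_ext; intros l' _.
      rewrite ip_adj, vscal_assoc, Cconj_pow, Cconj_conj. reflexivity.
  - rewrite <- rsum_scal. apply rsum_ext; intros l Hl.
    rewrite (rsum_ext _ (fun l' => if Nat.eqb l l' then INR L * q (y l') else 0)).
    + rewrite rsum_delta by exact Hl. reflexivity.
    + intros l' Hl'. rewrite <- ip_vsum_r, <- vscal_csum, root_orthogonal by lia.
      destruct (Nat.eqb_spec l l') as [->|].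
      * rewrite ip_real_r. reflexivity.
      * rewrite vscal_0, ip_z_r. reflexivity.
Qed.

(** * Transfer from the torus to commuting isometries *)

Definition contraction {K : PH} (T : K -> K) : Prop := is_lin T /\ forall x, q (T x) <= q x.
Definition isometry {K : PH} (V : K -> K) : Prop := is_lin V /\ forall x, q (V x) = q x.

Lemma isometry_contraction {K : PH} (V : K -> K) : isometry V -> contraction V.
Proof. intros [H H']; split; [exact H|]. intros x; rewrite H'; lra. Qed.

Lemma unimodular_isometry {K : PH} z : Cnorm2 z = 1 -> isometry (vscal z : K -> K).
Proof.
  intros H; split; [apply lin_scal|]. intros x; rewrite q_scal, H; ring.
Qed.

Lemma iter_is_lin {K : PH} (A : K -> K) l : is_lin A -> is_lin (Nat.iter l A).
Proof.
  intros HA; induction l as [|l IH]; simpl; [split; reflexivity|].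
  apply (lin_comp _ A IH HA).
Qed.

(* Elements of a free module over C[z1, z2]; [MX true] is multiplication by z1 and
   [MX false] multiplication by z2. *)
Inductive mexp :=
  | MVar (j : nat) | MZero | MAdd (e f : mexp) | MScal (c : C) (e : mexp) | MX (b : bool) (e : mexp).

Fixpoint eval {K : PH} (A : bool -> K -> K) (x : nat -> K) (e : mexp) : K :=
  match e with
  | MVar j => x j
  | MZero => vz
  | MAdd e f => vadd (eval A x e) (eval A x f)
  | MScal c e => vscal c (eval A x e)
  | MX b e => A b (eval A x e)
  end.

Lemma eval_map {K L : PH} (h : K -> L) A B x e :
  is_lin h -> (forall b y, h (A b y) = B b (h y)) ->
  h (eval A x e) = eval B (fun j => h (x j)) e.
Proof.
  intros Hl Hc. induction e as [j| |e IHe f IHf|c e IH|b e IH]; simpl.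
  - reflexivity.
  - apply lin_z, Hl.
  - rewrite (proj1 Hl), IHe, IHf; reflexivity.
  - rewrite (proj2 Hl), IH; reflexivity.
  - rewrite Hc, IH; reflexivity.
Qed.

Lemma eval_ext {K : PH} A B (x y : nat -> K) e :
  (forall b z, A b z = B b z) -> (forall j, x j = y j) -> eval A x e = eval B y e.
Proof.
  intros HA Hx. induction e as [j| |e IHe f IHf|c e IH|b e IH]; simpl;
    rewrite ?IHe, ?IHf, ?IH, ?Hx, ?HA; reflexivity.
Qed.

(** One bound serves all contractions, in particular all scalars [z] of the circle at once. *)
Lemma eval_bound {K : PH} (x : nat -> K) e :
  exists B, forall A, (forall b, contraction (A b)) -> q (eval A x e) <= B.
Proof.
  induction e as [j| |e [B HB] f [B' HB']|c e [B HB]|b e [B HB]]; simpl.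
  - exists (q (x j)); intros; lra.
  - exists 0; intros; rewrite q_z; lra.
  - exists (2 * B + 2 * B'); intros A HA. specialize (HB A HA). specialize (HB' A HA).
    pose proof (q_add_le (eval A x e) (eval A x f)). lra.
  - exists (Cnorm2 c * B); intros A HA. rewrite q_scal.
    apply Rmult_le_compat_l; [apply Cnorm2_ge0|apply HB, HA].
  - exists B; intros A HA. eapply Rle_trans; [apply HA|apply HB, HA].
Qed.

(** [V] sits in the slot [b0] and [U] in the other one, so that a single argument can replace either
    of the two variables by a scalar. *)
Definition with_op {K : PH} (b0 : bool) (V U : K -> K) (b : bool) : K -> K :=
  if Bool.eqb b b0 then V else U.

Section Transfer.
Context {K : PH} (V : K -> K).
Hypothesis HV : isometry V.

(* An approximate eigenvector of [V] for the eigenvalue [z]: the defect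
   [V X - z X] stays bounded while the mean square of X over z is of order L. *)
Definition wave (z : C) (L : nat) (y : K) : K :=
  vsum (fun l => vscal (Cpow (Cconj z) l) (Nat.iter l V y)) L.

Lemma wave_lin z L : is_lin (wave z L).
Proof.
  unfold wave. split; intros.
  - rewrite <- vsum_add. apply vsum_ext; intros l _. rewrite (proj1 (iter_is_lin V l (proj1 HV))). v_ring.
  - rewrite (lin_vsum _ _ _ (lin_scal c)). apply vsum_ext; intros l _.
    rewrite (proj2 (iter_is_lin V l (proj1 HV))). v_ring.
Qed.

Lemma wave_commute (U : K -> K) z L y :
  is_lin U -> (forall w, U (V w) = V (U w)) -> wave z L (U y) = U (wave z L y).
Proof.
  intros HU Hc. unfold wave. rewrite (lin_vsum _ _ _ HU). apply vsum_ext; intros l _.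
  rewrite (proj2 HU). f_equal. induction l as [|l IH]; simpl; [reflexivity|].
  rewrite IH, Hc; reflexivity.
Qed.

(** The difference telescopes to its two end terms, [z (conj z ^ L V^L y - y)], whose size does not
    depend on L. *)
Lemma wave_defect z L y : Cnorm2 z = 1 ->
  q (vsub (V (wave z L y)) (vscal z (wave z L y))) <= 4 * q y.
Proof.
  intros Hz.
  assert (E : vsub (V (wave z L y)) (vscal z (wave z L y)) =
              vscal z (vsub (vscal (Cpow (Cconj z) L) (Nat.iter L V y)) y)).
  { induction L as [|L IH].
    - unfold wave; simpl. rewrite (lin_z V (proj1 HV)). v_ring.
    - unfold wave in *; simpl. rewrite (proj1 (proj1 HV)), (proj2 (proj1 HV)).
      set (w := vsum _ L) in *. set (u := Nat.iter L V y) in *.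
      transitivity (vadd (vsub (V w) (vscal z w))
         (vsub (vscal (Cpow (Cconj z) L) (V u)) (vscal z (vscal (Cpow (Cconj z) L) u)))).
      + v_ring.
      + rewrite IH. set (c := Cpow (Cconj z) L).
        assert (Hc : c = Cmul z (Cmul (Cconj z) c)).
        { transitivity (Cmul (Cmul z (Cconj z)) c); [rewrite Cmul_conj, Hz; unfold RtoC; c_ring|ring]. }
        rewrite Hc at 2. v_ring. }
  rewrite E, q_scal, Hz, Rmult_1_l.
  unfold vsub. eapply Rle_trans; [apply q_add_le|].
  rewrite q_opp, q_scal, Cnorm2_pow, Cnorm2_conj, Hz, pow1.
  assert (forall l, q (Nat.iter l V y) = q y) as ->; [|lra].
  induction l as [|l IH]; simpl; [reflexivity|]. rewrite (proj2 HV); exact IH.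
Qed.

Variable U : K -> K.
Hypothesis HU : contraction U.
Hypothesis HUV : forall y, U (V y) = V (U y).
Variable b0 : bool.

(** The wave map commutes with [U] and nearly turns [V] into [z]. Each occurrence of [V] in [e] adds
    one more defect, so the total is bounded independently of [z] and L. *)
Lemma wave_eval_defect (x : nat -> K) e :
  exists B, forall z L, Cnorm2 z = 1 ->
    q (vsub (wave z L (eval (with_op b0 V U) x e))
            (wave z L (eval (with_op b0 (vscal z) U) x e))) <= B.
Proof.
  induction e as [j| |e [B HB] f [B' HB']|c e [B HB]|b e [B HB]].
  - exists 0; intros z L _. simpl. replace (vsub _ _) with (vz : K) by v_ring. rewrite q_z; lra.
  - exists 0; intros z L _. simpl. replace (vsub _ _) with (vz : K) by v_ring. rewrite q_z; lra.
  - exists (2 * B + 2 * B'); intros z L Hz. specialize (HB z L Hz). specialize (HB' z L Hz).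
    simpl. rewrite !(proj1 (wave_lin z L)).
    set (u := wave z L (eval (with_op b0 V U) x e)) in *.
    set (u' := wave z L (eval (with_op b0 (vscal z) U) x e)) in *.
    set (v := wave z L (eval (with_op b0 V U) x f)) in *.
    set (v' := wave z L (eval (with_op b0 (vscal z) U) x f)) in *.
    replace (vsub (vadd u v) (vadd u' v')) with (vadd (vsub u u') (vsub v v')) by v_ring.
    pose proof (q_add_le (vsub u u') (vsub v v')). lra.
  - exists (Cnorm2 c * B); intros z L Hz. specialize (HB z L Hz).
    simpl. rewrite !(proj2 (wave_lin z L)).
    rewrite <- lin_sub by apply lin_scal.
    rewrite q_scal. apply Rmult_le_compat_l; [apply Cnorm2_ge0|exact HB].
  - destruct (eval_bound x e) as [B' HB'].
    (* [2 B] is the inherited defect, and [8 B'] is twice the bound [4 B'] from [wave_defect]. *)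
    exists (2 * B + 8 * B'); intros z L Hz. specialize (HB z L Hz).
    assert (Hw : q (eval (with_op b0 (vscal z) U) x e) <= B').
    { apply HB'. intros b'; unfold with_op; destruct (Bool.eqb b' b0); [|exact HU].
      apply isometry_contraction, unimodular_isometry, Hz. }
    pose proof (q_ge0 (eval (with_op b0 (vscal z) U) x e)).
    cbn [eval]. unfold with_op at 1 3. destruct (Bool.eqb b b0).
    + set (y := eval (with_op b0 V U) x e) in *. set (w := eval (with_op b0 (vscal z) U) x e) in *.
      rewrite (wave_commute V) by (reflexivity || apply HV).
      rewrite (wave_commute (vscal z)) by (apply lin_scal || (intros; symmetry; apply HV)).
      replace (vsub _ _) with
        (vadd (V (vsub (wave z L y) (wave z L w)))
              (vsub (V (wave z L w)) (vscal z (wave z L w)))).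
      * eapply Rle_trans; [apply q_add_le|]. rewrite (proj2 HV).
        pose proof (wave_defect z L w Hz). lra.
      * rewrite (lin_sub V) by apply HV. v_ring.
    + rewrite !(wave_commute U) by (apply HU || exact HUV).
      rewrite <- (lin_sub U) by apply HU.
      eapply Rle_trans; [apply HU|]. pose proof (q_ge0
        (vsub (wave z L (eval (with_op b0 V U) x e)) (wave z L (eval (with_op b0 (vscal z) U) x e)))).
      lra.
Qed.

Lemma wave_eval_defect_sum (x : nat -> K) (F : nat -> mexp) n :
  exists B, forall z L, Cnorm2 z = 1 ->
    rsum (fun i => q (vsub (wave z L (eval (with_op b0 V U) x (F i)))
            (wave z L (eval (with_op b0 (vscal z) U) x (F i))))) n <= B.
Proof.
  induction n as [|n [B HB]]; simpl; [exists 0; intros; lra|].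
  destruct (wave_eval_defect x (F n)) as [B' HB'].
  exists (B + B'); intros z L Hz. specialize (HB z L Hz). specialize (HB' z L Hz). lra.
Qed.

(** By Parseval, as all [V^l y] have the norm of [y]. This sum is quadratic in L, whereas L bounded
    defects add up to order L only. *)
Lemma wave_mean_square L y : rsum (fun k => q (wave (root L k) L y)) L = INR L * (INR L * q y).
Proof.
  unfold wave. rewrite parseval. f_equal. rewrite <- rsum_const. apply rsum_ext; intros l _.
  induction l as [|l IH]; simpl; [reflexivity|]. rewrite (proj2 HV); exact IH.
Qed.

Lemma archimedean_le a D : (forall L, (0 < L)%nat -> INR L * a <= D) -> a <= 0.
Proof.
  intros H. destruct (Rle_dec a 0) as [|Hn]; [assumption|exfalso].
  destruct (INR_unbounded (D / a)) as [N HN].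
  assert (D < INR N * a).
  { apply (Rmult_lt_compat_r a) in HN; [|lra]. unfold Rdiv in HN.
    rewrite Rmult_assoc, Rinv_l in HN by lra. lra. }
  destruct N as [|N]; [specialize (H 1%nat ltac:(lia)); simpl in *; lra|].
  specialize (H (S N) ltac:(lia)). lra.
Qed.

(** The factor [1 + eta] is squared because each application loses it twice, once on either side of
    the inequality being transferred. *)
Lemma le_of_le_mul_eta a b : 0 <= b ->
  (forall eta, 0 < eta < 1 -> a <= (1 + eta) * ((1 + eta) * b)) -> a <= b.
Proof.
  intros Hb H. apply Rnot_lt_le; intros Hlt.
  set (eta := Rmin (1 / 2) ((a - b) / (6 * (b + 1)))).
  assert (0 < (a - b) / (6 * (b + 1))) by (apply Rdiv_lt_0_compat; lra).
  assert (0 < eta) by (unfold eta; apply Rmin_glb_lt; lra).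
  assert (eta <= 1 / 2) by apply Rmin_l.
  assert (eta * (6 * (b + 1)) <= a - b).
  { apply Rle_trans with ((a - b) / (6 * (b + 1)) * (6 * (b + 1))).
    - apply Rmult_le_compat_r; [lra|apply Rmin_r].
    - right; field; lra. }
  specialize (H eta ltac:(lra)). nra.
Qed.

(** The hypothesis is applied to the waves [wave z L (x j)], on which [V] may be exchanged for [z]
    at a bounded cost. Summed over the L-th roots of unity, the two sides become L^2 times the
    desired quantities and the errors are of order L; let L grow, then let [eta] tend to 0. *)
Lemma transfer_one (F G : nat -> mexp) n :
  (forall z, Cnorm2 z = 1 -> forall x,
     rsum (fun i => q (eval (with_op b0 (vscal z) U) x (F i))) n <=
     rsum (fun i => q (eval (with_op b0 (vscal z) U) x (G i))) n) ->
  forall x, rsum (fun i => q (eval (with_op b0 V U) x (F i))) n <=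
            rsum (fun i => q (eval (with_op b0 V U) x (G i))) n.
Proof.
  intros H x.
  destruct (wave_eval_defect_sum x F n) as [B HB].
  destruct (wave_eval_defect_sum x G n) as [B' HB'].
  set (SF := rsum (fun i => q (eval (with_op b0 V U) x (F i))) n).
  set (SG := rsum (fun i => q (eval (with_op b0 V U) x (G i))) n).
  assert (Hmean : forall L (E : nat -> mexp),
    rsum (fun k => rsum (fun i => q (wave (root L k) L (eval (with_op b0 V U) x (E i)))) n) L =
    INR L * (INR L * rsum (fun i => q (eval (with_op b0 V U) x (E i))) n)).
  { intros L E. rewrite rsum_swap, <- !rsum_scal. apply rsum_ext; intros i _.
    apply wave_mean_square. }
  apply le_of_le_mul_eta.
  { apply rsum_ge0; intros; apply q_ge0. }
  intros eta He. apply Rminus_le.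
  apply (archimedean_le _ ((1 + eta) * ((1 + / eta) * B') + (1 + / eta) * B)).
  intros L HL. assert (HLr : 0 < INR L) by (apply lt_0_INR; exact HL).
  apply (Rmult_le_reg_l (INR L)); [exact HLr|].
  assert (Hp : forall k,
    rsum (fun i => q (wave (root L k) L (eval (with_op b0 V U) x (F i)))) n <=
    (1 + eta) * ((1 + eta) * rsum (fun i => q (wave (root L k) L (eval (with_op b0 V U) x (G i)))) n)
    + ((1 + eta) * ((1 + / eta) * B') + (1 + / eta) * B)).
  { intros k. set (z := root L k). assert (Hz : Cnorm2 z = 1) by apply Cnorm2_root.
    assert (Hie : 0 < / eta) by (apply Rinv_0_lt_compat; lra).
    assert (Hcmp : forall (u v : nat -> K) D,
      rsum (fun i => q (vsub (u i) (v i))) n <= D ->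
      rsum (fun i => q (u i)) n <= (1 + eta) * rsum (fun i => q (v i)) n + (1 + / eta) * D).
    { intros u v D HD. apply Rle_trans with
        (rsum (fun i => (1 + eta) * q (v i) + (1 + / eta) * q (vsub (u i) (v i))) n).
      - apply rsum_le; intros i _. replace (u i) with (vadd (v i) (vsub (u i) (v i))) at 1 by v_ring.
        apply q_young; lra.
      - rewrite rsum_add, !rsum_scal. apply Rplus_le_compat_l, Rmult_le_compat_l; lra. }
    assert (Hw : forall E, wave z L (eval (with_op b0 (vscal z) U) x E) =
       eval (with_op b0 (vscal z) U) (fun j => wave z L (x j)) E).
    { intros E. apply eval_map; [apply wave_lin|]. intros b y; unfold with_op.
      destruct (Bool.eqb b b0); [apply (proj2 (wave_lin z L))|].
      apply wave_commute; [apply HU|exact HUV]. }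
    pose proof (Hcmp _ _ _ (HB z L Hz)) as H1.
    assert (H2 : rsum (fun i => q (wave z L (eval (with_op b0 (vscal z) U) x (F i)))) n <=
                 rsum (fun i => q (wave z L (eval (with_op b0 (vscal z) U) x (G i)))) n).
    { rewrite (rsum_ext (fun i => q (wave z L (eval (with_op b0 (vscal z) U) x (F i))))
        (fun i => q (eval (with_op b0 (vscal z) U) (fun j => wave z L (x j)) (F i))))
        by (intros; rewrite Hw; reflexivity).
      rewrite (rsum_ext (fun i => q (wave z L (eval (with_op b0 (vscal z) U) x (G i))))
        (fun i => q (eval (with_op b0 (vscal z) U) (fun j => wave z L (x j)) (G i))))
        by (intros; rewrite Hw; reflexivity).
      apply H, Hz. }
    assert (H3 : rsum (fun i => q (wave z L (eval (with_op b0 (vscal z) U) x (G i)))) n <=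
      (1 + eta) * rsum (fun i => q (wave z L (eval (with_op b0 V U) x (G i)))) n + (1 + / eta) * B').
    { apply Hcmp. erewrite rsum_ext; [apply (HB' z L Hz)|]. intros i _; apply q_sub_sym. }
    set (a1 := rsum (fun i => q (wave z L (eval (with_op b0 (vscal z) U) x (F i)))) n) in *.
    set (a2 := rsum (fun i => q (wave z L (eval (with_op b0 (vscal z) U) x (G i)))) n) in *.
    apply Rle_trans with ((1 + eta) * a1 + (1 + / eta) * B); [exact H1|].
    rewrite <- Rplus_assoc. apply Rplus_le_compat_r. rewrite <- Rmult_plus_distr_l.
    apply Rmult_le_compat_l; lra. }
  assert (Hs := rsum_le _ _ L (fun k _ => Hp k)). cbv beta in Hs.
  rewrite Hmean, rsum_add, !rsum_scal, Hmean, rsum_const in Hs.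
  fold SF SG in Hs. lra.
Qed.
End Transfer.

(** One variable is treated at a time: [V2] is exchanged for a scalar in the presence of the
    contraction [V1], then [V1] in the presence of that scalar. *)
Theorem transfer {K : PH} (V1 V2 : K -> K) (F G : nat -> mexp) n :
  isometry V1 -> isometry V2 -> (forall x, V1 (V2 x) = V2 (V1 x)) ->
  (forall z1 z2, Cnorm2 z1 = 1 -> Cnorm2 z2 = 1 -> forall x : nat -> K,
     rsum (fun i => q (eval (with_op true (vscal z1) (vscal z2)) x (F i))) n <=
     rsum (fun i => q (eval (with_op true (vscal z1) (vscal z2)) x (G i))) n) ->
  forall x, rsum (fun i => q (eval (with_op true V1 V2) x (F i))) n <=
            rsum (fun i => q (eval (with_op true V1 V2) x (G i))) n.
Proof.
  intros H1 H2 Hc H.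
  assert (Hsw : forall (A B : K -> K) (x : nat -> K) e,
    eval (with_op true A B) x e = eval (with_op false B A) x e).
  { intros; apply eval_ext; [|reflexivity]. intros [|] y; reflexivity. }
  assert (Hstep : forall x,
    rsum (fun i => q (eval (with_op false V2 V1) x (F i))) n <=
    rsum (fun i => q (eval (with_op false V2 V1) x (G i))) n).
  { apply transfer_one; [exact H2|apply isometry_contraction, H1|exact Hc|].
    intros z2 Hz2 x.
    rewrite (rsum_ext _ (fun i => q (eval (with_op true V1 (vscal z2)) x (F i))))
      by (intros; rewrite Hsw; reflexivity).
    rewrite (rsum_ext (fun i => q (eval (with_op false (vscal z2) V1) x (G i)))
      (fun i => q (eval (with_op true V1 (vscal z2)) x (G i))))
      by (intros; rewrite Hsw; reflexivity).
    revert x. apply transfer_one; [exact H1| |intros; symmetry; apply (proj1 H1)|].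
    - apply isometry_contraction, unimodular_isometry, Hz2.
    - intros z1 Hz1 x. apply H; assumption. }
  intros x. rewrite (rsum_ext _ (fun i => q (eval (with_op false V2 V1) x (F i))))
    by (intros; rewrite Hsw; reflexivity).
  rewrite (rsum_ext (fun i => q (eval (with_op true V1 V2) x (G i)))
    (fun i => q (eval (with_op false V2 V1) x (G i))))
    by (intros; rewrite Hsw; reflexivity).
  apply Hstep.
Qed.

(** * Riesz representation *)

Definition cauchy {H : PH} (u : nat -> H) : Prop :=
  forall eps, 0 < eps -> exists N, forall a b, (N <= a)%nat -> (N <= b)%nat ->
    q (vsub (u a) (u b)) < eps.
Definition converges {H : PH} (u : nat -> H) (l : H) : Prop :=
  forall eps, 0 < eps -> exists N, forall a, (N <= a)%nat -> q (vsub (u a) l) < eps.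
Definition complete (H : PH) : Prop := forall u : nat -> H, cauchy u -> exists l, converges u l.
Definition definite (H : PH) : Prop := forall x : H, q x = 0 -> x = vz.

Lemma definite_eq {H : PH} (x y : H) : definite H -> q (vsub x y) = 0 -> x = y.
Proof.
  intros Hd H0. apply Hd in H0. transitivity (vadd (vsub x y) y); [v_ring|].
  rewrite H0. v_ring.
Qed.

Lemma inv_S_lt eps : 0 < eps -> exists N, forall n, (N <= n)%nat -> / INR (S n) < eps.
Proof.
  intros He. destruct (INR_unbounded (/ eps)) as [N HN]. exists N. intros n Hn.
  assert (0 < / eps) by (apply Rinv_0_lt_compat; exact He).
  rewrite <- (Rinv_inv eps). apply Rinv_lt_contravar.
  - apply Rmult_lt_0_compat; [assumption|apply lt_0_INR; lia].
  - eapply Rlt_le_trans; [exact HN|apply le_INR; lia].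
Qed.

Lemma le_of_lt_eps a b c : 0 <= c -> (forall eps, 0 < eps -> a <= b + c * eps) -> a <= b.
Proof.
  intros Hc H. apply Rnot_lt_le; intros Hlt.
  specialize (H ((a - b) / (2 * (c + 1)))).
  assert (Hp : 0 < (a - b) / (2 * (c + 1))) by (apply Rdiv_lt_0_compat; lra).
  specialize (H Hp).
  assert ((a - b) / (2 * (c + 1)) * (2 * (c + 1)) = a - b) by (field; lra). nra.
Qed.

(** The representing vector is the limit of a minimising sequence of [J x = q x - 2 l x]. *)
Lemma riesz (H : PH) (l : H -> R) B :
  complete H -> 0 <= B ->
  (forall x y, l (vadd x y) = l x + l y) -> (forall r x, l (vscal (RtoC r) x) = r * l x) ->
  (forall x, l x * l x <= B * q x) ->
  exists v, forall k, l k = ip v k.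
Proof.
  intros Hc HB Ha Hs Hb. set (J := fun x : H => q x - 2 * l x).
  destruct (completeness (fun r => exists x, r = - J x)) as [s [Hub Hlub]].
  (* [J >= -B], because [4 (l x)^2 <= 4 B q x <= (B + q x)^2]. *)
  { exists B. intros r [x ->]. unfold J. specialize (Hb x). pose proof (q_ge0 x).
    apply Rnot_lt_le; intros Hlt. assert (B + q x < 2 * l x) by lra.
    pose proof (Rle_0_sqr (B - q x)). unfold Rsqr in *. nra. }
  { exists (- J vz), vz; reflexivity. }
  assert (Hm : forall x, - s <= J x).
  { intros x. specialize (Hub (- J x) (ex_intro _ x eq_refl)). lra. }
  assert (Hinf : forall eps, 0 < eps -> exists x, J x < - s + eps).
  { intros eps He. apply NNPP. intros Hn. specialize (Hlub (s - eps)).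
    assert (is_upper_bound (fun r => exists x, r = - J x) (s - eps)).
    { intros r [x ->]. apply Rnot_lt_le; intros Hlt. apply Hn; exists x; lra. }
    specialize (Hlub H0). lra. }
  assert (Hu : exists u : nat -> H, forall n, J (u n) < - s + / INR (S n)).
  { assert (forall n, {x | J x < - s + / INR (S n)}).
    { intros n. apply constructive_indefinite_description, Hinf, Rinv_0_lt_compat, lt_0_INR; lia. }
    exists (fun n => proj1_sig (X n)); intros n; exact (proj2_sig (X n)). }
  destruct Hu as [u Hu].
  (* The parallelogram law, with [J] bounded below at the midpoint, makes minimising sequences
     Cauchy. *)
  assert (Hpar : forall x y, q (vsub x y) <= 2 * (J x + s) + 2 * (J y + s)).
  { intros x y. pose proof (Hm (vscal (RtoC (1 / 2)) (vadd x y))) as H0. unfold J in *.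
    rewrite q_scal, Hs, Ha, q_add in H0. unfold Cnorm2 in H0; simpl in H0.
    unfold vsub. rewrite q_add, q_opp, ip_opp_r. lra. }
  destruct (Hc u) as [v Hv].
  { intros eps He. destruct (inv_S_lt (eps / 4)) as [N HN]; [lra|]. exists N. intros a b Ha' Hb'.
    specialize (Hpar (u a) (u b)). pose proof (Hu a). pose proof (Hu b).
    pose proof (HN a Ha'). pose proof (HN b Hb'). lra. }
  exists v. intros k.
  assert (Hvar : forall x, (ip x k - l k) * (ip x k - l k) <= (J x + s) * q k).
  { intros x. apply quadratic_discriminant; [|apply q_ge0]. intros t.
    pose proof (Hm (vadd x (vscal (RtoC t) k))) as H0. unfold J in *.
    rewrite q_add, q_scal, Ha, Hs, ip_real_r in H0. unfold Cnorm2 in H0; simpl in H0. lra. }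
  assert ((ip v k - l k) * (ip v k - l k) <= 0); [|nra].
  apply (le_of_lt_eps _ _ (4 * q k)); [pose proof (q_ge0 k); lra|].
  intros eps He. destruct (Hv eps He) as [N HN]. destruct (inv_S_lt eps He) as [N' HN'].
  set (n := (N + N')%nat). specialize (HN n ltac:(lia)). specialize (HN' n ltac:(lia)).
  specialize (Hu n). specialize (Hvar (u n)).
  pose proof (cauchy_schwarz (vsub (u n) v) k) as Hcs.
  assert (E : ip (vsub (u n) v) k = ip (u n) k - ip v k) by (unfold vsub; rewrite ip_add, ip_opp; ring).
  rewrite E in Hcs. pose proof (q_ge0 k).
  assert ((J (u n) + s) * q k <= eps * q k) by (apply Rmult_le_compat_r; lra).
  assert (q (vsub (u n) v) * q k <= eps * q k) by (apply Rmult_le_compat_r; lra).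
  set (a := ip (u n) k) in *. set (b := ip v k) in *. set (c := l k) in *.
  assert ((b - c) * (b - c) <= 2 * ((a - b) * (a - b)) + 2 * ((a - c) * (a - c))); [|lra].
  pose proof (Rle_0_sqr (2 * a - b - c)). unfold Rsqr in *. lra.
Qed.

(** * Constructions of spaces *)

Definition prod_space (K L : PH) : PH.
Proof.
  refine {| car := (K * L)%type; vz := (vz, vz);
    vadd := fun x y => (vadd (fst x) (fst y), vadd (snd x) (snd y));
    vopp := fun x => (vopp (fst x), vopp (snd x));
    vscal := fun c x => (vscal c (fst x), vscal c (snd x));
    ip := fun x y => ip (fst x) (fst y) + ip (snd x) (snd y) |}.
  - intros; f_equal; apply vadd_assoc.
  - intros; f_equal; apply vadd_comm.
  - intros [x y]; simpl; f_equal; apply vadd_0.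
  - intros; f_equal; apply vadd_opp.
  - intros [x y]; simpl; f_equal; apply vscal_1.
  - intros; simpl; f_equal; apply vscal_assoc.
  - intros; simpl; f_equal; apply vscal_distr_v.
  - intros; simpl; f_equal; apply vscal_distr_s.
  - intros; simpl; rewrite !ip_add; ring.
  - intros; f_equal; apply ip_sym.
  - intros; simpl; rewrite !ip_real; ring.
  - intros; simpl; f_equal; apply ip_adj.
  - intros; simpl; apply Rplus_le_le_0_compat; apply ip_pos.
Defined.

(* [K] with the form <x, y> - <Tx, Ty>: this replaces the range of the defect
   operator (1 - T*T)^(1/2), so that no adjoint or square root is needed. *)
Definition defect_space (K : PH) (T : K -> K) (HT : contraction T) : PH.
Proof.
  refine {| car := K; vz := vz; vadd := vadd; vopp := vopp; vscal := vscal;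
    ip := fun x y => ip x y - ip (T x) (T y) |}; intros.
  - apply vadd_assoc.
  - apply vadd_comm.
  - apply vadd_0.
  - apply vadd_opp.
  - apply vscal_1.
  - apply vscal_assoc.
  - apply vscal_distr_v.
  - apply vscal_distr_s.
  - rewrite (proj1 (proj1 HT)), !ip_add; ring.
  - rewrite (ip_sym _ x), (ip_sym _ (T x)); ring.
  - rewrite (proj2 (proj1 HT)), !ip_real; ring.
  - rewrite !(proj2 (proj1 HT)), !ip_adj; ring.
  - pose proof (proj2 HT x). unfold q in H. lra.
Defined.

(** This stands for the range of [z], parametrised by [H]. When [z] is bounded above and below,
    completeness of [H] carries over, and [riesz] then plays the part of the orthogonal projection
    onto the range. *)
Definition pullback_space (H Q : PH) (z : H -> Q) (Hz : is_lin z) : PH.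
Proof.
  refine {| car := H; vz := vz; vadd := vadd; vopp := vopp; vscal := vscal;
    ip := fun x y => ip (z x) (z y) |}; intros.
  - apply vadd_assoc.
  - apply vadd_comm.
  - apply vadd_0.
  - apply vadd_opp.
  - apply vscal_1.
  - apply vscal_assoc.
  - apply vscal_distr_v.
  - apply vscal_distr_s.
  - rewrite (proj1 Hz), !ip_add; ring.
  - apply ip_sym.
  - rewrite (proj2 Hz), !ip_real; ring.
  - rewrite !(proj2 Hz), !ip_adj; ring.
  - apply ip_pos.
Defined.

(** Finitely supported sequences replace square summable ones, so the form is a finite sum. The
    dilation needs only shifts and blockwise maps, which preserve finite support. *)
Definition finite_seq (Q : PH) : Type := {s : nat -> Q | exists n, forall i, (n <= i)%nat -> s i = vz}.

Definition seq_bound {Q : PH} (s : finite_seq Q) : nat :=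
  proj1_sig (constructive_indefinite_description _ (proj2_sig s)).

Lemma seq_bound_spec {Q : PH} (s : finite_seq Q) i :
  (seq_bound s <= i)%nat -> proj1_sig s i = vz.
Proof. unfold seq_bound. destruct (constructive_indefinite_description _ _); auto. Qed.

Lemma finite_seq_eq {Q : PH} (s t : finite_seq Q) :
  (forall i, proj1_sig s i = proj1_sig t i) -> s = t.
Proof.
  intros H. apply eq_sig_hprop; [intros; apply proof_irrelevance|].
  apply functional_extensionality, H.
Qed.

Definition seq_ip {Q : PH} (s t : finite_seq Q) : R :=
  rsum (fun i => ip (proj1_sig s i) (proj1_sig t i)) (seq_bound s).

Lemma rsum_tail f n N : (forall i, (n <= i)%nat -> f i = 0) -> (n <= N)%nat -> rsum f N = rsum f n.
Proof.
  intros H HN. induction N as [|N IH]; [replace n with 0%nat by lia; reflexivity|].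
  destruct (Nat.eq_dec n (S N)) as [->|]; [reflexivity|].
  simpl. rewrite IH, H by lia. ring.
Qed.

(** Any bound on the support of [s] computes the form. The bound picked by [seq_bound] is therefore
    immaterial, and several sequences can share a common one. *)
Lemma seq_ip_eq {Q : PH} (s t : finite_seq Q) n :
  (forall i, (n <= i)%nat -> proj1_sig s i = vz) ->
  seq_ip s t = rsum (fun i => ip (proj1_sig s i) (proj1_sig t i)) n.
Proof.
  intros H. unfold seq_ip.
  rewrite <- (rsum_tail _ (seq_bound s) (seq_bound s + n));
    [|intros; rewrite seq_bound_spec by assumption; apply ip_z|lia].
  apply rsum_tail; [|lia]. intros; rewrite H by assumption; apply ip_z.
Qed.

Lemma finite_zero {Q : PH} : exists n, forall i, (n <= i)%nat -> (vz : Q) = vz.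
Proof. exists 0%nat; reflexivity. Qed.

Lemma finite_add {Q : PH} (s t : finite_seq Q) :
  exists n, forall i, (n <= i)%nat -> vadd (proj1_sig s i) (proj1_sig t i) = vz.
Proof.
  exists (seq_bound s + seq_bound t)%nat; intros. rewrite !seq_bound_spec by lia. v_ring.
Qed.

Lemma finite_lin {Q : PH} (f : Q -> Q) (s : finite_seq Q) :
  f vz = vz -> exists n, forall i, (n <= i)%nat -> f (proj1_sig s i) = vz.
Proof. intros Hf. exists (seq_bound s); intros. rewrite seq_bound_spec by lia. exact Hf. Qed.

Lemma vopp_z {Q : PH} : vopp (vz : Q) = vz.
Proof. v_ring. Qed.

Definition seq_space (Q : PH) : PH.
Proof.
  refine {| car := finite_seq Q;
    vz := exist _ (fun _ => vz) finite_zero;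
    vadd := fun s t => exist _ (fun i => vadd (proj1_sig s i) (proj1_sig t i)) (finite_add s t);
    vopp := fun s => exist _ (fun i => vopp (proj1_sig s i)) (finite_lin vopp s vopp_z);
    vscal := fun c s => exist _ (fun i => vscal c (proj1_sig s i))
                                (finite_lin (vscal c) s (vscal_z c));
    ip := seq_ip |}.
  - intros; apply finite_seq_eq; intros; apply vadd_assoc.
  - intros; apply finite_seq_eq; intros; apply vadd_comm.
  - intros; apply finite_seq_eq; intros; apply vadd_0.
  - intros; apply finite_seq_eq; intros; apply vadd_opp.
  - intros; apply finite_seq_eq; intros; apply vscal_1.
  - intros; apply finite_seq_eq; intros; apply vscal_assoc.
  - intros; apply finite_seq_eq; intros; apply vscal_distr_v.
  - intros; apply finite_seq_eq; intros; apply vscal_distr_s.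
  - intros x y w. set (n := (seq_bound x + seq_bound y)%nat).
    rewrite !(seq_ip_eq _ w n); [simpl; rewrite <- rsum_add; apply rsum_ext; intros; apply ip_add| | |];
      intros; simpl; rewrite ?seq_bound_spec by lia; try reflexivity. v_ring.
  - intros x y. set (n := (seq_bound x + seq_bound y)%nat).
    rewrite (seq_ip_eq y x n), (seq_ip_eq x y n) by (intros; apply seq_bound_spec; lia).
    apply rsum_ext; intros; apply ip_sym.
  - intros r x y. rewrite !(seq_ip_eq _ y (seq_bound x)); intros; simpl;
      rewrite ?seq_bound_spec by lia; try reflexivity; [|v_ring].
    rewrite <- rsum_scal. apply rsum_ext; intros; apply ip_real.
  - intros c x y. rewrite !(seq_ip_eq _ _ (seq_bound x)); intros; simpl;
      rewrite ?seq_bound_spec by lia; try reflexivity; [|v_ring].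
    apply rsum_ext; intros; apply ip_adj.
  - intros x. apply rsum_ge0; intros; apply ip_pos.
Defined.

(** * Ando's dilation theorem *)

(* The unitary is [R x = x - z v] with [<z v, z k> = 2 <x, z k>], the reflection in the
   orthogonal complement of the range of [z]. *)
Lemma reflection_exists (H Q : PH) (z : H -> Q) c d :
  complete H -> definite H -> is_lin z -> 0 < c ->
  (forall h, c * q h <= q (z h)) -> (forall h, q (z h) <= d * q h) ->
  exists R : Q -> Q, isometry R /\ (forall x, R (R x) = x) /\
    forall x v, (forall k, ip (z v) (z k) = 2 * ip x (z k)) -> R x = vsub x (z v).
Proof.
  intros Hc Hd Hz Hpos Hlow Hup.
  (* The lower bound [c] makes a Cauchy sequence for the pulled back form Cauchy in [H]; the upper
     bound [d] carries convergence back. *)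
  assert (Hc' : complete (pullback_space H Q z Hz)).
  { intros u Hu. destruct (Hc u) as [l Hl].
    - intros eps He. destruct (Hu (c * eps)) as [N HN]; [nra|]. exists N. intros a b Ha Hb.
      specialize (HN a b Ha Hb). change (q (z (@vsub H (u a) (u b))) < c * eps) in HN.
      specialize (Hlow (@vsub H (u a) (u b))). apply (Rmult_lt_reg_l c); lra.
    - exists l. intros eps He.
      destruct (Hl (eps / (Rabs d + 1))) as [N HN].
      { pose proof (Rabs_pos d); apply Rdiv_lt_0_compat; lra. }
      exists N. intros a Ha. specialize (HN a Ha).
      change (q (z (@vsub H (u a) l)) < eps). specialize (Hup (@vsub H (u a) l)).
      pose proof (q_ge0 (@vsub H (u a) l)). pose proof (Rle_abs d). pose proof (Rabs_pos d).
      assert (q (@vsub H (u a) l) * (Rabs d + 1) < eps).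
      { apply (Rmult_lt_compat_r (Rabs d + 1)) in HN; [|lra].
        unfold Rdiv in HN. rewrite Rmult_assoc, Rinv_l in HN by lra. lra. }
      nra. }
  assert (Hex : forall x : Q, exists v : H, forall k, ip (z v) (z k) = 2 * ip x (z k)).
  { intros x.
    destruct (riesz (pullback_space H Q z Hz) (fun k => 2 * ip x (z k)) (4 * q x) Hc') as [v Hv].
    - pose proof (q_ge0 x); lra.
    - intros a b. change (2 * ip x (z (@vadd H a b)) = 2 * ip x (z a) + 2 * ip x (z b)).
      rewrite (proj1 Hz), ip_add_r; ring.
    - intros r a. change (2 * ip x (z (@vscal H (RtoC r) a)) = r * (2 * ip x (z a))).
      rewrite (proj2 Hz), ip_real_r; ring.
    - intros a. change (2 * ip x (z a) * (2 * ip x (z a)) <= 4 * q x * q (z a)).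
      pose proof (cauchy_schwarz x (z a)). lra.
    - exists v. intros k. symmetry; apply Hv. }
  assert (Hun : forall v w : H, (forall k, ip (z v) (z k) = ip (z w) (z k)) -> v = w).
  { intros v w E. apply definite_eq; [exact Hd|].
    specialize (Hlow (vsub v w)). pose proof (q_ge0 (vsub v w)).
    assert (q (z (vsub v w)) = 0); [|nra].
    assert (Hb : forall k, ip (z (vsub v w)) (z k) = 0).
    { intros k. rewrite lin_sub by exact Hz. unfold vsub. rewrite ip_add, ip_opp, E; ring. }
    apply Hb. }
  destruct (choice _ Hex) as [psi Hpsi].
  (* The defining equations determine [psi x], so linearity and involutivity follow by exhibiting
     solutions of them. *)
  assert (Hval : forall x v, (forall k, ip (z v) (z k) = 2 * ip x (z k)) -> psi x = v).
  { intros x v Hv. apply Hun. intros k. rewrite Hpsi, Hv; reflexivity. }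
  exists (fun x => vsub x (z (psi x))). split; [split; [split|]|split].
  - intros x y. rewrite (Hval (vadd x y) (vadd (psi x) (psi y))).
    + rewrite (proj1 Hz). v_ring.
    + intros k. rewrite (proj1 Hz), !ip_add, !Hpsi; ring.
  - intros a x. rewrite (Hval (vscal a x) (vscal a (psi x))).
    + rewrite (proj2 Hz). v_ring.
    + intros k. rewrite (proj2 Hz), !ip_adj, <- (proj2 Hz). apply Hpsi.
  (* [q (x - z v) = q x - 2 <x, z v> + <z v, z v>], and the last two terms cancel by the definition
     of [v = psi x]. *)
  - intros x. unfold vsub. rewrite q_add, q_opp, ip_opp_r.
    unfold q at 2. rewrite Hpsi. ring.
  - intros x. rewrite (Hval (vsub x (z (psi x))) (vopp (psi x))).
    + rewrite (lin_opp _ _ Hz). v_ring.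
    + intros k. rewrite (lin_opp _ _ Hz). unfold vsub. rewrite ip_add, !ip_opp, Hpsi; ring.
  - intros x v Hv. rewrite (Hval x v Hv). reflexivity.
Qed.

Definition strict {H : PH} (T : H -> H) : Prop :=
  is_lin T /\ exists c, 0 <= c < 1 /\ forall x, q (T x) <= c * q x.

Lemma strict_contraction_of {H : PH} (T : H -> H) : strict T -> contraction T.
Proof.
  intros [Hl [c [Hc Hb]]]; split; [exact Hl|]. intros x. pose proof (Hb x). pose proof (q_ge0 x). nra.
Qed.

Section Ando.
Context {H A : PH} (T1 T2 : H -> H) (j1 j2 : H -> A).
Let Q := prod_space A A.
Variable R : Q -> Q.
Hypotheses (HT1 : is_lin T1) (HT2 : is_lin T2) (Hj1 : is_lin j1) (Hj2 : is_lin j2)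
  (HR : isometry R) (HRR : forall x, R (R x) = x)
  (Hcom : forall x, T1 (T2 x) = T2 (T1 x))
  (Hq1 : forall h, q (T1 h) + q (j1 h) = q h) (Hq2 : forall h, q (T2 h) + q (j2 h) = q h)
  (Hswap : forall h, R (j1 (T2 h), j2 h) = (j2 (T1 h), j1 h)).
Let K := prod_space H (seq_space Q).

(* Sequences of elements of A are stored in consecutive pairs, the blocks on which R acts. *)
Definition push (a : A) (s : nat -> Q) (i : nat) : Q :=
  match i with O => (a, fst (s 0%nat)) | S i => (snd (s i), fst (s (S i))) end.

Lemma push_finite a (s : seq_space Q) :
  exists n, forall i, (n <= i)%nat -> push a (proj1_sig s) i = vz.
Proof.
  exists (S (seq_bound s)). intros [|i] Hi; [lia|]. simpl.
  rewrite !(seq_bound_spec s) by lia. reflexivity.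
Qed.

(** The isometric dilation of a single contraction: [T] acts on [H], and the norm it loses is stored
    as [j h] at the front of the shifted sequence. *)
Definition Wop (T : H -> H) (j : H -> A) (x : K) : K :=
  (T (fst x), exist _ (push (j (fst x)) (proj1_sig (snd x))) (push_finite (j (fst x)) (snd x))).

Definition Gop (x : K) : K :=
  (fst x, exist _ (fun i => R (proj1_sig (snd x) i)) (finite_lin R (snd x) (lin_z R (proj1 HR)))).

Lemma K_eq (x y : K) :
  fst x = fst y -> (forall i, proj1_sig (snd x) i = proj1_sig (snd y) i) -> x = y.
Proof.
  destruct x as [h s], y as [h' s']; cbn [fst snd]; intros -> Hs. f_equal.
  apply (@finite_seq_eq Q), Hs.
Qed.

Lemma Wop_isometry T j : is_lin T -> is_lin j -> (forall h, q (T h) + q (j h) = q h) ->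
  isometry (Wop T j).
Proof.
  intros HT Hj Hq. split; [split|].
  - intros x y. apply K_eq; [apply HT|]. intros [|i]; simpl; [|reflexivity].
    rewrite (proj1 Hj); reflexivity.
  - intros c x. apply K_eq; [apply HT|]. intros [|i]; simpl; [|reflexivity].
    rewrite (proj2 Hj); reflexivity.
  - intros [h s]. change (q (T h) + q (snd (Wop T j (h, s))) = q h + q s).
    set (n := seq_bound s).
    assert (E : q (snd (Wop T j (h, s))) =
              rsum (fun i => q (push (j h) (proj1_sig s) i : Q)) (S n)).
    { apply (seq_ip_eq (Q := Q)). intros [|i] Hi; [lia|]. simpl.
      rewrite !(seq_bound_spec s) by (fold n; lia). reflexivity. }
    rewrite E. rewrite <- (Hq h). change (q s) with (rsum (fun i => q (proj1_sig s i : Q)) n).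
    (* The shift moves by half a block. The first m + 1 blocks after it hold [j h], the first m
       blocks of [s] and the first half of block m, which vanishes once m reaches the bound. *)
    assert (Hs : forall m, rsum (fun i => q (push (j h) (proj1_sig s) i : Q)) (S m) =
      q (j h) + rsum (fun i => q (proj1_sig s i : Q)) m + q (fst (proj1_sig s m))).
    { induction m as [|m IH].
      - change (0 + (q (j h) + q (fst (proj1_sig s 0%nat))) =
          q (j h) + 0 + q (fst (proj1_sig s 0%nat))). ring.
      - set (f := fun i => q (push (j h) (proj1_sig s) i : Q)) in *.
        change (rsum f (S m) + (q (snd (proj1_sig s m)) + q (fst (proj1_sig s (S m)))) =
          q (j h) + (rsum (fun i => q (proj1_sig s i : Q)) m +
             (q (fst (proj1_sig s m)) + q (snd (proj1_sig s m)))) + q (fst (proj1_sig s (S m)))).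
        rewrite IH. ring. }
    rewrite Hs, (seq_bound_spec s) by (fold n; lia). simpl.
    rewrite q_z. ring.
Qed.

Lemma Gop_isometry : isometry Gop.
Proof.
  split; [split|].
  - intros x y. apply K_eq; [reflexivity|]. intros i. apply (proj1 (proj1 HR)).
  - intros c x. apply K_eq; [reflexivity|]. intros i. apply (proj2 (proj1 HR)).
  - intros [h s]. change (q h + q (snd (Gop (h, s))) = q h + q s). f_equal.
    set (n := seq_bound s).
    transitivity (rsum (fun i => q (R (proj1_sig s i))) n).
    + apply (seq_ip_eq (Q := Q)). intros i Hi. change (R (proj1_sig s i) = vz).
      rewrite (seq_bound_spec s i Hi). apply (lin_z R), HR.
    + apply rsum_ext; intros; apply HR.
Qed.

Lemma Gop_involutive x : Gop (Gop x) = x.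
Proof.
  apply K_eq; [reflexivity|]. intros i. apply HRR.
Qed.

(** Two pushes shift the old blocks by exactly one place. The new front block is [(j1 (T2 h), j2 h)]
    in one order and [(j2 (T1 h), j1 h)] in the other, and [R] exchanges these by [Hswap]. *)
Lemma Gop_swap x : Gop (Wop T1 j1 (Wop T2 j2 x)) = Wop T2 j2 (Wop T1 j1 (Gop x)).
Proof.
  apply K_eq; [apply Hcom|]. intros [|[|i]]; [apply Hswap| |]; simpl;
    rewrite <- !surjective_pairing; reflexivity.
Qed.

(** With [V1 = G W1] and [V2 = W2 G], both products equal [W2 W1]: one because [G G = 1], the other
    by [Gop_swap]. The result is an intertwining [P V = T P] with [P J = 1], the form in which
    polynomial identities and estimates descend to [H]. *)
Lemma ando_of_swap : exists (K : PH) (V1 V2 : K -> K) (P : K -> H) (J : H -> K),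
  isometry V1 /\ isometry V2 /\ (forall x, V1 (V2 x) = V2 (V1 x)) /\
  is_lin P /\ (forall x, q (P x) <= q x) /\
  (forall x, P (V1 x) = T1 (P x)) /\ (forall x, P (V2 x) = T2 (P x)) /\
  (forall h, P (J h) = h) /\ (forall h, q (J h) = q h).
Proof.
  pose proof Gop_isometry as HG.
  pose proof (Wop_isometry T1 j1 HT1 Hj1 Hq1) as HW1.
  pose proof (Wop_isometry T2 j2 HT2 Hj2 Hq2) as HW2.
  exists K, (fun x => Gop (Wop T1 j1 x)), (fun x => Wop T2 j2 (Gop x)), fst, (fun h => (h, vz)).
  repeat split.
  - intros; rewrite (proj1 (proj1 HW1)), (proj1 (proj1 HG)); reflexivity.
  - intros; rewrite (proj2 (proj1 HW1)), (proj2 (proj1 HG)); reflexivity.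
  - intros; rewrite (proj2 HG), (proj2 HW1); reflexivity.
  - intros; rewrite (proj1 (proj1 HG)), (proj1 (proj1 HW2)); reflexivity.
  - intros; rewrite (proj2 (proj1 HG)), (proj2 (proj1 HW2)); reflexivity.
  - intros; rewrite (proj2 HW2), (proj2 HG); reflexivity.
  - intros x. rewrite Gop_swap, Gop_involutive, Gop_involutive. reflexivity.
  - intros [h s]. simpl. change (q h <= q h + q s). pose proof (q_ge0 s). lra.
  - intros h. change (q h + q (vz : seq_space Q) = q h). rewrite q_z; ring.
Qed.
End Ando.

(** The vectors [(j1 (T2 h), j2 h)] and [(j2 (T1 h), j1 h)] both have squared norm
    [q h - q (T1 (T2 h))]. A reflection orthogonal to all their differences exchanges them for every
    [h] simultaneously, so commutation of the dilations can be arranged. *)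
Theorem ando (H : PH) (T1 T2 : H -> H) :
  complete H -> definite H -> strict T1 -> strict T2 -> (forall x, T1 (T2 x) = T2 (T1 x)) ->
  exists (K : PH) (V1 V2 : K -> K) (P : K -> H) (J : H -> K),
  isometry V1 /\ isometry V2 /\ (forall x, V1 (V2 x) = V2 (V1 x)) /\
  is_lin P /\ (forall x, q (P x) <= q x) /\
  (forall x, P (V1 x) = T1 (P x)) /\ (forall x, P (V2 x) = T2 (P x)) /\
  (forall h, P (J h) = h) /\ (forall h, q (J h) = q h).
Proof.
  intros Hc Hd HT1 HT2 Hcom.
  pose proof (strict_contraction_of T1 HT1) as HC1.
  pose proof (strict_contraction_of T2 HT2) as HC2.
  set (D1 := defect_space H T1 HC1). set (D2 := defect_space H T2 HC2).
  set (A := prod_space D1 D2).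
  set (j1 := (fun h => (h, vz)) : H -> A). set (j2 := (fun h => (vz, h)) : H -> A).
  set (Q := prod_space A A).
  (* [z h] is the difference of the two vectors that [R] has to exchange. *)
  set (z := (fun h => ((T2 h, vopp (T1 h)), (vopp h, h))) : H -> Q).
  destruct HT1 as [HL1 [c [Hc1 Hb1]]]. destruct HT2 as [HL2 HT2].
  assert (Hip : forall h k, ip (z h) (z k) = 2 * (ip h k - ip (T1 (T2 h)) (T1 (T2 k)))).
  { intros h k. unfold z; cbn. rewrite !(lin_opp T1) by exact HL1.
    rewrite !(lin_opp T2) by exact HL2. rewrite !ip_opp, !ip_opp_r, !Hcom. ring. }
  assert (Hz : is_lin z).
  { split; intros; unfold z; cbn.
    - rewrite (proj1 HL1), (proj1 HL2). repeat f_equal; v_ring.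
    - rewrite (proj2 HL1), (proj2 HL2). repeat f_equal; v_ring. }
  (* By [Hip], [q (z h) = 2 (q h - q (T1 (T2 h)))]. Strictness of [T1] gives the lower constant
     [2 (1 - c)], and dropping the subtracted term gives 2. *)
  destruct (reflection_exists H Q z (2 * (1 - c)) 2 Hc Hd Hz) as [R [HR [HRR Hval]]].
  - lra.
  - intros h. unfold q at 2. rewrite Hip. fold (q h) (q (T1 (T2 h))).
    pose proof (Hb1 (T2 h)). pose proof (proj2 HC2 h).
    assert (c * q (T2 h) <= c * q h) by (apply Rmult_le_compat_l; lra). lra.
  - intros h. unfold q at 1. rewrite Hip. fold (q h) (q (T1 (T2 h))).
    pose proof (q_ge0 (T1 (T2 h))). lra.
  - apply (@ando_of_swap H A T1 T2 j1 j2 R); try assumption.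
    + split; intros; unfold j1; cbn; f_equal; v_ring.
    + split; intros; unfold j2; cbn; f_equal; v_ring.
    + intros h. unfold q, j1; cbn. rewrite (lin_z T2), !ip_z by exact HL2. ring.
    + intros h. unfold q, j2; cbn. rewrite (lin_z T1), !ip_z by exact HL1. ring.
    + intros h. rewrite (Hval _ h).
      * unfold vsub, z, j1, j2; cbn. repeat f_equal; v_ring.
      * intros k. rewrite Hip. unfold z, j1, j2; cbn.
        rewrite !(lin_z T1), !(lin_z T2), !ip_z by assumption. ring.
Qed.

(** * Polynomials in two commuting operators *)

Definition poly2 (N M : nat) (c : nat -> nat -> C) (z1 z2 : C) : C :=
  csum (fun j => csum (fun k => Cmul (c j k) (Cmul (Cpow z1 j) (Cpow z2 k))) (S M)) (S N).

Definition poly_op {K : PH} (N M : nat) (c : nat -> nat -> C) (A B : K -> K) (y : K) : K :=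
  vsum (fun j => vsum (fun k => vscal (c j k) (Nat.iter j A (Nat.iter k B y))) (S M)) (S N).

Fixpoint msum (f : nat -> mexp) (n : nat) : mexp :=
  match n with O => MZero | S n => MAdd (msum f n) (f n) end.

Definition poly_mexp (N M : nat) (c : nat -> nat -> C) (e : mexp) : mexp :=
  msum (fun j => msum (fun k =>
    MScal (c j k) (Nat.iter j (MX true) (Nat.iter k (MX false) e))) (S M)) (S N).

Lemma eval_msum {K : PH} A (x : nat -> K) f n :
  eval A x (msum f n) = vsum (fun i => eval A x (f i)) n.
Proof. induction n as [|n IH]; simpl; [|rewrite IH]; reflexivity. Qed.

Lemma eval_iter {K : PH} A (x : nat -> K) b j e :
  eval A x (Nat.iter j (MX b) e) = Nat.iter j (A b) (eval A x e).
Proof. induction j as [|j IH]; simpl; [|rewrite IH]; reflexivity. Qed.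

Lemma eval_poly {K : PH} N M c (A B : K -> K) x e :
  eval (with_op true A B) x (poly_mexp N M c e) =
  poly_op N M c A B (eval (with_op true A B) x e).
Proof.
  unfold poly_mexp, poly_op. rewrite eval_msum. apply vsum_ext; intros j _.
  rewrite eval_msum. apply vsum_ext; intros k _.
  cbn [eval]. rewrite !eval_iter. reflexivity.
Qed.

Lemma vsum_lin {K L : PH} (f : nat -> K -> L) n :
  (forall i, is_lin (f i)) -> is_lin (fun y => vsum (fun i => f i y) n).
Proof.
  intros H. split; intros.
  - rewrite <- vsum_add. apply vsum_ext; intros i _; apply H.
  - rewrite (lin_vsum _ _ _ (lin_scal c)). apply vsum_ext; intros i _; apply H.
Qed.

Lemma poly_op_lin {K : PH} N M c (A B : K -> K) :
  is_lin A -> is_lin B -> is_lin (poly_op N M c A B).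
Proof.
  intros HA HB. unfold poly_op.
  apply (vsum_lin (fun j y => vsum (fun k => vscal (c j k) (Nat.iter j A (Nat.iter k B y))) (S M))).
  intros j. apply (vsum_lin (fun k y => vscal (c j k) (Nat.iter j A (Nat.iter k B y)))).
  intros k. apply (lin_comp (fun y => Nat.iter j A (Nat.iter k B y)) (vscal (c j k))).
  - apply (lin_comp (Nat.iter k B) (Nat.iter j A)); apply iter_is_lin; assumption.
  - apply lin_scal.
Qed.

Lemma iter_map {K L : PH} (h : K -> L) A A' j y :
  (forall y, h (A y) = A' (h y)) -> h (Nat.iter j A y) = Nat.iter j A' (h y).
Proof. intros H; induction j as [|j IH]; simpl; [|rewrite H, IH]; reflexivity. Qed.

Lemma poly_op_map {K L : PH} (h : K -> L) N M c A B A' B' y :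
  is_lin h -> (forall y, h (A y) = A' (h y)) -> (forall y, h (B y) = B' (h y)) ->
  h (poly_op N M c A B y) = poly_op N M c A' B' (h y).
Proof.
  intros Hl HA HB. unfold poly_op. rewrite (lin_vsum _ _ _ Hl). apply vsum_ext; intros j _.
  rewrite (lin_vsum _ _ _ Hl). apply vsum_ext; intros k _.
  rewrite (proj2 Hl), (iter_map h A A'), (iter_map h B B') by assumption. reflexivity.
Qed.

Lemma iter_scal {K : PH} z j (y : K) : Nat.iter j (vscal z) y = vscal (Cpow z j) y.
Proof. induction j as [|j IH]; simpl; [|rewrite IH]; v_ring. Qed.

Lemma poly_op_scal {K : PH} N M c z1 z2 (y : K) :
  poly_op N M c (vscal z1) (vscal z2) y = vscal (poly2 N M c z1 z2) y.
Proof.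
  unfold poly_op, poly2. rewrite vscal_csum. apply vsum_ext; intros j _.
  rewrite vscal_csum. apply vsum_ext; intros k _. rewrite !iter_scal. v_ring.
Qed.

Lemma q_vsum_le {K : PH} (f : nat -> K) n B :
  0 <= B -> (forall i, (i < n)%nat -> q (f i) <= B) -> q (vsum f n) <= 4 ^ n * B.
Proof.
  intros HB H. induction n as [|n IH]; simpl.
  - rewrite q_z; lra.
  - eapply Rle_trans; [apply q_add_le|].
    assert (q (vsum f n) <= 4 ^ n * B) by (apply IH; intros; apply H; lia).
    pose proof (H n ltac:(lia)). pose proof (pow_R1_Rle 4 n ltac:(lra)).
    assert (1 * B <= 4 ^ n * B) by (apply Rmult_le_compat_r; lra). lra.
Qed.

Lemma iter_contraction {K : PH} (A : K -> K) j y : contraction A -> q (Nat.iter j A y) <= q y.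
Proof.
  intros HA; induction j as [|j IH]; simpl; [lra|]. eapply Rle_trans; [apply HA|exact IH].
Qed.

Lemma poly_op_bound {K : PH} N M c (A B : K -> K) s y :
  contraction A -> contraction B ->
  (forall j k, (j <= N)%nat -> (k <= M)%nat -> Cnorm2 (c j k) <= s) ->
  q (poly_op N M c A B y) <= 4 ^ S N * (4 ^ S M * (s * q y)).
Proof.
  intros HA HB Hs. pose proof (q_ge0 y).
  assert (0 <= s) by (eapply Rle_trans; [apply Cnorm2_ge0|apply (Hs 0%nat 0%nat); lia]).
  assert (0 <= s * q y) by nra.
  pose proof (pow_lt 4 (S M) ltac:(lra)).
  apply q_vsum_le; [nra|]. intros j Hj. apply q_vsum_le; [assumption|]. intros k Hk.
  rewrite q_scal. apply Rmult_le_compat; [apply Cnorm2_ge0|apply q_ge0|apply Hs; lia|].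
  eapply Rle_trans; apply iter_contraction; assumption.
Qed.

Lemma poly_op_sub {K : PH} N M c d (A B : K -> K) y :
  vsub (poly_op N M c A B y) (poly_op N M d A B y) =
  poly_op N M (fun j k => Csub (c j k) (d j k)) A B y.
Proof.
  assert (Hs : forall (f g : nat -> K) n, vsub (vsum f n) (vsum g n) = vsum (fun i => vsub (f i) (g i)) n).
  { induction n as [|n IH]; simpl; [v_ring|]. rewrite <- IH. v_ring. }
  unfold poly_op. rewrite Hs. apply vsum_ext; intros j _.
  rewrite Hs. apply vsum_ext; intros k _. unfold Csub. v_ring.
Qed.

Lemma coef_bounded (c : nat -> nat -> C) N M :
  exists s, 0 <= s /\ forall j k, (j <= N)%nat -> (k <= M)%nat -> Cnorm2 (c j k) <= s.
Proof.
  exists (rsum (fun j => rsum (fun k => Cnorm2 (c j k)) (S M)) (S N)).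
  assert (Ht : forall f n i, (forall i, 0 <= f i) -> (i < n)%nat -> f i <= rsum f n).
  { clear. intros f n i Hf Hi. induction n as [|n IH]; [lia|]. simpl.
    destruct (Nat.eq_dec i n) as [->|].
    - pose proof (rsum_ge0 f n (fun i _ => Hf i)). lra.
    - pose proof (IH ltac:(lia)). pose proof (Hf n). lra. }
  assert (Hp : forall j, 0 <= rsum (fun k => Cnorm2 (c j k)) (S M))
    by (intros; apply rsum_ge0; intros; apply Cnorm2_ge0).
  split; [apply rsum_ge0; intros; apply Hp|]. intros j k Hj Hk.
  eapply Rle_trans; [apply (Ht (fun k => Cnorm2 (c j k)) (S M) k)|
    apply (Ht (fun j => rsum (fun k => Cnorm2 (c j k)) (S M)) (S N) j)].
  all: intros; try apply Cnorm2_ge0; try apply Hp; lia.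
Qed.

(** * Radial dilation of the coefficients *)

Definition dilate (t : R) (c : nat -> nat -> C) (j k : nat) : C :=
  Cmul (RtoC (t ^ (j + k))) (c j k).

Lemma Cpow_real t k : Cpow (RtoC t) k = RtoC (t ^ k).
Proof. induction k as [|k IH]; simpl; [reflexivity|]. rewrite IH. unfold RtoC; c_ring. Qed.

Lemma poly2_dilate N M c t z1 z2 :
  poly2 N M (dilate t c) z1 z2 = poly2 N M c (Cmul (RtoC t) z1) (Cmul (RtoC t) z2).
Proof.
  unfold poly2. apply csum_ext; intros j _. apply csum_ext; intros k _.
  unfold dilate. rewrite !Cpow_mul_base, !Cpow_real, pow_add. unfold RtoC. c_ring.
Qed.

Lemma dilate_1 c : dilate 1 c = c.
Proof.
  apply functional_extensionality; intros j; apply functional_extensionality; intros k.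
  unfold dilate. rewrite pow1. unfold RtoC; c_ring.
Qed.

Lemma vsum_zero {K : PH} (f : nat -> K) n : (forall i, f i = vz) -> vsum f n = vz.
Proof. intros H; induction n as [|n IH]; simpl; [reflexivity|]. rewrite IH, H. v_ring. Qed.

Lemma csum_zero f n : (forall i, f i = C0) -> csum f n = C0.
Proof. intros H; induction n as [|n IH]; simpl; [reflexivity|]. rewrite IH, H. ring. Qed.

Lemma vsum_first {K : PH} (f : nat -> K) n :
  (forall i, f (S i) = vz) -> vsum f (S n) = f 0%nat.
Proof.
  intros H; induction n as [|n IH]; [simpl; v_ring|].
  change (vadd (vsum f (S n)) (f (S n)) = f 0%nat). rewrite IH, H. v_ring.
Qed.

Lemma csum_first f n : (forall i, f (S i) = C0) -> csum f (S n) = f 0%nat.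
Proof.
  intros H; induction n as [|n IH]; [simpl; ring|].
  change (Cadd (csum f (S n)) (f (S n)) = f 0%nat). rewrite IH, H. ring.
Qed.

Lemma poly_op_dilate_0 {K : PH} N M c (A B : K -> K) y :
  poly_op N M (dilate 0 c) A B y = vscal (c 0%nat 0%nat) y.
Proof.
  unfold poly_op. rewrite vsum_first.
  - rewrite vsum_first; unfold dilate; simpl; [v_ring|].
    intros k. rewrite Rmult_0_l. v_ring.
  - intros j. apply vsum_zero. intros k. unfold dilate; simpl. rewrite Rmult_0_l. v_ring.
Qed.

Lemma poly2_0 N M c : poly2 N M c C0 C0 = c 0%nat 0%nat.
Proof.
  unfold poly2. rewrite csum_first.
  - rewrite csum_first; simpl; [ring|]. intros; ring.
  - intros j. apply csum_zero. intros k. simpl; ring.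
Qed.

Lemma pow_lipschitz t s d : 0 <= t <= 1 -> 0 <= s <= 1 ->
  (t ^ d - s ^ d) * (t ^ d - s ^ d) <= INR d * INR d * ((t - s) * (t - s)).
Proof.
  intros Ht Hs. rewrite <- !Rmult_assoc.
  assert (H : Rabs (t ^ d - s ^ d) <= INR d * Rabs (t - s)).
  { induction d as [|d IH].
    - simpl. rewrite Rminus_diag, Rabs_R0. lra.
    - rewrite S_INR. simpl.
      replace (t * t ^ d - s * s ^ d) with (t * (t ^ d - s ^ d) + (t - s) * s ^ d) by ring.
      eapply Rle_trans; [apply Rabs_triang|]. rewrite !Rabs_mult.
      pose proof (Rabs_pos (t ^ d - s ^ d)). pose proof (Rabs_pos (t - s)).
      rewrite (Rabs_right t) by lra.
      assert (0 <= s ^ d <= 1) by (split; [apply pow_le; lra|rewrite <- (pow1 d); apply pow_incr; lra]).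
      rewrite (Rabs_right (s ^ d)) by lra. nra. }
  pose proof (Rabs_pos (t ^ d - s ^ d)).
  assert (E : forall x, x * x = Rabs x * Rabs x).
  { intros x. rewrite <- Rabs_mult. symmetry; apply Rabs_right, Rle_ge, Rle_0_sqr. }
  rewrite (E (t ^ d - s ^ d)).
  replace (INR d * INR d * (t - s) * (t - s)) with (INR d * INR d * ((t - s) * (t - s))) by ring.
  rewrite (E (t - s)). nra.
Qed.

(** Uniform continuity in the operator sense: one [eta] serves all [t], [s] and all vectors, so the
    continuity method can proceed in steps of fixed length. *)
Lemma poly_op_dilate_continuous {K : PH} N M c (A B : K -> K) eps :
  contraction A -> contraction B -> 0 < eps ->
  exists eta, 0 < eta /\ forall t s, 0 <= t <= 1 -> 0 <= s <= 1 -> Rabs (t - s) <= eta ->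
    forall y, q (vsub (poly_op N M (dilate t c) A B y) (poly_op N M (dilate s c) A B y)) <= eps * q y.
Proof.
  intros HA HB He. destruct (coef_bounded c N M) as [s0 [Hs0 Hc]].
  set (D := 4 ^ S N * 4 ^ S M * (INR (N + M) * INR (N + M) * s0) + 1).
  pose proof (pow_lt 4 (S N) ltac:(lra)). pose proof (pow_lt 4 (S M) ltac:(lra)).
  assert (HNM : 0 <= INR (N + M) * INR (N + M) * s0)
    by (apply Rmult_le_pos; [apply Rmult_le_pos; apply pos_INR|exact Hs0]).
  assert (HD : 1 <= D).
  { unfold D. assert (0 <= 4 ^ S N * 4 ^ S M * (INR (N + M) * INR (N + M) * s0)); [|lra].
    apply Rmult_le_pos; [nra|exact HNM]. }
  assert (HeD : 0 < eps / D) by (apply Rdiv_lt_0_compat; lra).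
  exists (sqrt (eps / D)). split; [apply sqrt_lt_R0; exact HeD|].
  intros t s Ht Hs Hts y. rewrite poly_op_sub.
  assert (Hsq : (t - s) * (t - s) <= eps / D).
  { rewrite <- (sqrt_sqrt (eps / D)) by lra.
    replace ((t - s) * (t - s)) with (Rabs (t - s) * Rabs (t - s)).
    - apply Rmult_le_compat; try apply Rabs_pos; assumption.
    - rewrite <- Rabs_mult. apply Rabs_right, Rle_ge, Rle_0_sqr. }
  eapply Rle_trans; [apply (poly_op_bound _ _ _ _ _ (INR (N + M) * INR (N + M) * s0 * (eps / D)));
    [exact HA|exact HB|]|].
  - intros j k Hj Hk. unfold dilate.
    replace (Csub _ _) with (Cmul (RtoC (t ^ (j + k) - s ^ (j + k))) (c j k))
      by (unfold Csub, Copp, RtoC; c_ring).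
    rewrite Cnorm2_mul. unfold Cnorm2 at 1; simpl.
    pose proof (pow_lipschitz t s (j + k) Ht Hs). pose proof (Hc j k Hj Hk).
    pose proof (Cnorm2_ge0 (c j k)).
    assert (INR (j + k) <= INR (N + M)) by (apply le_INR; lia). pose proof (pos_INR (j + k)).
    assert (INR (j + k) * INR (j + k) <= INR (N + M) * INR (N + M)) by nra.
    assert (0 <= (t - s) * (t - s)) by apply Rle_0_sqr.
    assert (0 <= (t ^ (j + k) - s ^ (j + k)) * (t ^ (j + k) - s ^ (j + k))) by apply Rle_0_sqr.
    replace (INR (N + M) * INR (N + M) * s0 * (eps / D))
      with ((INR (N + M) * INR (N + M) * (eps / D)) * s0) by ring.
    apply Rmult_le_compat; [nra|assumption| |assumption].
    apply Rle_trans with (INR (j + k) * INR (j + k) * ((t - s) * (t - s))); [lra|].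
    apply Rmult_le_compat; nra.
  - pose proof (q_ge0 y).
    replace (4 ^ S N * (4 ^ S M * (INR (N + M) * INR (N + M) * s0 * (eps / D) * q y)))
      with ((D - 1) * (eps / D) * q y) by (unfold D; ring).
    apply Rmult_le_compat_r; [assumption|].
    apply Rle_trans with (D * (eps / D)); [nra|]. right; field; lra.
Qed.

(** * The method of continuity *)

(** Surjectivity would be too much to ask on the dilation space, which need not be complete. *)
Definition dense_range {K L : PH} (A : K -> L) : Prop :=
  forall y eps, 0 < eps -> exists x, q (vsub y (A x)) <= eps.

(** Solving again for the residual multiplies the error by [th] each time, so finitely many
    corrections reach any precision. *)
Lemma dense_range_of_residual {K : PH} (A : K -> K) th :
  is_lin A -> 0 <= th < 1 -> (forall y, exists x, q (vsub y (A x)) <= th * q y) -> dense_range A.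
Proof.
  intros HA Hth Hres y eps He.
  assert (Hk : forall k, exists x, q (vsub y (A x)) <= th ^ k * q y).
  { induction k as [|k [x Hx]].
    - exists vz. rewrite (lin_z A HA). replace (vsub y vz) with y by v_ring. simpl; lra.
    - destruct (Hres (vsub y (A x))) as [x' Hx']. exists (vadd x x').
      rewrite (proj1 HA). replace (vsub y (vadd (A x) (A x'))) with (vsub (vsub y (A x)) (A x')) by v_ring.
      eapply Rle_trans; [exact Hx'|]. simpl. rewrite Rmult_assoc. apply Rmult_le_compat_l; lra. }
  pose proof (q_ge0 y).
  destruct (pow_lt_1_zero th) with (y := eps / (q y + 1)) as [N HN].
  - rewrite Rabs_right; lra.
  - apply Rdiv_lt_0_compat; lra.
  - destruct (Hk N) as [x Hx]. exists x. specialize (HN N ltac:(lia)).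
    assert (0 <= th ^ N) by (apply pow_le; lra). rewrite Rabs_right in HN by lra.
    assert (th ^ N * (q y + 1) <= eps); [|nra].
    apply Rle_trans with (eps / (q y + 1) * (q y + 1)); [nra|right; field; lra].
Qed.

Lemma dense_range_perturb {K : PH} (A A' : K -> K) d :
  is_lin A -> is_lin A' -> 0 < d -> (forall x, d * q x <= q (A x)) ->
  (forall x, q (vsub (A x) (A' x)) <= d / 16 * q x) -> dense_range A -> dense_range A'.
Proof.
  intros HA HA' Hd Hlow Hclose Hdense. apply (dense_range_of_residual A' (1 / 2) HA'); [lra|].
  (* The tolerance below is [q y / 16], which must be positive. With it,
     [d q x <= q (A x) <= 17/8 q y], and the residual is at most [(1/8 + 17/64) q y], below
     [q y / 2]. *)
  intros y. pose proof (q_ge0 y) as Hy. destruct (Req_dec (q y) 0) as [E|Hn].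
  - exists vz. rewrite (lin_z A' HA'). replace (vsub y vz) with y by v_ring. lra.
  - destruct (Hdense y (q y / 16)) as [x Hx]; [lra|]. exists x.
    replace (vsub y (A' x)) with (vadd (vsub y (A x)) (vsub (A x) (A' x))) by v_ring.
    eapply Rle_trans; [apply q_add_le|].
    assert (q (A x) <= 2 * q y + 2 * (q y / 16)).
    { replace (A x) with (vadd y (vopp (vsub y (A x)))) by v_ring.
      eapply Rle_trans; [apply q_add_le|]. rewrite q_opp. lra. }
    specialize (Hlow x). specialize (Hclose x). lra.
Qed.

(** As the step length is uniform, induction along a finite subdivision of [0, t] does the work of a
    connectedness argument. *)
Lemma continuity_induction (P : R -> Prop) eta :
  0 < eta -> P 0 ->
  (forall t s, 0 <= t <= 1 -> 0 <= s <= 1 -> Rabs (t - s) <= eta -> P t -> P s) ->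
  forall t, 0 <= t <= 1 -> P t.
Proof.
  intros He H0 Hstep t Ht.
  destruct (inv_S_lt eta He) as [N HN]. specialize (HN N ltac:(lia)).
  assert (HS : 0 < INR (S N)) by (apply lt_0_INR; lia).
  assert (Hk : forall k, (k <= S N)%nat -> 0 <= t * (INR k / INR (S N)) <= 1).
  { intros k Hk. apply le_INR in Hk. pose proof (pos_INR k).
    assert (0 <= INR k / INR (S N)) by (apply Rle_mult_inv_pos; lra).
    assert (INR k / INR (S N) <= 1).
    { apply (Rmult_le_reg_r (INR (S N))); [lra|].
      unfold Rdiv; rewrite Rmult_assoc, Rinv_l by lra. lra. }
    nra. }
  assert (Hind : forall k, (k <= S N)%nat -> P (t * (INR k / INR (S N)))).
  { induction k as [|k IH]; intros Hle.
    - replace (t * (INR 0 / INR (S N))) with 0 by (simpl; field; simpl in HS; lra). exact H0.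
    - apply (Hstep (t * (INR k / INR (S N)))); [apply Hk; lia|apply Hk; lia| |apply IH; lia].
      replace (t * (INR k / INR (S N)) - t * (INR (S k) / INR (S N))) with (- (t * / INR (S N))).
      + assert (0 < / INR (S N)) by (apply Rinv_0_lt_compat; lra).
        rewrite Rabs_Ropp, Rabs_right by nra. nra.
      + rewrite (S_INR k). field; lra. }
  replace t with (t * (INR (S N) / INR (S N))) by (field; lra). apply Hind; lia.
Qed.

(** The lower bound makes approximate preimages a Cauchy sequence, so completeness of [H] upgrades
    dense range to surjectivity. *)
Lemma bijective_of_dense {H : PH} (A : H -> H) d B :
  complete H -> definite H -> is_lin A -> 0 < d ->
  (forall x, d * q x <= q (A x)) -> (forall x, q (A x) <= B * q x) -> dense_range A ->
  exists X : H -> H, (forall x, A (X x) = x) /\ (forall x, X (A x) = x).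
Proof.
  intros Hc Hdef HA Hd Hlow Hup Hdense.
  assert (Hinj : forall x y, A x = A y -> x = y).
  { intros x y E. apply definite_eq; [exact Hdef|]. specialize (Hlow (vsub x y)).
    rewrite (lin_sub A _ _ HA), E in Hlow. replace (vsub (A y) (A y)) with (vz : H) in Hlow by v_ring.
    rewrite q_z in Hlow. pose proof (q_ge0 (vsub x y)). nra. }
  assert (Hsurj : forall y, exists x, A x = y).
  { intros y.
    destruct (choice (fun n x => q (vsub y (A x)) <= / INR (S n))) as [u Hu].
    { intros n. apply Hdense, Rinv_0_lt_compat, lt_0_INR; lia. }
    destruct (Hc u) as [x Hx].
    - intros eps He. destruct (inv_S_lt (d * eps / 4)) as [N HN]; [nra|].
      exists N. intros a b Ha Hb. specialize (Hlow (vsub (u a) (u b))).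
      rewrite (lin_sub A _ _ HA) in Hlow.
      replace (vsub (A (u a)) (A (u b))) with
        (vadd (vsub y (A (u b))) (vopp (vsub y (A (u a))))) in Hlow by v_ring.
      pose proof (q_add_le (vsub y (A (u b))) (vopp (vsub y (A (u a))))) as Hq.
      rewrite q_opp in Hq. pose proof (Hu a). pose proof (Hu b).
      pose proof (HN a Ha). pose proof (HN b Hb).
      apply (Rmult_lt_reg_l d); lra.
    - exists x. symmetry. apply definite_eq; [exact Hdef|].
      apply Rle_antisym; [|apply q_ge0].
      apply (le_of_lt_eps _ _ (2 + 2 * Rabs B)); [pose proof (Rabs_pos B); lra|].
      intros eps He. destruct (Hx eps He) as [N HN]. destruct (inv_S_lt eps He) as [N' HN'].
      set (n := (N + N')%nat). specialize (HN n ltac:(lia)). specialize (HN' n ltac:(lia)).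
      replace (vsub y (A x)) with (vadd (vsub y (A (u n))) (A (vsub (u n) x)))
        by (rewrite (lin_sub A _ _ HA); v_ring).
      eapply Rle_trans; [apply q_add_le|]. specialize (Hu n).
      pose proof (Hup (vsub (u n) x)). pose proof (q_ge0 (vsub (u n) x)).
      assert (B * q (vsub (u n) x) <= Rabs B * eps).
      { pose proof (Rle_abs B). pose proof (Rabs_pos B). nra. }
      lra. }
  destruct (choice _ Hsurj) as [X HX]. exists X. split; [exact HX|].
  intros x. apply Hinj, HX.
Qed.

(** * Von Neumann's inequality for quotients by a stable polynomial *)

Lemma eval_sub {K : PH} A (x y : nat -> K) e :
  (forall b, is_lin (A b)) ->
  eval A (fun j => vsub (x j) (y j)) e = vsub (eval A x e) (eval A y e).
Proof.
  intros HA. induction e as [j| |e IHe f IHf|c e IH|b e IH]; simpl.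
  - reflexivity.
  - v_ring.
  - rewrite IHe, IHf. v_ring.
  - rewrite IH. v_ring.
  - rewrite IH. apply lin_sub, HA.
Qed.

(** Unlike in [eval_bound], the constant depends on [e] alone and the bound is proportional to the
    size of the vectors, so small errors in the arguments stay small. *)
Lemma eval_small e : exists B, 0 <= B /\
  forall (K : PH) A (x : nat -> K) s, (forall b, contraction (A b)) -> 0 <= s ->
    (forall j, q (x j) <= s) -> q (eval A x e) <= B * s.
Proof.
  induction e as [j| |e [B [H0 HB]] f [B' [H0' HB']]|c e [B [H0 HB]]|b e [B [H0 HB]]]; simpl.
  - exists 1; split; [lra|]; intros. rewrite Rmult_1_l; auto.
  - exists 0; split; [lra|]; intros. rewrite q_z; lra.
  - exists (2 * B + 2 * B'); split; [lra|]; intros K A x s HA Hs Hx.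
    specialize (HB K A x s HA Hs Hx). specialize (HB' K A x s HA Hs Hx).
    pose proof (q_add_le (eval A x e) (eval A x f)). lra.
  - exists (Cnorm2 c * B); pose proof (Cnorm2_ge0 c); split; [nra|]; intros K A x s HA Hs Hx.
    rewrite q_scal, Rmult_assoc. apply Rmult_le_compat_l; auto.
  - exists B; split; [lra|]; intros K A x s HA Hs Hx. eapply Rle_trans; [apply HA|auto].
Qed.

Section Quotient.
Variables (N M : nat) (a : nat -> nat -> C) (d : R).
Hypothesis Hd : 0 < d.
Hypothesis Ha : forall z1 z2, Cnorm2 z1 <= 1 -> Cnorm2 z2 <= 1 -> d <= Cnorm2 (poly2 N M a z1 z2).

Lemma dilate_lower_torus t z1 z2 : 0 <= t <= 1 -> Cnorm2 z1 = 1 -> Cnorm2 z2 = 1 ->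
  d <= Cnorm2 (poly2 N M (dilate t a) z1 z2).
Proof.
  intros Ht H1 H2. rewrite poly2_dilate. apply Ha; rewrite Cnorm2_mul, ?H1, ?H2;
    unfold Cnorm2; simpl; nra.
Qed.

Lemma const_coef_lower : d <= Cnorm2 (a 0%nat 0%nat).
Proof. rewrite <- (poly2_0 N M). apply Ha; unfold Cnorm2; simpl; lra. Qed.

Section Dilation.
Variables (H K : PH) (T1 T2 : H -> H) (V1 V2 : K -> K) (P : K -> H) (J : H -> K).
Hypotheses (HT1 : contraction T1) (HT2 : contraction T2)
  (HV1 : isometry V1) (HV2 : isometry V2) (HVV : forall x, V1 (V2 x) = V2 (V1 x))
  (HP : is_lin P) (HPq : forall x, q (P x) <= q x)
  (HP1 : forall x, P (V1 x) = T1 (P x)) (HP2 : forall x, P (V2 x) = T2 (P x))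
  (HPJ : forall h, P (J h) = h) (HJ : forall h, q (J h) = q h).

(** The bound [d <= |a|^2] on the torus, transferred. The constant is written as multiplication by
    [sqrt d], since both sides must be squared norms of module expressions. *)
Lemma isometry_lower t y : 0 <= t <= 1 -> d * q y <= q (poly_op N M (dilate t a) V1 V2 y).
Proof.
  intros Ht. assert (Hs : sqrt d * sqrt d = d) by (apply sqrt_sqrt; lra).
  assert (Htr : rsum (fun _ => q (eval (with_op true V1 V2) (fun _ => y)
                   (MScal (RtoC (sqrt d)) (MVar 0)))) 1 <=
                rsum (fun _ => q (eval (with_op true V1 V2) (fun _ => y)
                   (poly_mexp N M (dilate t a) (MVar 0)))) 1).
  { apply (transfer V1 V2 (fun _ => MScal (RtoC (sqrt d)) (MVar 0))
      (fun _ => poly_mexp N M (dilate t a) (MVar 0)) 1 HV1 HV2 HVV).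
    intros z1 z2 H1 H2 x. cbn [rsum]. rewrite eval_poly, poly_op_scal. cbn [eval]. rewrite !q_scal.
    pose proof (dilate_lower_torus t z1 z2 Ht H1 H2). pose proof (q_ge0 (x 0%nat)).
    replace (Cnorm2 (RtoC (sqrt d))) with d by (unfold Cnorm2; simpl; lra).
    apply Rplus_le_compat_l, Rmult_le_compat_r; assumption. }
  cbn [rsum] in Htr. rewrite eval_poly in Htr. cbn [eval] in Htr. rewrite q_scal in Htr.
  unfold Cnorm2 in Htr; simpl in Htr. rewrite Hs in Htr. lra.
Qed.

(** Continuity method from the nonzero constant [a 0 0] at [t = 0]. The lower bound [d] holds for
    every [t], so the admissible perturbation never shrinks. *)
Lemma isometry_dense t : 0 <= t <= 1 -> dense_range (poly_op N M (dilate t a) V1 V2).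
Proof.
  assert (HL : forall s, is_lin (poly_op N M (dilate s a) V1 V2))
    by (intros; apply poly_op_lin; [apply HV1|apply HV2]).
  destruct (poly_op_dilate_continuous N M a V1 V2 (d / 16)) as [eta [He Hc]];
    [apply isometry_contraction, HV1|apply isometry_contraction, HV2|lra|].
  revert t. apply (continuity_induction _ eta He).
  - intros y eps Heps. exists (vscal (Cinv (a 0%nat 0%nat)) y).
    rewrite poly_op_dilate_0, vscal_assoc. pose proof const_coef_lower.
    replace (Cmul (a 0%nat 0%nat) (Cinv (a 0%nat 0%nat))) with C1.
    + replace (vsub y (vscal C1 y)) with (vz : K) by v_ring. rewrite q_z; lra.
    + unfold Cnorm2 in *. apply C_eq; simpl; field; lra.
  - intros t s Ht Hs Hts. apply (dense_range_perturb _ _ d); auto.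
    intros x; apply isometry_lower, Ht.
Qed.

Lemma compress_poly t w :
  P (poly_op N M (dilate t a) V1 V2 w) = poly_op N M (dilate t a) T1 T2 (P w).
Proof. apply poly_op_map; assumption. Qed.

(** An element of [K] lying over [x] says nothing by itself about [q (A x)]. Instead [J (A x)] is
    approximated by [a(V) w], where [w] is controlled by the bound on [K]; then [A (x - P w)] is
    small. To conclude that [x - P w] is small, some lower bound for [A] is required: a weak one is
    inherited from a nearby parameter. It affects only the vanishing error, so the constant [d / 4]
    is recovered at each step. *)
Lemma contraction_lower t x : 0 <= t <= 1 -> d / 4 * q x <= q (poly_op N M (dilate t a) T1 T2 x).
Proof.
  assert (HL : forall s, is_lin (poly_op N M (dilate s a) T1 T2))
    by (intros; apply poly_op_lin; [apply HT1|apply HT2]).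
  destruct (poly_op_dilate_continuous N M a T1 T2 (d / 64) HT1 HT2) as [eta [He Hc]]; [lra|].
  intros Ht. revert x. revert t Ht.
  apply (continuity_induction
    (fun t => forall x, d / 4 * q x <= q (poly_op N M (dilate t a) T1 T2 x)) eta He).
  - intros x. rewrite poly_op_dilate_0, q_scal. pose proof const_coef_lower. pose proof (q_ge0 x). nra.
  - intros t s Ht Hs Hts IH.
    set (A := poly_op N M (dilate s a) T1 T2) in *.
    (* From [d / 4 q x <= 2 q (A x) + d / 32 q x], with room to spare. *)
    assert (Hweak : forall x, d / 16 * q x <= q (A x)).
    { intros x. specialize (IH x). specialize (Hc t s Ht Hs Hts x). fold A in Hc.
      set (y := poly_op N M (dilate t a) T1 T2 x) in *.
      pose proof (q_add_le (A x) (vsub y (A x))) as Hq.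
      replace (vadd (A x) (vsub y (A x))) with y in Hq by v_ring.
      pose proof (q_ge0 x). assert (0 <= d * q x) by nra. lra. }
    intros x. assert (d * q x <= 4 * q (A x)); [|lra].
    (* [36 = 4 + 32]: the error [2 eps] in [q y] is doubled, and [2 q (x - P w)] costs [2 * 16 eps]
       after multiplication by [d]. *)
    apply (le_of_lt_eps _ _ 36); [lra|]. intros eps Heps.
    destruct (isometry_dense s Hs (J (A x)) eps Heps) as [w Hw].
    set (y := poly_op N M (dilate s a) V1 V2 w) in *.
    pose proof (isometry_lower s w Hs) as Hlw. fold y in Hlw.
    assert (Hy : q y <= 2 * q (A x) + 2 * eps).
    { replace y with (vadd (J (A x)) (vopp (vsub (J (A x)) y))) by v_ring.
      eapply Rle_trans; [apply q_add_le|]. rewrite q_opp, HJ. lra. }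
    assert (Hr : q (A (vsub x (P w))) <= eps).
    { unfold A. rewrite (lin_sub _ _ _ (HL s)), <- compress_poly. fold A y.
      rewrite <- (HPJ (A x)) at 1. rewrite <- (lin_sub P _ _ HP).
      eapply Rle_trans; [apply HPq|exact Hw]. }
    specialize (Hweak (vsub x (P w))).
    pose proof (q_add_le (P w) (vsub x (P w))) as Hq.
    replace (vadd (P w) (vsub x (P w))) with x in Hq by v_ring.
    pose proof (HPq w). nra.
Qed.

Lemma contraction_dense : dense_range (poly_op N M a T1 T2).
Proof.
  intros y eps He. rewrite <- (dilate_1 a).
  destruct (isometry_dense 1 ltac:(lra) (J y) eps He) as [w Hw].
  exists (P w). rewrite <- compress_poly, <- (HPJ y) at 1. rewrite <- (lin_sub P _ _ HP).
  eapply Rle_trans; [apply HPq|exact Hw].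
Qed.

(** On [K] the inequality is a transfer from the torus. To descend, pick [w i] with [a(V) (w i)]
    close to [J (a(T) (u i))]; by [contraction_lower], [P (w i)] is then close to [u i], and [F(T)]
    applied to the [P (w j)] is the image under [P] of [F(V)] applied to the [w j]. *)
Lemma quotient_inequality (F : nat -> mexp) n :
  (forall z1 z2, Cnorm2 z1 = 1 -> Cnorm2 z2 = 1 -> forall x : nat -> K,
     rsum (fun i => q (eval (with_op true (vscal z1) (vscal z2)) x (F i))) n <=
     rsum (fun i => Cnorm2 (poly2 N M a z1 z2) * q (x i)) n) ->
  forall u : nat -> H,
    rsum (fun i => q (eval (with_op true T1 T2) u (F i))) n <=
    rsum (fun i => q (poly_op N M a T1 T2 (u i))) n.
Proof.
  intros HF u.
  assert (Htr : forall w : nat -> K,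
    rsum (fun i => q (eval (with_op true V1 V2) w (F i))) n <=
    rsum (fun i => q (poly_op N M a V1 V2 (w i))) n).
  { intros w. apply Rle_trans with
      (rsum (fun i => q (eval (with_op true V1 V2) w (poly_mexp N M a (MVar i)))) n).
    - apply (transfer V1 V2 F (fun i => poly_mexp N M a (MVar i))); try assumption.
      intros z1 z2 H1 H2 x. eapply Rle_trans; [apply HF; assumption|].
      apply rsum_le; intros i _. rewrite eval_poly, poly_op_scal, q_scal. simpl; lra.
    - right; apply rsum_ext; intros i _. rewrite eval_poly. reflexivity. }
  set (Au := fun i => poly_op N M a T1 T2 (u i)).
  assert (HB : exists B, 0 <= B /\ forall s, 0 <= s -> forall x : nat -> H, (forall j, q (x j) <= s) ->
    rsum (fun i => q (eval (with_op true T1 T2) x (F i))) n <= B * s).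
  { clear - HT1 HT2. induction n as [|n [B [H0 HB]]]; simpl; [exists 0; split; intros; lra|].
    destruct (eval_small (F n)) as [B' [H0' HB']]. exists (B + B'). split; [lra|].
    intros s Hs x Hx. specialize (HB s Hs x Hx).
    specialize (HB' H (with_op true T1 T2) x s).
    assert (q (eval (with_op true T1 T2) x (F n)) <= B' * s); [|lra].
    apply HB'; try assumption. intros [|]; assumption. }
  destruct HB as [B [HB0 HB]].
  apply le_of_le_mul_eta; [apply rsum_ge0; intros; apply q_ge0|].
  intros eta He. assert (Hie : 0 < / eta) by (apply Rinv_0_lt_compat; lra).
  apply (le_of_lt_eps _ _ ((1 + eta) * ((1 + / eta) * INR n) + (1 + / eta) * (B * (4 / d)))).
  { assert (0 <= 4 / d) by (apply Rle_mult_inv_pos; lra).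
    pose proof (pos_INR n).
    apply Rplus_le_le_0_compat; repeat apply Rmult_le_pos; lra. }
  intros eps Heps.
  destruct (choice (fun i w => q (vsub (J (Au i)) (poly_op N M a V1 V2 w)) <= eps)) as [w Hw].
  { intros i. pose proof (isometry_dense 1 ltac:(lra) (J (Au i)) eps Heps) as Hd1.
    rewrite dilate_1 in Hd1. exact Hd1. }
  assert (Hdiff : forall j, q (vsub (u j) (P (w j))) <= 4 / d * eps).
  { intros j. pose proof (contraction_lower 1 (vsub (u j) (P (w j))) ltac:(lra)) as Hl.
    rewrite dilate_1 in Hl.
    rewrite (lin_sub _ _ _ (poly_op_lin N M a T1 T2 (proj1 HT1) (proj1 HT2))) in Hl.
    pose proof (compress_poly 1 (w j)) as Hcp. rewrite dilate_1 in Hcp. rewrite <- Hcp in Hl.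
    fold (Au j) in Hl. rewrite <- (HPJ (Au j)), <- (lin_sub P _ _ HP) in Hl.
    pose proof (HPq (vsub (J (Au j)) (poly_op N M a V1 V2 (w j)))). specialize (Hw j).
    apply (Rmult_le_reg_l (d / 4)); [lra|].
    replace (d / 4 * (4 / d * eps)) with eps by (field; lra). lra. }
  set (S1 := rsum (fun i => q (eval (with_op true T1 T2) (fun j => P (w j)) (F i))) n).
  set (S2 := rsum (fun i => q (eval (with_op true T1 T2) (fun j => vsub (u j) (P (w j))) (F i))) n).
  set (S3 := rsum (fun i => q (poly_op N M a V1 V2 (w i))) n).
  set (S4 := rsum (fun i => q (Au i)) n).
  assert (E1 : rsum (fun i => q (eval (with_op true T1 T2) u (F i))) n <=
               (1 + eta) * S1 + (1 + / eta) * S2).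
  { unfold S1, S2. rewrite <- !rsum_scal, <- rsum_add. apply rsum_le; intros i _.
    rewrite eval_sub by (intros [|]; [apply HT1|apply HT2]).
    set (x := eval _ u (F i)). set (y := eval _ (fun j => P (w j)) (F i)).
    replace x with (vadd y (vsub x y)) at 1 by v_ring. apply q_young; lra. }
  assert (E2 : S2 <= B * (4 / d * eps)).
  { apply HB; [|exact Hdiff]. assert (0 <= 4 / d) by (apply Rle_mult_inv_pos; lra). nra. }
  assert (E3 : S1 <= S3).
  { eapply Rle_trans; [|apply Htr]. apply rsum_le; intros i _.
    rewrite <- (eval_map P (with_op true V1 V2)); [apply HPq|exact HP|].
    intros [|] y; [apply HP1|apply HP2]. }
  assert (E4 : S3 <= (1 + eta) * S4 + (1 + / eta) * (INR n * eps)).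
  { unfold S3, S4. rewrite <- (rsum_const eps n), <- !rsum_scal, <- rsum_add.
    apply rsum_le; intros i _. rewrite <- (HJ (Au i)).
    set (y := poly_op N M a V1 V2 (w i)) in *. specialize (Hw i). fold y in Hw.
    replace y with (vadd (J (Au i)) (vopp (vsub (J (Au i)) y))) at 1 by v_ring.
    eapply Rle_trans; [apply (q_young eta); lra|]. rewrite q_opp.
    apply Rplus_le_compat_l, Rmult_le_compat_l; lra. }
  assert (E5 : (1 + eta) * S1 <= (1 + eta) * ((1 + eta) * S4 + (1 + / eta) * (INR n * eps)))
    by (apply Rmult_le_compat_l; lra).
  assert (E6 : (1 + / eta) * S2 <= (1 + / eta) * (B * (4 / d * eps)))
    by (apply Rmult_le_compat_l; lra).
  unfold Au in S4. fold S4. lra.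
Qed.

End Dilation.

(** The torus hypothesis ranges over all spaces [K] because the dilation space on which it is used
    is produced only inside the proof. *)
Theorem von_neumann_quotient (H : PH) (T1 T2 : H -> H) :
  complete H -> definite H -> strict T1 -> strict T2 -> (forall x, T1 (T2 x) = T2 (T1 x)) ->
  (forall x, d / 4 * q x <= q (poly_op N M a T1 T2 x)) /\
  dense_range (poly_op N M a T1 T2) /\
  forall (F : nat -> mexp) n,
  (forall (K : PH) z1 z2, Cnorm2 z1 = 1 -> Cnorm2 z2 = 1 -> forall x : nat -> K,
     rsum (fun i => q (eval (with_op true (vscal z1) (vscal z2)) x (F i))) n <=
     rsum (fun i => Cnorm2 (poly2 N M a z1 z2) * q (x i)) n) ->
  forall u : nat -> H,
    rsum (fun i => q (eval (with_op true T1 T2) u (F i))) n <=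
    rsum (fun i => q (poly_op N M a T1 T2 (u i))) n.
Proof.
  intros Hc Hdef HT1 HT2 Hcom.
  destruct (ando H T1 T2 Hc Hdef HT1 HT2 Hcom)
    as (K & V1 & V2 & P & J & HV1 & HV2 & HVV & HP & HPq & HP1 & HP2 & HPJ & HJ).
  apply strict_contraction_of in HT1, HT2. repeat split.
  - intros x. rewrite <- (dilate_1 a). apply (contraction_lower H K T1 T2 V1 V2 P J); try assumption; lra.
  - apply (contraction_dense H K T1 T2 V1 V2 P J); assumption.
  - intros F n HF. apply (quotient_inequality H K T1 T2 V1 V2 P J); try assumption. apply HF.
Qed.

End Quotient.

(** * Strictly positive trigonometric polynomials in two variables *)

(** Coefficients are indexed by pairs of exponents instead of frequencies [j - j'], so that those of
    a squared modulus are plain products. *)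
Definition quad (n : nat) (g : nat -> nat -> C) (z : C) : C :=
  csum (fun j => csum (fun j' => Cmul (g j j') (Cmul (Cpow z j) (Cpow (Cconj z) j'))) (S n)) (S n).

(* With D(z) = sum_{l<L} z^l, summing g(w) |D(z/w)|^2 over the M-th roots of unity w
   multiplies the Fourier coefficients of g by those of |D|^2, which [fejer_weight] counts;
   [dirichlet L M q z] is D(z/w) at w = [root M q]. *)
Definition dirichlet (L M q : nat) (z : C) : C :=
  csum (fun l => Cmul (Cpow (Cconj (root M q)) l) (Cpow z l)) L.

Definition fejer_weight (L u v : nat) : R :=
  rsum (fun l => rsum (fun l' => if Nat.eqb (u + l') (v + l) then 1 else 0) L) L.

Lemma csum_mul f g n m :
  Cmul (csum f n) (csum g m) = csum (fun i => csum (fun j => Cmul (f i) (g j)) m) n.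
Proof.
  rewrite <- csum_scal_r. apply csum_ext; intros i _. rewrite <- csum_scal. reflexivity.
Qed.

Lemma RtoC_mul r s : RtoC (r * s) = Cmul (RtoC r) (RtoC s).
Proof. unfold RtoC; c_ring. Qed.

Lemma RtoC_rsum f n : RtoC (rsum f n) = csum (fun i => RtoC (f i)) n.
Proof.
  induction n as [|n IH]; simpl; [reflexivity|]. rewrite <- IH. unfold RtoC; c_ring.
Qed.

(** Summing over roots of unity keeps only the terms with [u + l' = v + l], where [z^l conj z^l']
    equals [z^u conj z^v]. The condition [L + n <= M] rules out aliasing. *)
Lemma dirichlet_moment L M n u v z :
  Cnorm2 z = 1 -> (u <= n)%nat -> (v <= n)%nat -> (L + n <= M)%nat ->
  csum (fun q => Cmul (RtoC (Cnorm2 (dirichlet L M q z)))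
                      (Cmul (Cpow (root M q) u) (Cpow (Cconj (root M q)) v))) M =
  Cmul (RtoC (INR M * fejer_weight L u v)) (Cmul (Cpow z u) (Cpow (Cconj z) v)).
Proof.
  intros Hz Hu Hv HM.
  rewrite (csum_ext _ (fun q => csum (fun l => csum (fun l' =>
    Cmul (Cmul (Cpow z l) (Cpow (Cconj z) l'))
      (Cmul (Cpow (root M q) (u + l')) (Cpow (Cconj (root M q)) (v + l)))) L) L)).
  - rewrite csum_swap. unfold fejer_weight. rewrite <- rsum_scal, RtoC_rsum, <- csum_scal_r.
    apply csum_ext; intros l Hl. rewrite csum_swap, <- rsum_scal, RtoC_rsum, <- csum_scal_r.
    apply csum_ext; intros l' Hl'. rewrite csum_scal, root_orthogonal by lia.
    destruct (Nat.eqb_spec (u + l') (v + l)) as [E|].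
    + assert (E1 : Cmul (Cpow z l) (Cpow (Cconj z) l') = Cmul (Cpow z u) (Cpow (Cconj z) v)).
      { pose proof (Cconj_pow_mul_pow z v Hz) as Hzv. pose proof (Cconj_pow_mul_pow z l' Hz) as Hzl.
        transitivity (Cmul (Cmul (Cpow z l) (Cpow (Cconj z) l'))
          (Cmul (Cpow z v) (Cpow (Cconj z) v))); [rewrite Hzv; ring|].
        transitivity (Cmul (Cmul (Cpow z (v + l)) (Cpow (Cconj z) l')) (Cpow (Cconj z) v));
          [rewrite Cpow_add; ring|].
        rewrite <- E, Cpow_add.
        transitivity (Cmul (Cmul (Cpow z u) (Cpow (Cconj z) v))
          (Cmul (Cpow z l') (Cpow (Cconj z) l'))); [ring|rewrite Hzl; ring]. }
      rewrite E1. unfold RtoC; c_ring.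
    + unfold RtoC; c_ring.
  - intros q _. rewrite <- Cmul_conj. unfold dirichlet. rewrite csum_conj, csum_mul, <- csum_scal_r.
    apply csum_ext; intros l _. rewrite <- csum_scal_r. apply csum_ext; intros l' _.
    rewrite Cconj_mul, !Cconj_pow, Cconj_conj, !Cpow_add. ring.
Qed.

Lemma rsum_zero f n : (forall i, (i < n)%nat -> f i = 0) -> rsum f n = 0.
Proof.
  intros H. rewrite (rsum_ext f (fun _ => 0)), rsum_const by exact H. ring.
Qed.

Lemma fejer_weight_bounds L n u v : (u <= n)%nat -> (v <= n)%nat -> (2 * n <= L)%nat ->
  INR L - 2 * INR n <= fejer_weight L u v <= INR L.
Proof.
  intros Hu Hv HL.
  set (f := fun l => rsum (fun l' => if Nat.eqb (u + l') (v + l) then 1 else 0) L).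
  (* For given [l] the only candidate is [l' = v + l - u]. *)
  assert (Hf : forall l, f l = if ((u <=? v + l) && (v + l - u <? L))%nat%bool then 1 else 0).
  { intros l. unfold f. destruct (Nat.leb_spec u (v + l)); simpl.
    - destruct (Nat.ltb_spec (v + l - u) L).
      + transitivity (rsum (fun l' => if Nat.eqb (v + l - u) l' then 1 else 0) L);
          [|apply (rsum_delta (fun _ => 1)); assumption].
        apply rsum_ext; intros l' _.
        destruct (Nat.eqb_spec (u + l') (v + l)), (Nat.eqb_spec (v + l - u) l'); lia || reflexivity.
      + apply rsum_zero; intros l' Hl'.
        destruct (Nat.eqb_spec (u + l') (v + l)); lia || reflexivity.
    - apply rsum_zero; intros l' Hl'.
      destruct (Nat.eqb_spec (u + l') (v + l)); lia || reflexivity. }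
  change (INR L - 2 * INR n <= rsum f L <= INR L). split.
  (* Every [l] with [n <= l < L - n] contributes 1. The two truncated subtractions discard the n
     indices at either end. *)
  - assert (Hm : forall m, (m <= L)%nat -> INR (m - n) - INR (m - (L - n)) <= rsum f m).
    { induction m as [|m IH]; intros Hle; [simpl; lra|].
      specialize (IH ltac:(lia)). simpl rsum. rewrite Hf.
      destruct (Nat.le_gt_cases n m).
      - destruct (Nat.le_gt_cases (L - n) m).
        + replace (S m - n)%nat with (S (m - n)) by lia.
          replace (S m - (L - n))%nat with (S (m - (L - n))) by lia. rewrite !S_INR.
          destruct (_ && _)%bool; lra.
        + replace (S m - n)%nat with (S (m - n)) by lia. rewrite S_INR.
          replace (S m - (L - n))%nat with (m - (L - n))%nat by lia.
          destruct (Nat.leb_spec u (v + m)); [|lia].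
          destruct (Nat.ltb_spec (v + m - u) L); [|lia]. simpl. lra.
      - replace (S m - n)%nat with (m - n)%nat by lia.
        replace (S m - (L - n))%nat with (m - (L - n))%nat by lia.
        destruct (_ && _)%bool; lra. }
    specialize (Hm L (Nat.le_refl L)).
    replace (L - (L - n))%nat with n in Hm by lia. rewrite minus_INR in Hm by lia. lra.
  - rewrite <- (Rmult_1_r (INR L)), <- rsum_const. apply rsum_le; intros l _. rewrite Hf.
    destruct (_ && _)%bool; lra.
Qed.

Lemma quad_ext n g g' z :
  (forall j j', (j <= n)%nat -> (j' <= n)%nat -> g j j' = g' j j') -> quad n g z = quad n g' z.
Proof.
  intros H. apply csum_ext; intros j Hj. apply csum_ext; intros j' Hj'.
  rewrite H by lia. reflexivity.
Qed.

(** Dividing the coefficients by the weights beforehand compensates exactly for the averaging. The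
    polynomial becomes a finite combination of squared moduli, whose coefficients are values of the
    corrected polynomial. *)
Lemma fejer_formula L M n g z : Cnorm2 z = 1 -> (2 * n < L)%nat -> (L + n <= M)%nat ->
  Cmul (RtoC (INR M)) (quad n g z) =
  csum (fun q => Cmul (RtoC (Cnorm2 (dirichlet L M q z)))
    (quad n (fun j j' => Cmul (RtoC (/ fejer_weight L j j')) (g j j')) (root M q))) M.
Proof.
  intros Hz HL HM. unfold quad.
  rewrite (csum_ext (fun q => Cmul (RtoC (Cnorm2 (dirichlet L M q z))) _)
    (fun q => csum (fun j => csum (fun j' =>
       Cmul (Cmul (RtoC (/ fejer_weight L j j')) (g j j'))
       (Cmul (RtoC (Cnorm2 (dirichlet L M q z)))
         (Cmul (Cpow (root M q) j) (Cpow (Cconj (root M q)) j')))) (S n)) (S n))).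
  - symmetry. rewrite csum_swap, <- csum_scal. apply csum_ext; intros j Hj.
    rewrite csum_swap, <- csum_scal. apply csum_ext; intros j' Hj'.
    rewrite csum_scal, (dirichlet_moment L M n) by (assumption || lia).
    pose proof (fejer_weight_bounds L n j j' ltac:(lia) ltac:(lia) ltac:(lia)) as Hw.
    assert (2 * INR n < INR L) by (apply (lt_INR (2 * n)) in HL; rewrite mult_INR in HL; exact HL).
    apply C_eq; unfold RtoC, Cmul; simpl; field; lra.
  - intros q _. rewrite <- csum_scal. apply csum_ext; intros j _.
    rewrite <- csum_scal. apply csum_ext; intros j' _. ring.
Qed.

(** The same [w] reweights the coefficients in both variables: [w = 1] is the polynomial itself, and
    inverse Fejer weights give the corrected one. *)
Definition biquad (n m : nat) (w : nat -> nat -> R) (c : nat -> nat -> nat -> nat -> C) (z1 z2 : C) : C :=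
  quad n (fun j j' => Cmul (RtoC (w j j'))
    (quad m (fun k k' => Cmul (RtoC (w k k')) (c j j' k k')) z2)) z1.

Lemma csum_ext_all f g n : (forall i, f i = g i) -> csum f n = csum g n.
Proof. intros H; apply csum_ext; auto. Qed.

Lemma quad_swap n m w w' c z1 z2 :
  quad n (fun j j' => Cmul (RtoC (w j j'))
    (quad m (fun k k' => Cmul (RtoC (w' k k')) (c j j' k k')) z2)) z1 =
  quad m (fun k k' => Cmul (RtoC (w' k k'))
    (quad n (fun j j' => Cmul (RtoC (w j j')) (c j j' k k')) z1)) z2.
Proof.
  unfold quad.
  transitivity (csum (fun j => csum (fun j' => csum (fun k => csum (fun k' =>
    Cmul (Cmul (RtoC (w j j')) (Cmul (RtoC (w' k k')) (c j j' k k')))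
      (Cmul (Cmul (Cpow z1 j) (Cpow (Cconj z1) j')) (Cmul (Cpow z2 k) (Cpow (Cconj z2) k'))))
    (S m)) (S m)) (S n)) (S n)).
  - apply csum_ext_all; intros j. apply csum_ext_all; intros j'.
    rewrite <- csum_scal, <- csum_scal_r. apply csum_ext_all; intros k.
    rewrite <- csum_scal, <- csum_scal_r. apply csum_ext_all; intros k'. ring.
  - rewrite (csum_ext_all _ _ (S n) (fun j => csum_swap _ (S n) (S m))).
    rewrite csum_swap. apply csum_ext_all; intros k.
    rewrite (csum_ext_all _ _ (S n) (fun j => csum_swap _ (S n) (S m))).
    rewrite csum_swap. apply csum_ext_all; intros k'.
    rewrite <- csum_scal, <- csum_scal_r. apply csum_ext_all; intros j.
    rewrite <- csum_scal, <- csum_scal_r. apply csum_ext_all; intros j'. ring.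
Qed.

Lemma fejer_formula2 L M n m c z1 z2 :
  Cnorm2 z1 = 1 -> Cnorm2 z2 = 1 -> (2 * n < L)%nat -> (2 * m < L)%nat -> (L + n + m <= M)%nat ->
  Cmul (RtoC (INR M * INR M)) (biquad n m (fun _ _ => 1) c z1 z2) =
  csum (fun q => csum (fun s =>
    Cmul (RtoC (Cnorm2 (dirichlet L M q z1) * Cnorm2 (dirichlet L M s z2)))
      (biquad n m (fun u v => / fejer_weight L u v) c (root M q) (root M s))) M) M.
Proof.
  intros H1 H2 Hn Hm HM.
  transitivity (Cmul (RtoC (INR M)) (Cmul (RtoC (INR M)) (biquad n m (fun _ _ => 1) c z1 z2)));
    [rewrite RtoC_mul; ring|].
  unfold biquad at 1. rewrite (fejer_formula L M n) by (assumption || lia).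
  rewrite <- csum_scal. apply csum_ext_all; intros q.
  transitivity (Cmul (RtoC (Cnorm2 (dirichlet L M q z1))) (Cmul (RtoC (INR M))
    (quad n (fun j j' => Cmul (RtoC (/ fejer_weight L j j'))
      (quad m (fun k k' => Cmul (RtoC 1) (c j j' k k')) z2)) (root M q)))).
  { transitivity (Cmul (RtoC (Cnorm2 (dirichlet L M q z1))) (Cmul (RtoC (INR M))
    (quad n (fun j j' => Cmul (RtoC (/ fejer_weight L j j')) (Cmul (RtoC 1)
      (quad m (fun k k' => Cmul (RtoC 1) (c j j' k k')) z2))) (root M q)))); [ring|].
    do 2 f_equal. apply quad_ext; intros. unfold RtoC; c_ring. }
  rewrite quad_swap, (fejer_formula L M m) by (assumption || lia).
  rewrite <- csum_scal. apply csum_ext_all; intros s.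
  unfold biquad. rewrite quad_swap.
  rewrite (quad_ext m _ (fun k k' => Cmul (RtoC (/ fejer_weight L k k'))
    (quad n (fun j j' => Cmul (RtoC (/ fejer_weight L j j')) (c j j' k k')) (root M q)))).
  - rewrite RtoC_mul. ring.
  - intros. unfold RtoC; c_ring.
Qed.

Lemma Cre_csum f n : Cre (csum f n) = rsum (fun i => Cre (f i)) n.
Proof. induction n as [|n IH]; simpl; [|rewrite IH]; reflexivity. Qed.

Lemma rsum_close f g h e n :
  (forall i, (i < n)%nat -> Rabs (f i - g i) <= e * h i) ->
  Rabs (rsum f n - rsum g n) <= e * rsum h n.
Proof.
  intros H. induction n as [|n IH]; simpl.
  - rewrite Rminus_diag, Rabs_R0. lra.
  - replace (rsum f n + f n - (rsum g n + g n)) with ((rsum f n - rsum g n) + (f n - g n)) by ring.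
    eapply Rle_trans; [apply Rabs_triang|].
    pose proof (H n ltac:(lia)). assert (Rabs (rsum f n - rsum g n) <= e * rsum h n)
      by (apply IH; intros; apply H; lia). lra.
Qed.

Lemma unimodular_parts z : Cnorm2 z = 1 -> Rabs (Cre z) <= 1 /\ Rabs (Cim z) <= 1.
Proof.
  assert (Hx : forall x, x * x <= 1 -> Rabs x <= 1).
  { intros x Hx. apply Rabs_le. split; apply Rnot_lt_le; intros H; nra. }
  unfold Cnorm2; intros H.
  pose proof (Rle_0_sqr (Cre z)). pose proof (Rle_0_sqr (Cim z)). unfold Rsqr in *.
  split; apply Hx; lra.
Qed.

Definition biquad_bound (n m : nat) (c : nat -> nat -> nat -> nat -> C) : R :=
  rsum (fun j => rsum (fun j' => rsum (fun k => rsum (fun k' =>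
    Rabs (Cre (c j j' k k')) + Rabs (Cim (c j j' k k'))) (S m)) (S m)) (S n)) (S n).

Lemma biquad_close n m w c e z1 z2 :
  Cnorm2 z1 = 1 -> Cnorm2 z2 = 1 ->
  (forall j j' k k', (j <= n)%nat -> (j' <= n)%nat -> (k <= m)%nat -> (k' <= m)%nat ->
     Rabs (w j j' * w k k' - 1) <= e) ->
  Rabs (Cre (biquad n m w c z1 z2) - Cre (biquad n m (fun _ _ => 1) c z1 z2)) <=
  e * biquad_bound n m c.
Proof.
  intros H1 H2 Hw.
  assert (E : forall w, Cre (biquad n m w c z1 z2) =
    rsum (fun j => rsum (fun j' => rsum (fun k => rsum (fun k' => (w j j' * w k k') *
      Cre (Cmul (c j j' k k') (Cmul (Cmul (Cpow z1 j) (Cpow (Cconj z1) j'))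
         (Cmul (Cpow z2 k) (Cpow (Cconj z2) k'))))) (S m)) (S m)) (S n)) (S n)).
  { clear. intros w. unfold biquad, quad. rewrite Cre_csum. apply rsum_ext; intros j _.
    rewrite Cre_csum. apply rsum_ext; intros j' _.
    rewrite <- csum_scal, <- csum_scal_r, Cre_csum. apply rsum_ext; intros k _.
    rewrite <- csum_scal, <- csum_scal_r, Cre_csum. apply rsum_ext; intros k' _.
    unfold RtoC, Cmul; simpl; ring. }
  rewrite !E. unfold biquad_bound.
  apply rsum_close; intros j Hj. apply rsum_close; intros j' Hj'.
  apply rsum_close; intros k Hk. apply rsum_close; intros k' Hk'.
  set (u := Cmul _ (Cmul (Cpow z2 k) _)).
  assert (Hu : Cnorm2 u = 1).
  { unfold u. rewrite !Cnorm2_mul, !Cnorm2_pow, !Cnorm2_conj, H1, H2, !pow1. ring. }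
  destruct (unimodular_parts u Hu) as [Hr Hi]. clearbody u.
  rewrite Rmult_1_r, <- (Rmult_1_l (Cre (Cmul (c j j' k k') u))) at 1.
  replace (w j j' * w k k' * (1 * Cre (Cmul (c j j' k k') u)) - 1 * Cre (Cmul (c j j' k k') u))
    with ((w j j' * w k k' - 1) * Cre (Cmul (c j j' k k') u)) by ring.
  rewrite Rabs_mult. apply Rmult_le_compat; try apply Rabs_pos; [apply Hw; lia|].
  simpl. eapply Rle_trans; [apply Rabs_triang|]. rewrite Rabs_Ropp, !Rabs_mult.
  pose proof (Rabs_pos (Cre (c j j' k k'))). pose proof (Rabs_pos (Cim (c j j' k k'))).
  assert (Rabs (Cre (c j j' k k')) * Rabs (Cre u) <= Rabs (Cre (c j j' k k')) * 1)
    by (apply Rmult_le_compat_l; assumption).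
  assert (Rabs (Cim (c j j' k k')) * Rabs (Cim u) <= Rabs (Cim (c j j' k k')) * 1)
    by (apply Rmult_le_compat_l; assumption).
  lra.
Qed.

(** The ratio minus 1 is at most [2 n / (L - 2 n)], and the condition on L is that this stays below
    [e]. *)
Lemma fejer_weight_ratio L n u v e : (u <= n)%nat -> (v <= n)%nat -> 0 < e ->
  2 * INR n + 2 * INR n / e < INR L ->
  0 <= INR L * / fejer_weight L u v - 1 <= e.
Proof.
  intros Hu Hv He HL. pose proof (pos_INR n).
  assert (0 <= 2 * INR n / e) by (apply Rle_mult_inv_pos; lra).
  assert (Hle : (2 * n <= L)%nat) by (apply INR_le; rewrite mult_INR; simpl; lra).
  pose proof (fejer_weight_bounds L n u v Hu Hv Hle) as Hw.
  set (r := fejer_weight L u v) in *.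
  assert (Hr : 0 < r) by lra.
  replace (INR L * / r - 1) with ((INR L - r) * / r) by (field; lra).
  split.
  - apply Rle_mult_inv_pos; lra.
  - apply (Rmult_le_reg_r r); [exact Hr|]. rewrite Rmult_assoc, Rinv_l, Rmult_1_r by lra.
    apply Rle_trans with (e * (INR L - 2 * INR n)); [|apply Rmult_le_compat_l; lra].
    apply Rle_trans with (e * (2 * INR n / e)).
    + replace (e * (2 * INR n / e)) with (2 * INR n) by (field; lra). lra.
    + apply Rmult_le_compat_l; lra.
Qed.

(** [L^2] times the corrected polynomial tends to the original one uniformly on the torus as L
    grows, so the positive margin [d] absorbs the difference. *)
Lemma biquad_weighted_nonneg n m c d : 0 < d ->
  (forall z1 z2, Cnorm2 z1 = 1 -> Cnorm2 z2 = 1 -> d <= Cre (biquad n m (fun _ _ => 1) c z1 z2)) ->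
  exists L, (2 * n < L)%nat /\ (2 * m < L)%nat /\
  forall z1 z2, Cnorm2 z1 = 1 -> Cnorm2 z2 = 1 ->
    0 <= Cre (biquad n m (fun u v => / fejer_weight L u v) c z1 z2).
Proof.
  intros Hd Hpos.
  assert (HB : 0 <= biquad_bound n m c).
  { unfold biquad_bound. do 4 (apply rsum_ge0; intros).
    apply Rplus_le_le_0_compat; apply Rabs_pos. }
  set (B := biquad_bound n m c) in *.
  (* If both ratios lie in [1, 1 + e] with [e <= 1], their product is within [3 e] of 1, and
     [3 e B <= d]. *)
  set (e := Rmin 1 (d / (3 * (B + 1)))).
  assert (Hdb : 0 < d / (3 * (B + 1))) by (apply Rdiv_lt_0_compat; lra).
  assert (He : 0 < e) by (apply Rmin_glb_lt; lra).
  assert (He1 : e <= 1) by apply Rmin_l.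
  assert (HeB : 3 * e * B <= d).
  { assert (e * (3 * (B + 1)) <= d); [|nra].
    apply Rle_trans with (d / (3 * (B + 1)) * (3 * (B + 1))).
    - apply Rmult_le_compat_r; [lra|apply Rmin_r].
    - right; field; lra. }
  set (p := (n + m)%nat).
  destruct (INR_unbounded (2 * INR p + 2 * INR p / e)) as [L0 HL0].
  set (L := S L0).
  assert (HL : 2 * INR p + 2 * INR p / e < INR L).
  { unfold L. rewrite S_INR. lra. }
  assert (HLp : 0 < INR L) by (apply lt_0_INR; unfold L; lia). clearbody L.
  assert (Hp : 0 <= 2 * INR p / e) by (apply Rle_mult_inv_pos; [pose proof (pos_INR p)|]; lra).
  assert (H2p : (2 * p < L)%nat) by (apply INR_lt; rewrite mult_INR; simpl; lra).
  exists L. split; [lia|]. split; [lia|]. intros z1 z2 H1 H2.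
  pose proof (biquad_close n m (fun u v => INR L * / fejer_weight L u v) c (3 * e) z1 z2 H1 H2) as Hc.
  fold B in Hc. specialize (Hpos z1 z2 H1 H2).
  assert (Hsc : Cre (biquad n m (fun u v => INR L * / fejer_weight L u v) c z1 z2) =
    INR L * INR L * Cre (biquad n m (fun u v => / fejer_weight L u v) c z1 z2)).
  { replace (biquad n m (fun u v => INR L * / fejer_weight L u v) c z1 z2) with
      (Cmul (RtoC (INR L * INR L)) (biquad n m (fun u v => / fejer_weight L u v) c z1 z2));
      [simpl; ring|].
    unfold biquad, quad. rewrite RtoC_mul, <- csum_scal.
    apply csum_ext_all; intros j. rewrite <- csum_scal. apply csum_ext_all; intros j'.
    rewrite RtoC_mul.
    rewrite (csum_ext_all (fun j0 => csum (fun j'0 => Cmul (Cmul (RtoC (INR L * _)) _) _) _)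
      (fun k => Cmul (RtoC (INR L)) (csum (fun k' => Cmul (Cmul (RtoC (/ fejer_weight L k k'))
         (c j j' k k')) (Cmul (Cpow z2 k) (Cpow (Cconj z2) k'))) (S m)))).
    - rewrite csum_scal. ring.
    - intros k. rewrite <- csum_scal. apply csum_ext_all; intros k'. rewrite RtoC_mul. ring. }
  rewrite Hsc in Hc.
  apply (Rmult_le_reg_l (INR L * INR L)); [nra|]. rewrite Rmult_0_r.
  assert (Hab : Rabs (INR L * INR L * Cre (biquad n m (fun u v => / fejer_weight L u v) c z1 z2)
     - Cre (biquad n m (fun _ _ => 1) c z1 z2)) <= 3 * e * B).
  { apply Hc. intros j j' k k' Hj Hj' Hk Hk'.
    pose proof (fejer_weight_ratio L p j j' e ltac:(lia) ltac:(lia) He HL) as Ha.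
    pose proof (fejer_weight_ratio L p k k' e ltac:(lia) ltac:(lia) He HL) as Hb.
    set (a := INR L * / fejer_weight L j j') in *. set (b := INR L * / fejer_weight L k k') in *.
    replace (a * b - 1) with ((a - 1) * (b - 1) + (a - 1) + (b - 1)) by ring.
    assert (0 <= (a - 1) * (b - 1) <= e * 1).
    { split; [apply Rmult_le_pos; lra|]. apply Rmult_le_compat; lra. }
    rewrite Rabs_right; lra. }
  pose proof (Rle_abs (- (INR L * INR L * Cre (biquad n m (fun u v => / fejer_weight L u v) c z1 z2)
     - Cre (biquad n m (fun _ _ => 1) c z1 z2)))) as Hab'.
  rewrite Rabs_Ropp in Hab'. lra.
Qed.

Lemma biquad_modulus n m a z1 z2 :
  biquad n m (fun _ _ => 1) (fun j j' k k' => Cmul (a j k) (Cconj (a j' k'))) z1 z2 =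
  RtoC (Cnorm2 (poly2 n m a z1 z2)).
Proof.
  rewrite <- Cmul_conj. unfold poly2, biquad, quad. rewrite csum_conj, csum_mul.
  apply csum_ext_all; intros j. apply csum_ext_all; intros j'.
  rewrite csum_conj, csum_mul.
  replace (RtoC 1) with C1 by reflexivity.
  transitivity (Cmul (Cmul (Cpow z1 j) (Cpow (Cconj z1) j'))
    (csum (fun k => csum (fun k' => Cmul (Cmul C1 (Cmul (a j k) (Cconj (a j' k'))))
       (Cmul (Cpow z2 k) (Cpow (Cconj z2) k'))) (S m)) (S m))); [ring|].
  rewrite <- csum_scal. apply csum_ext_all; intros k. rewrite <- csum_scal.
  apply csum_ext_all; intros k'. rewrite !Cconj_mul, !Cconj_pow. ring.
Qed.

Lemma biquad_sub n m w c c' z1 z2 :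
  biquad n m w (fun j j' k k' => Csub (c j j' k k') (c' j j' k k')) z1 z2 =
  Csub (biquad n m w c z1 z2) (biquad n m w c' z1 z2).
Proof.
  assert (Hs : forall f g n, csum (fun i => Csub (f i) (g i)) n = Csub (csum f n) (csum g n)).
  { clear. induction n as [|n IH]; simpl; [ring|rewrite IH; ring]. }
  unfold biquad, quad. rewrite <- Hs. apply csum_ext_all; intros j.
  rewrite <- Hs. apply csum_ext_all; intros j'.
  transitivity (Cmul (Cmul (RtoC (w j j')) (csum (fun k => Csub
     (csum (fun k' => Cmul (Cmul (RtoC (w k k')) (c j j' k k'))
        (Cmul (Cpow z2 k) (Cpow (Cconj z2) k'))) (S m))
     (csum (fun k' => Cmul (Cmul (RtoC (w k k')) (c' j j' k k'))
        (Cmul (Cpow z2 k) (Cpow (Cconj z2) k'))) (S m))) (S m)))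
     (Cmul (Cpow z1 j) (Cpow (Cconj z1) j'))).
  - do 2 f_equal. apply csum_ext_all; intros k. rewrite <- Hs. apply csum_ext_all; intros k'. ring.
  - rewrite Hs. ring.
Qed.

Lemma rsum_append f p r : rsum f (p + r) = rsum f p + rsum (fun i => f (p + i)%nat) r.
Proof.
  induction r as [|r IH]; [rewrite Nat.add_0_r; simpl; ring|].
  rewrite Nat.add_succ_r. simpl. rewrite IH. ring.
Qed.

Lemma rsum_flatten (f : nat -> nat -> R) p r : (0 < r)%nat ->
  rsum (fun i => f (i / r) (i mod r))%nat (p * r) = rsum (fun i => rsum (f i) r) p.
Proof.
  intros Hr. induction p as [|p IH]; [reflexivity|].
  replace (S p * r)%nat with (p * r + r)%nat by (simpl; lia).
  rewrite rsum_append, IH. simpl. f_equal. apply rsum_ext; intros i Hi.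
  replace ((p * r + i) / r)%nat with p.
  - replace ((p * r + i) mod r)%nat with i; [reflexivity|].
    apply (Nat.mod_unique _ _ p); lia.
  - apply (Nat.div_unique _ _ _ i); lia.
Qed.

(** In the two-variable Fejer formula the coefficients are now nonnegative, so each summand is the
    squared modulus of a multiple of a product of two Dirichlet kernels. *)
Theorem positive_difference_sos n m (a b : nat -> nat -> C) d : 0 < d ->
  (forall z1 z2, Cnorm2 z1 = 1 -> Cnorm2 z2 = 1 ->
     d <= Cnorm2 (poly2 n m a z1 z2) - Cnorm2 (poly2 n m b z1 z2)) ->
  exists L p (E : nat -> nat -> nat -> C), (n <= L)%nat /\ (m <= L)%nat /\
  forall z1 z2, Cnorm2 z1 = 1 -> Cnorm2 z2 = 1 ->
    Cnorm2 (poly2 n m a z1 z2) =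
    Cnorm2 (poly2 n m b z1 z2) + rsum (fun i => Cnorm2 (poly2 L L (E i) z1 z2)) p.
Proof.
  intros Hd Hpos.
  set (c := fun j j' k k' => Csub (Cmul (a j k) (Cconj (a j' k'))) (Cmul (b j k) (Cconj (b j' k')))).
  assert (Hc : forall z1 z2, Cre (biquad n m (fun _ _ => 1) c z1 z2) =
     Cnorm2 (poly2 n m a z1 z2) - Cnorm2 (poly2 n m b z1 z2)).
  { intros z1 z2. unfold c.
    rewrite (biquad_sub n m _ (fun j j' k k' => Cmul (a j k) (Cconj (a j' k')))
      (fun j j' k k' => Cmul (b j k) (Cconj (b j' k')))), !biquad_modulus. simpl. ring. }
  destruct (biquad_weighted_nonneg n m c d Hd) as [L [Hn [Hm Hw]]].
  { intros z1 z2 H1 H2. rewrite Hc. apply Hpos; assumption. }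
  set (M := (L + n + m)%nat).
  assert (HM : 0 < INR M) by (apply lt_0_INR; unfold M; lia).
  set (W := fun q s => Cre (biquad n m (fun u v => / fejer_weight L u v) c (root M q) (root M s))).
  assert (HW : forall q s, 0 <= W q s) by (intros; apply Hw; apply Cnorm2_root).
  (* Coefficients of [sqrt (W q s) / M] times [D(z1/w_q) D(z2/w_s)]; the factor M comes from the
     [M^2] in the formula. *)
  set (E := fun q s j k => Cmul (RtoC (sqrt (W q s) / INR M))
     (Cmul (Cpow (Cconj (root M q)) j) (Cpow (Cconj (root M s)) k))).
  (* The kernel with L terms has degree [L - 1]. The pair [(q, s)] is encoded as the single index
     [q * M + s]. *)
  exists (L - 1)%nat, (M * M)%nat, (fun i => E (i / M) (i mod M))%nat.
  split; [lia|]. split; [lia|]. intros z1 z2 H1 H2.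
  rewrite (rsum_flatten (fun q s => Cnorm2 (poly2 (L - 1) (L - 1) (E q s) z1 z2)))
    by (unfold M; lia).
  assert (HE : forall q s, Cnorm2 (poly2 (L - 1) (L - 1) (E q s) z1 z2) =
    / (INR M * INR M) * (Cnorm2 (dirichlet L M q z1) * Cnorm2 (dirichlet L M s z2) * W q s)).
  { intros q s.
    replace (poly2 (L - 1) (L - 1) (E q s) z1 z2) with
      (Cmul (RtoC (sqrt (W q s) / INR M)) (Cmul (dirichlet L M q z1) (dirichlet L M s z2))).
    - rewrite !Cnorm2_mul. unfold Cnorm2 at 1; simpl.
      pose proof (sqrt_sqrt (W q s) (HW q s)) as Hs.
      transitivity (sqrt (W q s) * sqrt (W q s) * / (INR M * INR M) *
        (Cnorm2 (dirichlet L M q z1) * Cnorm2 (dirichlet L M s z2))); [field; lra|].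
      rewrite Hs. ring.
    - unfold poly2, dirichlet. replace (S (L - 1)) with L by lia.
      rewrite csum_mul, <- csum_scal. apply csum_ext_all; intros j.
      rewrite <- csum_scal. apply csum_ext_all; intros k. unfold E. ring. }
  rewrite (rsum_ext _ (fun q => / (INR M * INR M) * rsum (fun s =>
     Cnorm2 (dirichlet L M q z1) * Cnorm2 (dirichlet L M s z2) * W q s) M)).
  - rewrite rsum_scal.
    pose proof (f_equal Cre (fejer_formula2 L M n m c z1 z2 H1 H2 Hn Hm (Nat.le_refl _))) as Hf.
    rewrite Cre_csum in Hf.
    rewrite (rsum_ext (fun i => Cre (csum _ M)) (fun q => rsum (fun s =>
      Cnorm2 (dirichlet L M q z1) * Cnorm2 (dirichlet L M s z2) * W q s) M)) in Hf.
    + rewrite <- Hf. unfold Cmul, RtoC; cbn [Cre Cim]. rewrite Hc. field; lra.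
    + intros q _. rewrite Cre_csum. apply rsum_ext; intros s _.
      unfold Cmul, RtoC, W; cbn [Cre Cim]. ring.
  - intros q _. rewrite <- rsum_scal. apply rsum_ext; intros s _. apply HE.
Qed.

(** * Compactness of the bidisk *)

Definition continuous2 (f : C -> C -> C) : Prop :=
  forall z1 z2 eps, 0 < eps -> exists r, 0 < r /\ forall w1 w2,
    Cnorm2 (Csub w1 z1) < r -> Cnorm2 (Csub w2 z2) < r ->
    Cnorm2 (Csub (f w1 w2) (f z1 z2)) < eps.

Lemma Cnorm2_add_le a b : Cnorm2 (Cadd a b) <= 2 * Cnorm2 a + 2 * Cnorm2 b.
Proof.
  unfold Cnorm2; simpl.
  pose proof (Rle_0_sqr (Cre a - Cre b)). pose proof (Rle_0_sqr (Cim a - Cim b)).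
  unfold Rsqr in *. lra.
Qed.

Lemma continuous2_const c : continuous2 (fun _ _ => c).
Proof.
  intros z1 z2 eps He. exists 1; split; [lra|]. intros w1 w2 _ _.
  replace (Csub c c) with C0 by ring. unfold Cnorm2; simpl; lra.
Qed.

Lemma continuous2_fst : continuous2 (fun z _ => z).
Proof. intros z1 z2 eps He. exists eps; auto. Qed.

Lemma continuous2_snd : continuous2 (fun _ z => z).
Proof. intros z1 z2 eps He. exists eps; auto. Qed.

Lemma continuous2_add f g :
  continuous2 f -> continuous2 g -> continuous2 (fun z1 z2 => Cadd (f z1 z2) (g z1 z2)).
Proof.
  intros Hf Hg z1 z2 eps He.
  destruct (Hf z1 z2 (eps / 4)) as [r [Hr Hf']]; [lra|].
  destruct (Hg z1 z2 (eps / 4)) as [s [Hs Hg']]; [lra|].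
  exists (Rmin r s). split; [apply Rmin_glb_lt; assumption|]. intros w1 w2 H1 H2.
  pose proof (Rmin_l r s). pose proof (Rmin_r r s).
  specialize (Hf' w1 w2 ltac:(lra) ltac:(lra)). specialize (Hg' w1 w2 ltac:(lra) ltac:(lra)).
  replace (Csub _ _) with (Cadd (Csub (f w1 w2) (f z1 z2)) (Csub (g w1 w2) (g z1 z2))) by ring.
  pose proof (Cnorm2_add_le (Csub (f w1 w2) (f z1 z2)) (Csub (g w1 w2) (g z1 z2))). lra.
Qed.

Lemma continuous2_mul f g :
  continuous2 f -> continuous2 g -> continuous2 (fun z1 z2 => Cmul (f z1 z2) (g z1 z2)).
Proof.
  intros Hf Hg z1 z2 eps He.
  set (A := Cnorm2 (f z1 z2)). set (B := Cnorm2 (g z1 z2)).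
  assert (HA : 0 <= A) by apply Cnorm2_ge0. assert (HB : 0 <= B) by apply Cnorm2_ge0.
  set (D := 8 * (1 + A + B)).
  set (e := Rmin 1 (eps / D)).
  assert (HeD : 0 < eps / D) by (apply Rdiv_lt_0_compat; unfold D; lra).
  assert (He' : 0 < e) by (apply Rmin_glb_lt; lra).
  destruct (Hf z1 z2 e He') as [r [Hr Hf']].
  destruct (Hg z1 z2 e He') as [s [Hs Hg']].
  exists (Rmin r s). split; [apply Rmin_glb_lt; assumption|]. intros w1 w2 H1 H2.
  pose proof (Rmin_l r s). pose proof (Rmin_r r s).
  specialize (Hf' w1 w2 ltac:(lra) ltac:(lra)). specialize (Hg' w1 w2 ltac:(lra) ltac:(lra)).
  set (u := Csub (f w1 w2) (f z1 z2)) in *. set (v := Csub (g w1 w2) (g z1 z2)) in *.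
  replace (Csub _ _) with (Cadd (Cmul u v) (Cadd (Cmul u (g z1 z2)) (Cmul (f z1 z2) v)))
    by (unfold u, v; ring).
  pose proof (Cnorm2_add_le (Cmul u v) (Cadd (Cmul u (g z1 z2)) (Cmul (f z1 z2) v))) as E1.
  pose proof (Cnorm2_add_le (Cmul u (g z1 z2)) (Cmul (f z1 z2) v)) as E2.
  rewrite Cnorm2_mul in E1. rewrite !Cnorm2_mul in E2. fold A B in E2.
  pose proof (Cnorm2_ge0 u). pose proof (Cnorm2_ge0 v).
  assert (He1 : e <= 1) by apply Rmin_l.
  assert (e * D <= eps).
  { apply Rle_trans with (eps / D * D); [apply Rmult_le_compat_r; [unfold D; lra|apply Rmin_r]|].
    right; field. unfold D; lra. }
  assert (Cnorm2 u * Cnorm2 v <= e * 1) by (apply Rmult_le_compat; lra).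
  assert (Cnorm2 u * B <= e * B) by (apply Rmult_le_compat_r; lra).
  assert (A * Cnorm2 v <= A * e) by (apply Rmult_le_compat_l; lra).
  assert (2 * e + 4 * (e * B) + 4 * (A * e) < e * D); [|lra].
  unfold D. nra.
Qed.

Lemma continuous2_csum (f : nat -> C -> C -> C) n :
  (forall i, continuous2 (f i)) -> continuous2 (fun z1 z2 => csum (fun i => f i z1 z2) n).
Proof.
  intros H. induction n as [|n IH]; simpl; [apply continuous2_const|].
  apply (continuous2_add (fun z1 z2 => csum (fun i => f i z1 z2) n)); auto.
Qed.

Lemma continuous2_pow f k : continuous2 f -> continuous2 (fun z1 z2 => Cpow (f z1 z2) k).
Proof.
  intros H. induction k as [|k IH]; simpl; [apply continuous2_const|].
  apply (continuous2_mul f); auto.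
Qed.

Lemma continuous2_poly n m c : continuous2 (poly2 n m c).
Proof.
  unfold poly2.
  apply (continuous2_csum (fun j z1 z2 => csum (fun k => Cmul (c j k) (Cmul (Cpow z1 j) (Cpow z2 k))) (S m))).
  intros j. apply (continuous2_csum (fun k z1 z2 => Cmul (c j k) (Cmul (Cpow z1 j) (Cpow z2 k)))).
  intros k. apply continuous2_mul; [apply continuous2_const|].
  apply continuous2_mul; apply continuous2_pow; [apply continuous2_fst|apply continuous2_snd].
Qed.

Lemma continuous2_conj f : continuous2 f -> continuous2 (fun z1 z2 => Cconj (f z1 z2)).
Proof.
  intros H z1 z2 eps He. destruct (H z1 z2 eps He) as [r [Hr H']].
  exists r; split; [exact Hr|]. intros w1 w2 H1 H2.
  replace (Csub (Cconj (f w1 w2)) (Cconj (f z1 z2))) with (Cconj (Csub (f w1 w2) (f z1 z2)))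
    by (unfold Csub, Copp; c_ring).
  rewrite Cnorm2_conj. auto.
Qed.

(** A local-to-global principle for predicates that weaken as the radius shrinks. It reduces to
    gauge compactness of the square [-1, 1]^2, where a point outside the disk receives a box that
    misses the disk. *)
Lemma disk_compactness (P : R -> C -> Prop) :
  (forall r s z, s <= r -> P r z -> P s z) ->
  (forall z, Cnorm2 z <= 1 -> exists r, 0 < r /\
     forall w, Cnorm2 w <= 1 -> Cnorm2 (Csub w z) < r -> P r w) ->
  exists r, 0 < r /\ forall z, Cnorm2 z <= 1 -> P r z.
Proof.
  intros Hmono Hloc.
  assert (Hbox : forall x y, exists r : posreal, forall u v, Rabs (u - x) < r -> Rabs (v - y) < r ->
     Cnorm2 (mkC u v) <= 1 -> P r (mkC u v)).
  { intros x y. destruct (Rle_dec (Cnorm2 (mkC x y)) 1) as [Hin|Hout].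
    - destruct (Hloc _ Hin) as [r [Hr H]].
      (* Coordinates within [s] give squared distance below [2 s^2 <= 2 s <= r]. *)
      set (s := Rmin r (Rmin 1 (r / 2))).
      assert (Hs : 0 < s) by (repeat apply Rmin_glb_lt; lra).
      assert (s <= r) by apply Rmin_l.
      assert (s <= Rmin 1 (r / 2)) by apply Rmin_r.
      pose proof (Rmin_l 1 (r / 2)). pose proof (Rmin_r 1 (r / 2)).
      exists (mkposreal s Hs). intros u v Hu Hv Huv. apply (Hmono r); [assumption|].
      apply H; [exact Huv|]. unfold Cnorm2; simpl.
      apply Rabs_def2 in Hu, Hv. simpl in *.
      replace (u + - x) with (u - x) by ring. replace (v + - y) with (v - y) by ring.
      assert ((u - x) * (u - x) < s * s) by nra. assert ((v - y) * (v - y) < s * s) by nra. nra.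
    - unfold Cnorm2 in Hout; simpl in Hout.
      set (k := x * x + y * y - 1). assert (Hk : 0 < k) by (unfold k; lra).
      pose proof (Rabs_pos x). pose proof (Rabs_pos y).
      (* By [|w|^2 >= |z|^2 + 2 (x (u - x) + y (v - y))], a box of this radius around [z] stays
         outside the disk. *)
      set (s := k / (2 * (Rabs x + Rabs y + 1))).
      assert (Hs : 0 < s) by (apply Rdiv_lt_0_compat; lra).
      assert (Es : 2 * (Rabs x + Rabs y) * s < k).
      { assert (s * (2 * (Rabs x + Rabs y + 1)) = k) by (unfold s; field; lra). nra. }
      exists (mkposreal s Hs). simpl. intros u v Hu Hv Huv. exfalso.
      unfold Cnorm2 in Huv; simpl in Huv.
      assert (Ex : - (Rabs x * s) <= x * (u - x)).
      { pose proof (Rle_abs (- (x * (u - x)))) as E. rewrite Rabs_Ropp, Rabs_mult in E.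
        assert (Rabs x * Rabs (u - x) <= Rabs x * s) by (apply Rmult_le_compat_l; lra). lra. }
      assert (Ey : - (Rabs y * s) <= y * (v - y)).
      { pose proof (Rle_abs (- (y * (v - y)))) as E. rewrite Rabs_Ropp, Rabs_mult in E.
        assert (Rabs y * Rabs (v - y) <= Rabs y * s) by (apply Rmult_le_compat_l; lra). lra. }
      pose proof (Rle_0_sqr (u - x)). pose proof (Rle_0_sqr (v - y)).
      unfold k, Rsqr in *. nra. }
  assert (Hbox' : forall xy : R * R, exists r : posreal, forall u v,
     Rabs (u - fst xy) < r -> Rabs (v - snd xy) < r ->
     Cnorm2 (mkC u v) <= 1 -> P r (mkC u v)) by (intros [x y]; apply Hbox).
  destruct (choice _ Hbox') as [rho Hrho].
  destruct (Compactness.compactness_value_2d (-1) 1 (-1) 1 (fun x y => rho (x, y))) as [r Hr].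
  exists r. split; [apply cond_pos|]. intros [x y] Hz.
  assert (Hx : -1 <= x <= 1) by (unfold Cnorm2 in Hz; simpl in Hz; nra).
  assert (Hy : -1 <= y <= 1) by (unfold Cnorm2 in Hz; simpl in Hz; nra).
  (* The compactness theorem asserts the existence of the box point only under a double negation. *)
  apply NNPP. intros Hn. apply (Hr x y Hx Hy). intros (u & v & _ & _ & Hu & Hv & Hle).
  apply Hn, (Hmono (rho (u, v))); [exact Hle|]. apply (Hrho (u, v)); assumption.
Qed.

(** Compactness of one disk is used twice: in [z2], to get a bound near a fixed [z1], and then in
    [z1]. *)
Lemma bidisk_positive_lower_bound (G : C -> C -> C) :
  continuous2 G ->
  (forall z1 z2, Cnorm2 z1 <= 1 -> Cnorm2 z2 <= 1 -> 0 < Cre (G z1 z2)) ->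
  exists d, 0 < d /\ forall z1 z2, Cnorm2 z1 <= 1 -> Cnorm2 z2 <= 1 -> d <= Cre (G z1 z2).
Proof.
  intros HG Hpos.
  destruct (disk_compactness (fun d z1 => forall z2, Cnorm2 z2 <= 1 -> d <= Cre (G z1 z2)))
    as [d [Hd H]]; [| |exists d; split; [exact Hd|]; intros; apply H; assumption].
  { intros r s z Hs H z2 H2. eapply Rle_trans; [exact Hs|apply H, H2]. }
  intros z1 H1.
  (* Here [d] is both the lower bound and the radius of the neighbourhood of [z1], so that a single
     parameter becomes uniform in [z2]. *)
  destruct (disk_compactness (fun d z2 => forall w1, Cnorm2 w1 <= 1 -> Cnorm2 (Csub w1 z1) < d ->
     d <= Cre (G w1 z2))) as [d [Hd H]].
  - intros r s z Hs H w1 Hw Hlt. eapply Rle_trans; [exact Hs|]. apply H; lra.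
  - intros z2 H2. specialize (Hpos z1 z2 H1 H2). set (g := Cre (G z1 z2)) in *.
    destruct (HG z1 z2 (g / 2 * (g / 2))) as [r [Hr Hc]]; [nra|].
    exists (Rmin r (g / 2)). pose proof (Rmin_l r (g / 2)). pose proof (Rmin_r r (g / 2)).
    split; [apply Rmin_glb_lt; lra|]. intros w2 Hw2 Hlt2 w1 Hw1 Hlt1.
    specialize (Hc w1 w2 ltac:(lra) ltac:(lra)). unfold Cnorm2 in Hc; simpl in Hc. fold g in Hc.
    apply Rle_trans with (g / 2); [assumption|]. apply Rnot_lt_le. intros Hlt.
    pose proof (Rle_0_sqr (Cim (G w1 w2) + - Cim (G z1 z2))) as Hi. unfold Rsqr in Hi. nra.
  - exists d. split; [exact Hd|]. intros w1 Hw1 Hlt z2 H2. apply H; assumption.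
Qed.

(** * The transfer function *)

Definition reflect2 (n m : nat) (c : nat -> nat -> C) (j k : nat) : C :=
  Cconj (c (n - j) (m - k))%nat.

Lemma csum_shift f n : csum f (S n) = Cadd (f 0%nat) (csum (fun i => f (S i)) n).
Proof.
  induction n as [|n IH]; [simpl; ring|].
  change (Cadd (csum f (S n)) (f (S n)) = Cadd (f 0%nat) (Cadd (csum (fun i => f (S i)) n) (f (S n)))).
  rewrite IH. ring.
Qed.

Lemma csum_rev f n : csum f (S n) = csum (fun j => f (n - j)%nat) (S n).
Proof.
  induction n as [|n IH]; [reflexivity|].
  rewrite (csum_shift (fun j => f (S n - j)%nat)).
  change (Cadd (csum f (S n)) (f (S n)) = Cadd (f (S n)) (csum (fun i => f (n - i)%nat) (S n))).
  rewrite <- IH. ring.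
Qed.

Lemma Cpow_reflect z n j : Cnorm2 z = 1 -> (j <= n)%nat ->
  Cpow z (n - j) = Cmul (Cpow z n) (Cpow (Cconj z) j).
Proof.
  intros Hz Hj. replace n with ((n - j) + j)%nat at 2 by lia. rewrite Cpow_add.
  transitivity (Cmul (Cpow z (n - j)) (Cmul (Cpow z j) (Cpow (Cconj z) j))); [|ring].
  rewrite Cconj_pow_mul_pow by exact Hz. ring.
Qed.

Lemma poly2_reflect n m c z1 z2 : Cnorm2 z1 = 1 -> Cnorm2 z2 = 1 ->
  poly2 n m (reflect2 n m c) z1 z2 =
  Cmul (Cmul (Cpow z1 n) (Cpow z2 m)) (Cconj (poly2 n m c z1 z2)).
Proof.
  intros H1 H2. unfold poly2. rewrite csum_rev, csum_conj, <- csum_scal.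
  apply csum_ext; intros j Hj. rewrite csum_rev, csum_conj, <- csum_scal.
  apply csum_ext; intros k Hk. unfold reflect2.
  replace (n - (n - j))%nat with j by lia. replace (m - (m - k))%nat with k by lia.
  rewrite !Cpow_reflect by (assumption || lia). rewrite !Cconj_mul, !Cconj_pow. ring.
Qed.

Lemma q_vsum_cauchy_schwarz {K : PH} (c : nat -> C) (y : nat -> K) n :
  q (vsum (fun l => vscal (c l) (y l)) n) <=
  rsum (fun l => Cnorm2 (c l)) n * rsum (fun l => q (y l)) n.
Proof.
  induction n as [|n IH]; simpl; [rewrite q_z; lra|].
  rewrite q_add, q_scal.
  set (S := vsum _ n) in *. set (A := rsum _ n) in *. set (Y := rsum (fun l => q (y l)) n) in *.
  assert (HA : 0 <= A) by (apply rsum_ge0; intros; apply Cnorm2_ge0).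
  assert (HY : 0 <= Y) by (apply rsum_ge0; intros; apply q_ge0).
  pose proof (cauchy_schwarz S (vscal (c n) (y n))) as Hc. rewrite q_scal in Hc.
  pose proof (Cnorm2_ge0 (c n)). pose proof (q_ge0 (y n)).
  set (g := Cnorm2 (c n)) in *. set (h := q (y n)) in *. set (i := ip S _) in *.
  assert (Hi : i * i <= (A * h) * (g * Y)).
  { apply Rle_trans with (q S * (g * h)); [exact Hc|].
    apply Rle_trans with (A * Y * (g * h)); [apply Rmult_le_compat_r; nra|right; ring]. }
  assert (0 <= A * h) by (apply Rmult_le_pos; assumption).
  assert (0 <= g * Y) by (apply Rmult_le_pos; assumption).
  assert (2 * i <= A * h + g * Y).
  { apply Rnot_lt_le; intros Hlt. pose proof (Rle_0_sqr (A * h - g * Y)). unfold Rsqr in *. nra. }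
  lra.
Qed.

(* The matrix [[b~, E*], [E, -b]] is a contraction after division by a, where
   |a|^2 = |b|^2 + |E|^2: its first column has norm |a| and is orthogonal to the others. *)
Lemma colligation_contractive {K : PH} (alpha2 : R) (beta : C) (e : nat -> C) (x : K) (y : nat -> K) p :
  alpha2 = Cnorm2 beta + rsum (fun l => Cnorm2 (e l)) p ->
  q (vadd (vscal (Cconj beta) x) (vsum (fun l => vscal (Cconj (e l)) (y l)) p)) +
  rsum (fun l => q (vsub (vscal (e l) x) (vscal beta (y l)))) p <=
  alpha2 * (q x + rsum (fun l => q (y l)) p).
Proof.
  intros ->.
  (* The cross terms of the lower rows are opposite to that of row 0. After cancellation only the
     bound of [sum conj(e l) y l] by Cauchy-Schwarz remains. *)
  assert (E : rsum (fun l => q (vsub (vscal (e l) x) (vscal beta (y l)))) p =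
    rsum (fun l => Cnorm2 (e l)) p * q x + Cnorm2 beta * rsum (fun l => q (y l)) p
    - 2 * ip (vscal (Cconj beta) x) (vsum (fun l => vscal (Cconj (e l)) (y l)) p)).
  { rewrite ip_vsum_r. induction p as [|p IH]; simpl; [ring|]. rewrite IH.
    unfold vsub. rewrite q_add, q_opp, ip_opp_r, !q_scal.
    replace (ip (vscal (e p) x) (vscal beta (y p))) with
      (ip (vscal (Cconj beta) x) (vscal (Cconj (e p)) (y p))); [ring|].
    rewrite !ip_adj, !vscal_assoc, Cconj_conj. do 2 f_equal. ring. }
  rewrite E, q_add, q_scal, Cnorm2_conj.
  pose proof (q_vsum_cauchy_schwarz (fun l => Cconj (e l)) y p) as Hc.
  rewrite (rsum_ext (fun l => Cnorm2 (Cconj (e l))) (fun l => Cnorm2 (e l))) in Hc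
    by (intros; apply Cnorm2_conj).
  lra.
Qed.

Lemma poly_op_comm {H : PH} n m c n' m' c' (A B : H -> H) x :
  is_lin A -> is_lin B -> (forall x, A (B x) = B (A x)) ->
  poly_op n m c A B (poly_op n' m' c' A B x) = poly_op n' m' c' A B (poly_op n m c A B x).
Proof.
  intros HA HB Hc. apply poly_op_map; [apply poly_op_lin; assumption| |];
    intros y; symmetry; apply poly_op_map; auto.
Qed.

(** An equality on the torus is the inequality [|f - g|^2 <= 0], which transfers to the dilation and
    descends through [P]. No comparison of coefficients is involved. *)
Lemma identity_principle (H : PH) (T1 T2 : H -> H) f g :
  complete H -> definite H -> strict T1 -> strict T2 -> (forall x, T1 (T2 x) = T2 (T1 x)) ->
  (forall (K : PH) z1 z2, Cnorm2 z1 = 1 -> Cnorm2 z2 = 1 -> forall x : nat -> K,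
     eval (with_op true (vscal z1) (vscal z2)) x f = eval (with_op true (vscal z1) (vscal z2)) x g) ->
  forall x, eval (with_op true T1 T2) x f = eval (with_op true T1 T2) x g.
Proof.
  intros Hc Hdef HT1 HT2 Hcom E x.
  destruct (ando H T1 T2 Hc Hdef HT1 HT2 Hcom)
    as (K & V1 & V2 & P & J & HV1 & HV2 & HVV & HP & HPq & HP1 & HP2 & HPJ & HJ).
  assert (Hz : forall y,
    rsum (fun _ => q (eval (with_op true V1 V2) y (MAdd f (MScal (Copp C1) g)))) 1 <=
    rsum (fun _ => q (eval (with_op true V1 V2) y MZero)) 1).
  { apply (transfer V1 V2 (fun _ => MAdd f (MScal (Copp C1) g)) (fun _ => MZero) 1 HV1 HV2 HVV).
    intros z1 z2 H1 H2 w. cbn [rsum eval]. rewrite (E K z1 z2 H1 H2 w).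
    match goal with |- _ + q ?v <= _ => replace v with (vz : K) by v_ring end. lra. }
  apply definite_eq; [exact Hdef|]. apply Rle_antisym; [|apply q_ge0].
  specialize (Hz (fun j => J (x j))).
  assert (Hev : forall h, eval (with_op true T1 T2) x h =
     P (eval (with_op true V1 V2) (fun j => J (x j)) h)).
  { intros h. rewrite (eval_map P _ (with_op true T1 T2)); [|exact HP|].
    - apply eval_ext; [reflexivity|]. intros; symmetry; apply HPJ.
    - intros [|] y; [apply HP1|apply HP2]. }
  rewrite !Hev, <- (lin_sub P _ _ HP). eapply Rle_trans; [apply HPq|].
  cbn [rsum eval] in Hz. rewrite q_z in Hz. unfold vsub. rewrite vopp_scal. lra.
Qed.

(** Stated for all complete definite spaces with one choice of r and s, so that it yields both the
    operator inequality and, on the space C, the pointwise bound. *)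
Theorem degree_one_schur_agler n m (a b : nat -> nat -> C) d : 0 < d ->
  (forall z1 z2, Cnorm2 z1 <= 1 -> Cnorm2 z2 <= 1 ->
     d <= Cnorm2 (poly2 n m a z1 z2) - Cnorm2 (poly2 n m b z1 z2)) ->
  exists r s : nat, forall (H : PH) (T1 T2 T3 : H -> H),
    complete H -> definite H -> strict T1 -> strict T2 -> strict T3 ->
    (forall x, T1 (T2 x) = T2 (T1 x)) -> (forall x, T1 (T3 x) = T3 (T1 x)) ->
    (forall x, T2 (T3 x) = T3 (T2 x)) ->
    (forall x, q (Nat.iter r T1 (Nat.iter s T2
        (vadd (poly_op n m (reflect2 n m b) T1 T2 x) (poly_op n m (reflect2 n m a) T1 T2 (T3 x))))) <=
      q (vadd (poly_op n m a T1 T2 x) (poly_op n m b T1 T2 (T3 x)))) /\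
    exists X : H -> H,
      (forall x, vadd (poly_op n m a T1 T2 (X x)) (poly_op n m b T1 T2 (T3 (X x))) = x) /\
      (forall x, X (vadd (poly_op n m a T1 T2 x) (poly_op n m b T1 T2 (T3 x))) = x).
Proof.
  intros Hd Hpos.
  destruct (positive_difference_sos n m a b d Hd) as (L & p & E & HnL & HmL & Hsos).
  { intros z1 z2 H1 H2. apply Hpos; lra. }
  exists (L - n)%nat, (L - m)%nat. intros H T1 T2 T3 Hc Hdef HT1 HT2 HT3 H12 H13 H23.
  assert (Ha : forall z1 z2, Cnorm2 z1 <= 1 -> Cnorm2 z2 <= 1 -> d <= Cnorm2 (poly2 n m a z1 z2)).
  { intros z1 z2 H1 H2. pose proof (Hpos z1 z2 H1 H2). pose proof (Cnorm2_ge0 (poly2 n m b z1 z2)). lra. }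
  destruct (von_neumann_quotient n m a d Hd Ha H T1 T2 Hc Hdef HT1 HT2 H12) as (Hlow & Hdense & Hvn).
  pose proof (proj1 HT1) as HL1. pose proof (proj1 HT2) as HL2. pose proof (proj1 HT3) as HL3.
  pose proof (strict_contraction_of T1 HT1) as HC1.
  pose proof (strict_contraction_of T2 HT2) as HC2.
  pose proof (strict_contraction_of T3 HT3) as HC3.
  assert (Hlin : forall N M c, is_lin (poly_op N M c T1 T2)) by (intros; apply poly_op_lin; assumption).
  assert (Hcom : forall N M c N' M' c' x, poly_op N M c T1 T2 (poly_op N' M' c' T1 T2 x) =
     poly_op N' M' c' T1 T2 (poly_op N M c T1 T2 x)) by (intros; apply poly_op_comm; assumption).
  assert (H3 : forall N M c x, T3 (poly_op N M c T1 T2 x) = poly_op N M c T1 T2 (T3 x)).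
  { intros; apply poly_op_map; [exact HL3| |]; intros; symmetry; auto. }
  assert (Hbd : forall N M c, exists B, forall x, q (poly_op N M c T1 T2 x) <= B * q x).
  { intros N M c. destruct (coef_bounded c N M) as [s0 [Hs0 Hcs]].
    exists (4 ^ S N * (4 ^ S M * s0)). intros x.
    pose proof (poly_op_bound N M c T1 T2 s0 x HC1 HC2 Hcs). lra. }
  set (A := poly_op n m a T1 T2) in *. set (B := poly_op n m b T1 T2).
  destruct (Hbd n m a) as [Ba HBa]. fold A in HBa.
  destruct (bijective_of_dense A (d / 4) Ba Hc Hdef (Hlin n m a) ltac:(lra) Hlow HBa Hdense)
    as [Y [HAY HYA]].
  (* The 1 by 1 case of the quotient inequality: [b / a] is contractive on the torus. *)
  assert (HBA : forall x, q (B x) <= q (A x)).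
  { intros x. pose proof (Hvn (fun _ => poly_mexp n m b (MVar 0)) 1%nat) as Hv.
    assert (Hv' : 0 + q (eval (with_op true T1 T2) (fun _ => x) (poly_mexp n m b (MVar 0))) <= 0 + q (A x)).
    { apply (Hv) with (u := fun _ => x). intros K z1 z2 H1 H2 w.
      cbn [rsum]. rewrite eval_poly, poly_op_scal, q_scal. cbn [eval].
      pose proof (Hpos z1 z2 ltac:(lra) ltac:(lra)). pose proof (q_ge0 (w 0%nat)).
      apply Rplus_le_compat_l, Rmult_le_compat_r; [assumption|lra]. }
    rewrite eval_poly in Hv'. cbn [eval] in Hv'. fold B in Hv'. lra. }
  split.
  - intros x. set (y := T3 x).
    set (W := fun v => Nat.iter (L - n) T1 (Nat.iter (L - m) T2 v)).
    (* The rows of the colligation. On the torus [reflect2 L L (E l)] is [z^L] times the conjugate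
       of [E l], so row 0 carries the common unimodular factor [z^L]. *)
    set (F := fun i => match i with
      | O => MAdd (Nat.iter (L - n) (MX true) (Nat.iter (L - m) (MX false)
                     (poly_mexp n m (reflect2 n m b) (MVar 0))))
                  (msum (fun l => poly_mexp L L (reflect2 L L (E l)) (MVar (S l))) p)
      | S l => MAdd (poly_mexp L L (E l) (MVar 0))
                    (MScal (Copp C1) (poly_mexp n m b (MVar (S l))))
      end).
    (* The colligation divided by a sends [v] to [w]. With [y = T3 x], entry 0 goes from p(T)x to
       T^r p~(T)x, and the others from [T3 E_l(T)x] to [E_l(T)x]. *)
    set (v := fun i => match i with O => vadd (A x) (B y) | S l => T3 (poly_op L L (E l) T1 T2 x) end).
    set (w := fun i => match i with
      | O => W (vadd (poly_op n m (reflect2 n m b) T1 T2 x) (poly_op n m (reflect2 n m a) T1 T2 y))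
      | S l => poly_op L L (E l) T1 T2 x end).
    assert (HWlin : is_lin W).
    { apply (lin_comp (Nat.iter (L - m) T2) (Nat.iter (L - n) T1)); apply iter_is_lin; assumption. }
    assert (HWA : forall u, A (W u) = W (A u)).
    { intros u. unfold W. rewrite (iter_map A T1 T1), (iter_map A T2 T2); [reflexivity| |];
        intros; symmetry; apply poly_op_map; auto. }
    assert (Hshift : forall f k, rsum f (S k) = f 0%nat + rsum (fun i => f (S i)) k).
    { intros f k. rewrite <- (Nat.add_1_l k), rsum_append. simpl. ring. }
    assert (HF0 : forall (K : PH) (U1 U2 : K -> K) u, eval (with_op true U1 U2) u (F 0%nat) =
      vadd (Nat.iter (L - n) U1 (Nat.iter (L - m) U2 (poly_op n m (reflect2 n m b) U1 U2 (u 0%nat))))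
           (vsum (fun l => poly_op L L (reflect2 L L (E l)) U1 U2 (u (S l))) p)).
    { intros. unfold F. cbn [eval]. rewrite !eval_iter, eval_poly, eval_msum. f_equal.
      apply vsum_ext; intros l _. rewrite eval_poly. reflexivity. }
    assert (HFS : forall (K : PH) (U1 U2 : K -> K) u l, eval (with_op true U1 U2) u (F (S l)) =
      vsub (poly_op L L (E l) U1 U2 (u 0%nat)) (poly_op n m b U1 U2 (u (S l)))).
    { intros. unfold F. cbn [eval]. rewrite !eval_poly. cbn [eval]. v_ring. }
    assert (Htorus : forall z1 z2, Cnorm2 z1 = 1 -> Cnorm2 z2 = 1 ->
      forall c, Cmul (Cmul (Cpow z1 (L - n)) (Cpow z2 (L - m))) (poly2 n m (reflect2 n m c) z1 z2) =
        Cmul (Cmul (Cpow z1 L) (Cpow z2 L)) (Cconj (poly2 n m c z1 z2))).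
    { intros z1 z2 H1 H2 c. rewrite poly2_reflect by assumption.
      replace (Cpow z1 L) with (Cmul (Cpow z1 (L - n)) (Cpow z1 n)) by (rewrite <- Cpow_add; f_equal; lia).
      replace (Cpow z2 L) with (Cmul (Cpow z2 (L - m)) (Cpow z2 m)) by (rewrite <- Cpow_add; f_equal; lia).
      ring. }
    assert (Hineq : rsum (fun i => q (eval (with_op true T1 T2) (fun j => Y (v j)) (F i))) (S p) <=
                    rsum (fun i => q (A (Y (v i)))) (S p)).
    { apply Hvn. intros K z1 z2 H1 H2 u. rewrite rsum_scal, !Hshift.
      set (om := Cmul (Cpow z1 L) (Cpow z2 L)).
      assert (Hom : Cnorm2 om = 1).
      { unfold om. rewrite Cnorm2_mul, !Cnorm2_pow, H1, H2, !pow1. ring. }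
      rewrite (rsum_ext (fun i => q (eval _ u (F (S i))))
        (fun l => q (vsub (vscal (poly2 L L (E l) z1 z2) (u 0%nat))
                          (vscal (poly2 n m b z1 z2) (u (S l))))))
        by (intros l _; rewrite HFS, !poly_op_scal; reflexivity).
      rewrite HF0.
      match goal with |- q ?t + _ <= _ => replace t with (vscal om
        (vadd (vscal (Cconj (poly2 n m b z1 z2)) (u 0%nat))
          (vsum (fun l => vscal (Cconj (poly2 L L (E l) z1 z2)) (u (S l))) p))) end.
      - rewrite q_scal, Hom, Rmult_1_l.
        apply colligation_contractive. apply Hsos; assumption.
      - rewrite !iter_scal, poly_op_scal, vscal_distr_v, !vscal_assoc.
        rewrite (lin_vsum _ _ _ (lin_scal om)). unfold om. f_equal.
        + f_equal. rewrite <- Htorus by assumption. ring.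
        + apply vsum_ext; intros l _. rewrite poly_op_scal, poly2_reflect by assumption. v_ring. }
    (* [A] is injective and commutes with everything in sight, so the claim is checked after
       applying [A], which removes the division. *)
    assert (Hw : forall i, (i < S p)%nat -> eval (with_op true T1 T2) (fun j => Y (v j)) (F i) = w i).
    { intros i _.
      assert (Hinj : forall u u', A u = A u' -> u = u') by (intros u u' Hu; rewrite <- (HYA u), Hu; apply HYA).
      apply Hinj. unfold A at 1. rewrite (eval_map (poly_op n m a T1 T2) _ (with_op true T1 T2));
        [|apply Hlin|intros [|] t; unfold with_op; simpl; symmetry; apply poly_op_map; auto].
      fold A. rewrite (eval_ext _ (with_op true T1 T2) _ v) by (reflexivity || (intros; apply HAY)).
      destruct i as [|l].
      - rewrite HF0. unfold v, w. rewrite (proj1 (Hlin _ _ _)), HWA.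
        fold (W (vadd (poly_op n m (reflect2 n m b) T1 T2 (A x))
                      (poly_op n m (reflect2 n m b) T1 T2 (B y)))).
        rewrite (proj1 (Hlin n m a) : forall x y, A (vadd x y) = vadd (A x) (A y)), !(proj1 HWlin).
        rewrite (vsum_ext _ (fun l => poly_op L L (reflect2 L L (E l)) T1 T2 (poly_op L L (E l) T1 T2 y)))
          by (intros; rewrite H3; reflexivity).
        (* The operator form of [z^L (|b|^2 + sum |E_l|^2) = z^L |a|^2], valid on the torus and
           hence at [T1], [T2]. *)
        assert (Hid : vadd (W (poly_op n m (reflect2 n m b) T1 T2 (B y)))
           (vsum (fun l => poly_op L L (reflect2 L L (E l)) T1 T2 (poly_op L L (E l) T1 T2 y)) p) =
           W (A (poly_op n m (reflect2 n m a) T1 T2 y))).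
        { set (Wm := fun e => Nat.iter (L - n) (MX true) (Nat.iter (L - m) (MX false) e)).
          pose proof (identity_principle H T1 T2
            (MAdd (Wm (poly_mexp n m (reflect2 n m b) (poly_mexp n m b (MVar 0))))
              (msum (fun l => poly_mexp L L (reflect2 L L (E l)) (poly_mexp L L (E l) (MVar 0))) p))
            (Wm (poly_mexp n m a (poly_mexp n m (reflect2 n m a) (MVar 0))))
            Hc Hdef HT1 HT2 H12) as Hi.
          assert (Hev : forall (K : PH) (U1 U2 : K -> K) u,
            eval (with_op true U1 U2) u
              (MAdd (Wm (poly_mexp n m (reflect2 n m b) (poly_mexp n m b (MVar 0))))
              (msum (fun l => poly_mexp L L (reflect2 L L (E l)) (poly_mexp L L (E l) (MVar 0))) p)) =
            vadd (Nat.iter (L - n) U1 (Nat.iter (L - m) U2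
                (poly_op n m (reflect2 n m b) U1 U2 (poly_op n m b U1 U2 (u 0%nat)))))
              (vsum (fun l => poly_op L L (reflect2 L L (E l)) U1 U2 (poly_op L L (E l) U1 U2 (u 0%nat))) p)).
          { intros. unfold Wm. cbn [eval]. rewrite !eval_iter, !eval_poly, eval_msum. f_equal.
            apply vsum_ext; intros l _. rewrite !eval_poly. reflexivity. }
          assert (Hev' : forall (K : PH) (U1 U2 : K -> K) u,
            eval (with_op true U1 U2) u
              (Wm (poly_mexp n m a (poly_mexp n m (reflect2 n m a) (MVar 0)))) =
            Nat.iter (L - n) U1 (Nat.iter (L - m) U2
                (poly_op n m a U1 U2 (poly_op n m (reflect2 n m a) U1 U2 (u 0%nat))))).
          { intros. unfold Wm. rewrite !eval_iter, !eval_poly. reflexivity. }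
          assert (Hi' := fun Hprem => Hi Hprem (fun _ => y)).
          rewrite Hev, Hev' in Hi'. apply Hi'.
          intros K z1 z2 H1 H2 u. rewrite Hev, Hev', !iter_scal, !poly_op_scal.
          set (om := Cmul (Cpow z1 L) (Cpow z2 L)).
          rewrite (vsum_ext _ (fun l => vscal (Cmul om (RtoC (Cnorm2 (poly2 L L (E l) z1 z2)))) (u 0%nat))).
          - rewrite <- vscal_csum, csum_scal, <- RtoC_rsum, !vscal_assoc, <- vscal_distr_s. f_equal.
            transitivity (Cmul om (RtoC (Cnorm2 (poly2 n m a z1 z2)))).
            + rewrite (Hsos z1 z2 H1 H2).
              transitivity (Cadd (Cmul om (Cmul (poly2 n m b z1 z2) (Cconj (poly2 n m b z1 z2))))
                (Cmul om (RtoC (rsum (fun i => Cnorm2 (poly2 L L (E i) z1 z2)) p)))).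
              * f_equal. transitivity (Cmul (Cmul om (Cconj (poly2 n m b z1 z2))) (poly2 n m b z1 z2)); [|ring].
                unfold om. rewrite <- Htorus by assumption. ring.
              * rewrite Cmul_conj. unfold RtoC. c_ring.
            + rewrite <- Cmul_conj.
              transitivity (Cmul (Cmul om (Cconj (poly2 n m a z1 z2))) (poly2 n m a z1 z2)); [ring|].
              unfold om. rewrite <- Htorus by assumption. ring.
          - intros l _. rewrite !poly_op_scal, poly2_reflect, <- Cmul_conj by assumption.
            unfold om. v_ring. }
        unfold A at 1. rewrite Hcom. fold A.
        rewrite <- Hid. v_ring.
      - rewrite HFS. unfold v, w. rewrite (proj1 (Hlin _ _ _)), H3.
        unfold A, B. rewrite (Hcom L L (E l)), (Hcom L L (E l) n m b). fold y. v_ring. }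
    rewrite (rsum_ext (fun i => q (A (Y (v i)))) (fun i => q (v i))) in Hineq
      by (intros; rewrite HAY; reflexivity).
    rewrite (rsum_ext _ (fun i => q (w i))) in Hineq by (intros; rewrite Hw by assumption; reflexivity).
    rewrite !Hshift in Hineq.
    (* Contractivity of [T3] makes the state entries cancel, leaving the inequality for entry 0. *)
    assert (rsum (fun i => q (v (S i))) p <= rsum (fun i => q (w (S i))) p).
    { apply rsum_le; intros l _. apply HC3. }
    change (q (w 0%nat) <= q (v 0%nat)). lra.
  - set (PT := fun x => vadd (A x) (B (T3 x))).
    assert (HPTlin : is_lin PT).
    { pose proof (Hlin n m a) as HlA. fold A in HlA. pose proof (Hlin n m b) as HlB. fold B in HlB.
      split; intros; unfold PT.
      - rewrite (proj1 HL3), (proj1 HlA), (proj1 HlB). v_ring.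
      - rewrite (proj2 HL3), (proj2 HlA), (proj2 HlB). v_ring. }
    destruct HT3 as [_ [c [Hc01 Hcq]]].
    (* [T3] commutes with [A], so its strict bound acts on [A x]: the term [b(T) T3] is a strict
       perturbation of [a(T)]. *)
    assert (HBT : forall x, q (B (T3 x)) <= c * q (A x)).
    { intros x. eapply Rle_trans; [apply HBA|]. unfold A. rewrite <- H3. apply Hcq. }
    destruct (Hbd n m b) as [Bb HBb]. fold B in HBb.
    (* Chosen so that [(1 + eta) c <= 1 - eta], which leaves a multiple [eta] of [q (A x)] after the
       perturbation is subtracted. *)
    set (eta := (1 - c) / 2). assert (Heta : 0 < eta) by (unfold eta; lra).
    assert (Hie : 0 < / eta) by (apply Rinv_0_lt_compat; exact Heta).
    apply (bijective_of_dense PT (d / 4 * (eta / (1 + / eta))) (2 * Ba + 2 * Rabs Bb) Hc Hdef HPTlin).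
    + apply Rmult_lt_0_compat; [lra|]. apply Rdiv_lt_0_compat; lra.
    + intros x. specialize (Hlow x). specialize (HBT x).
      pose proof (q_young eta (vopp (B (T3 x))) (PT x) Heta) as Hy.
      replace (vadd (vopp (B (T3 x))) (PT x)) with (A x) in Hy by (unfold PT; v_ring).
      rewrite q_opp in Hy. pose proof (q_ge0 (A x)). pose proof (q_ge0 x).
      assert ((1 + eta) * q (B (T3 x)) <= (1 + eta) * (c * q (A x))) by (apply Rmult_le_compat_l; lra).
      assert ((1 + eta) * c <= 1 - eta) by (unfold eta; nra).
      assert ((1 + eta) * c * q (A x) <= (1 - eta) * q (A x)) by (apply Rmult_le_compat_r; lra).
      assert (Hq : eta * q (A x) <= (1 + / eta) * q (PT x)) by lra.
      apply (Rmult_le_reg_l (1 + / eta)); [lra|].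
      replace ((1 + / eta) * (d / 4 * (eta / (1 + / eta)) * q x)) with (eta * (d / 4 * q x))
        by (field; repeat split; nra).
      eapply Rle_trans; [|exact Hq]. apply Rmult_le_compat_l; lra.
    + intros x. unfold PT. eapply Rle_trans; [apply q_add_le|].
      specialize (HBa x). specialize (HBb (T3 x)). pose proof (proj2 HC3 x).
      pose proof (q_ge0 (T3 x)). pose proof (Rle_abs Bb). pose proof (Rabs_pos Bb).
      assert (Bb * q (T3 x) <= Rabs Bb * q (T3 x)) by (apply Rmult_le_compat_r; assumption).
      assert (Rabs Bb * q (T3 x) <= Rabs Bb * q x) by (apply Rmult_le_compat_l; assumption).
      lra.
    (* [Y y], the solution with the [T3] term dropped, leaves the residual [- B (T3 (Y y))], of
       squared norm at most [c q y]. *)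
    + apply (dense_range_of_residual PT c HPTlin Hc01). intros y. exists (Y y).
      unfold PT. rewrite HAY. replace (vsub y (vadd y (B (T3 (Y y))))) with (vopp (B (T3 (Y y)))) by v_ring.
      rewrite q_opp. rewrite <- (HAY y) at 2. apply HBT.
Qed.

(** * Hilbert spaces and the complex plane as instances *)

Definition hilbert_space (H : HilbertSpace) : PH.
Proof.
  refine {| car := hcar H; vz := hz H; vadd := hadd H; vopp := hopp H; vscal := hscal H;
    ip := fun x y => Cre (hinner H x y) |}; intros.
  - apply hadd_assoc.
  - apply hadd_comm.
  - apply hadd_0.
  - apply hadd_opp.
  - apply hscal_1.
  - apply hscal_assoc.
  - apply hscal_distr_v.
  - apply hscal_distr_s.
  - rewrite hinner_add_l; reflexivity.
  - rewrite hinner_sym; reflexivity.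
  - rewrite hinner_scal_l; unfold RtoC; simpl; ring.
  - rewrite (hinner_sym _ (hscal H (Cconj c) y) x), !hinner_scal_l, (hinner_sym _ x y).
    unfold Cmul, Cconj; simpl; ring.
  - apply hinner_pos.
Defined.

Lemma sqrt_lt_iff x e : 0 <= x -> 0 < e -> sqrt x < e <-> x < e * e.
Proof.
  intros Hx He. split; intros H.
  - rewrite <- (sqrt_sqrt x Hx). pose proof (sqrt_pos x). nra.
  - rewrite <- (sqrt_square e) by lra. apply sqrt_lt_1; nra.
Qed.

Lemma hilbert_complete (H : HilbertSpace) : complete (hilbert_space H).
Proof.
  intros u Hu. destruct (hcomplete H u) as [l Hl].
  - intros eps He. destruct (Hu (eps * eps)) as [N HN]; [nra|].
    exists N. intros a b Ha Hb. apply sqrt_lt_iff; [apply hinner_pos|exact He|apply HN; assumption].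
  - exists l. intros eps He. destruct (Hl (sqrt eps)) as [N HN]; [apply sqrt_lt_R0, He|].
    exists N. intros a Ha. specialize (HN a Ha).
    apply sqrt_lt_iff in HN; [|apply hinner_pos|apply sqrt_lt_R0, He].
    rewrite sqrt_sqrt in HN by lra. exact HN.
Qed.

(** [strict] speaks of squared norms, so the constant [c] becomes [c * c]. *)
Lemma hilbert_strict (H : HilbertSpace) (T : H -> H) :
  strict_contraction T -> @strict (hilbert_space H) T.
Proof.
  intros [Hl [c [Hc Hb]]]. split; [exact Hl|]. exists (c * c). split; [nra|]. intros x.
  specialize (Hb x). unfold hnorm, gen_norm in Hb.
  change (Cre (hinner H (T x) (T x)) <= c * c * Cre (hinner H x x)).
  pose proof (hinner_pos H x) as H0. pose proof (hinner_pos H (T x)) as H1.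
  rewrite <- (sqrt_sqrt _ H0), <- (sqrt_sqrt _ H1).
  pose proof (sqrt_pos (Cre (hinner H x x))). pose proof (sqrt_pos (Cre (hinner H (T x) (T x)))).
  set (s := sqrt (Cre (hinner H x x))) in *. set (t := sqrt _) in *.
  apply Rle_trans with ((c * s) * (c * s)); [apply Rmult_le_compat; assumption|lra].
Qed.

(** [hsum] includes its upper index and [vsum] stops before it, hence the shift. *)
Lemma hsum_vsum (H : HilbertSpace) (f : nat -> H) N :
  hsum f N = @vsum (hilbert_space H) f (S N).
Proof.
  induction N as [|N IH].
  - symmetry. apply (hadd_0 H).
  - simpl hsum. rewrite IH. reflexivity.
Qed.

Lemma opeval3_poly (H : HilbertSpace) n m c (T1 T2 T3 : H -> H) x :
  opeval3 n m c T1 T2 T3 x =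
  hadd H (@poly_op (hilbert_space H) n m (fun j k => c j k 0%nat) T1 T2 x)
         (@poly_op (hilbert_space H) n m (fun j k => c j k 1%nat) T1 T2 (T3 x)).
Proof.
  unfold opeval3, poly_op. rewrite hsum_vsum.
  change (hadd H) with (@vadd (hilbert_space H)).
  rewrite <- vsum_add. apply (@vsum_ext (hilbert_space H)); intros j _.
  rewrite hsum_vsum, <- vsum_add.
  apply (@vsum_ext (hilbert_space H)); intros k _.
  reflexivity.
Qed.

(** Points of the tridisk act on this space as commuting strict contractions, so the pointwise bound
    is an instance of the operator bound. *)
Definition C_space : PH.
Proof.
  refine {| car := C; vz := C0; vadd := Cadd; vopp := Copp; vscal := Cmul;
    ip := fun x y => Cre (Cmul x (Cconj y)) |}; intros;
    first [ring | unfold Copp; c_ring | simpl; ring | simpl; nra].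
Defined.

Lemma C_q z : @q C_space z = Cnorm2 z.
Proof. unfold q, Cnorm2; simpl; ring. Qed.

Lemma C_definite : definite C_space.
Proof. intros z Hz. rewrite C_q in Hz. apply Cnorm2_eq0, Hz. Qed.

Lemma C_complete : complete C_space.
Proof.
  intros u Hu.
  assert (Hpart : forall f : C -> R, (forall z w, (f z - f w) * (f z - f w) <= Cnorm2 (Csub z w)) ->
    exists l, forall eps, 0 < eps -> exists N, forall a, (N <= a)%nat ->
      (f (u a) - l) * (f (u a) - l) < eps).
  { intros f Hf. destruct (R_complete (fun n => f (u n))) as [l Hl].
    - intros eps He. destruct (Hu (eps * eps)) as [N HN]; [nra|].
      exists N. intros a b Ha Hb. specialize (HN a b Ha Hb). rewrite C_q in HN.
      specialize (Hf (u a) (u b)). unfold Rdist. change (vsub (u a) (u b)) with (Csub (u a) (u b)) in HN.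
      set (e := f (u a) - f (u b)) in *. assert (e * e < eps * eps) by lra.
      apply Rabs_def1; nra.
    - exists l. intros eps He. destruct (Hl (sqrt eps)) as [N HN]; [apply sqrt_lt_R0, He|].
      exists N. intros a Ha. specialize (HN a Ha). unfold Rdist in HN.
      rewrite <- (sqrt_sqrt eps) by lra.
      pose proof (sqrt_pos eps). apply Rabs_def2 in HN. nra. }
  destruct (Hpart Cre) as [x Hx].
  { intros z w. unfold Cnorm2; simpl. pose proof (Rle_0_sqr (Cim z - Cim w)). unfold Rsqr in *. lra. }
  destruct (Hpart Cim) as [y Hy].
  { intros z w. unfold Cnorm2; simpl. pose proof (Rle_0_sqr (Cre z - Cre w)). unfold Rsqr in *. lra. }
  exists (mkC x y). intros eps He.
  destruct (Hx (eps / 2)) as [N HN]; [lra|]. destruct (Hy (eps / 2)) as [N' HN']; [lra|].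
  exists (N + N')%nat. intros a Ha. specialize (HN a ltac:(lia)). specialize (HN' a ltac:(lia)).
  rewrite C_q. unfold Cnorm2; simpl. unfold Rminus in *. lra.
Qed.

Lemma Csum_csum f N : Csum f N = csum f (S N).
Proof. induction N as [|N IH]; simpl; [ring|]. rewrite IH; reflexivity. Qed.

Lemma eval3_poly n m c z1 z2 z3 :
  eval3 n m c z1 z2 z3 =
  Cadd (poly2 n m (fun j k => c j k 0%nat) z1 z2)
       (Cmul (poly2 n m (fun j k => c j k 1%nat) z1 z2) z3).
Proof.
  unfold eval3, poly2. rewrite Csum_csum, <- csum_scal_r, <- csum_add.
  apply csum_ext_all; intros j. rewrite Csum_csum, <- csum_scal_r, <- csum_add.
  apply csum_ext_all; intros k. simpl. ring.
Qed.

Lemma Cmod_le1 z : Cmod z <= 1 <-> Cnorm2 z <= 1.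
Proof.
  change (Cmod z) with (sqrt (Cnorm2 z)). pose proof (Cnorm2_ge0 z). split; intros Hz.
  - rewrite <- (sqrt_sqrt _ H). pose proof (sqrt_pos (Cnorm2 z)). nra.
  - rewrite <- sqrt_1. apply sqrt_le_1; lra.
Qed.

Lemma reflect3_reflect2 n m p k : (k <= 1)%nat ->
  forall i j, (i <= n)%nat -> (j <= m)%nat ->
  reflect3 n m p i j k = reflect2 n m (fun i j => p i j (1 - k)%nat) i j.
Proof.
  intros Hk i j Hi Hj. unfold reflect3, reflect2.
  apply Nat.leb_le in Hi, Hj, Hk. rewrite Hi, Hj, Hk. reflexivity.
Qed.

Lemma poly_op_ext {K : PH} n m c c' (A B : K -> K) x :
  (forall j k, (j <= n)%nat -> (k <= m)%nat -> c j k = c' j k) ->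
  poly_op n m c A B x = poly_op n m c' A B x.
Proof.
  intros H. apply vsum_ext; intros j Hj. apply vsum_ext; intros k Hk.
  rewrite H by lia. reflexivity.
Qed.

Lemma poly2_ext n m c c' z1 z2 :
  (forall j k, (j <= n)%nat -> (k <= m)%nat -> c j k = c' j k) ->
  poly2 n m c z1 z2 = poly2 n m c' z1 z2.
Proof.
  intros H. apply csum_ext; intros j Hj. apply csum_ext; intros k Hk.
  rewrite H by lia. reflexivity.
Qed.

Theorem theorem6 (n m : nat) (hn : (1 <= n)%nat) (hm : (1 <= m)%nat)
  (p : coef3) (hdeg : multideg_le p n m 1)
  (hnz : forall z1 z2 z3, in_closedD z1 -> in_closedD z2 -> in_closedD z3 ->
           eval3 n m p z1 z2 z3 <> C0) :
  exists r s : nat, SchurAgler_rat r s n m (reflect3 n m p) p.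
Proof.
  set (a := fun j k => p j k 0%nat). set (b := fun j k => p j k 1%nat).
  assert (Hlt : forall z1 z2, Cnorm2 z1 <= 1 -> Cnorm2 z2 <= 1 ->
    Cnorm2 (poly2 n m b z1 z2) < Cnorm2 (poly2 n m a z1 z2)).
  { intros z1 z2 H1 H2. apply Rnot_le_lt; intros Hle.
    pose proof (Cnorm2_ge0 (poly2 n m a z1 z2)) as Hage.
    apply Cmod_le1 in H1, H2.
    (* If [|a| <= |b|] at a point, p vanishes over it within the closed disk: at [z3 = -a/b] if [b]
       is nonzero, and at [z3 = 0] if both vanish. *)
    destruct (Req_dec (Cnorm2 (poly2 n m b z1 z2)) 0) as [E|Hne].
    - apply (hnz z1 z2 C0 H1 H2); [apply Cmod_le1; unfold Cnorm2; simpl; lra|].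
      rewrite eval3_poly. fold a b. rewrite (Cnorm2_eq0 (poly2 n m a z1 z2)) by lra. ring.
    - pose proof (Cnorm2_ge0 (poly2 n m b z1 z2)).
      set (beta := poly2 n m b z1 z2) in *. set (alpha := poly2 n m a z1 z2) in *.
      apply (hnz z1 z2 (Copp (Cmul alpha (Cinv beta))) H1 H2).
      + apply Cmod_le1.
        replace (Cnorm2 (Copp (Cmul alpha (Cinv beta)))) with (Cnorm2 alpha / Cnorm2 beta)
          by (unfold Cnorm2 in *; simpl; field; exact Hne).
        apply (Rmult_le_reg_r (Cnorm2 beta)); [lra|].
        unfold Rdiv. rewrite Rmult_assoc, Rinv_l by exact Hne. lra.
      + rewrite eval3_poly. fold a b alpha beta.
        unfold Cnorm2 in Hne. apply C_eq; simpl; field; exact Hne. }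
  (* [|a|^2 - |b|^2], written as a complex expression so that the continuity lemmas apply to it. *)
  destruct (bidisk_positive_lower_bound (fun z1 z2 => Cadd
      (Cmul (poly2 n m a z1 z2) (Cconj (poly2 n m a z1 z2)))
      (Cmul (Copp C1) (Cmul (poly2 n m b z1 z2) (Cconj (poly2 n m b z1 z2)))))) as [d [Hd Hlow]].
  { pose proof (continuous2_poly n m a). pose proof (continuous2_poly n m b).
    apply continuous2_add; [|apply continuous2_mul; [apply continuous2_const|]];
      (apply continuous2_mul; [|apply continuous2_conj]); assumption. }
  { intros z1 z2 H1 H2. specialize (Hlt z1 z2 H1 H2). rewrite !Cmul_conj. simpl. lra. }
  destruct (degree_one_schur_agler n m a b d Hd) as (r & s & Hmain).
  { intros z1 z2 H1 H2. specialize (Hlow z1 z2 H1 H2). rewrite !Cmul_conj in Hlow. simpl in Hlow. lra. }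
  exists r, s. split.
  - intros z1 z2 z3 H1 H2 H3.
    assert (Hne : eval3 n m p z1 z2 z3 <> C0) by (apply hnz; left; assumption).
    split; [exact Hne|].
    assert (Hst : forall z, in_D z -> @strict C_space (vscal z)).
    { intros z Hz. split; [apply lin_scal|]. exists (Cnorm2 z). split.
      - split; [apply Cnorm2_ge0|]. unfold in_D in Hz. change (sqrt (Cnorm2 z) < 1) in Hz.
        apply sqrt_lt_iff in Hz; [lra|apply Cnorm2_ge0|lra].
      - intros x. rewrite q_scal. lra. }
    assert (Hsc : forall (z w : C) (x : C_space), vscal z (vscal w x) = vscal w (vscal z x))
      by (intros; v_ring).
    destruct (Hmain C_space (vscal z1) (vscal z2) (vscal z3) C_complete C_definite
      (Hst z1 H1) (Hst z2 H2) (Hst z3 H3) (Hsc z1 z2) (Hsc z1 z3) (Hsc z2 z3)) as [Hq _].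
    specialize (Hq C1). rewrite !iter_scal, !poly_op_scal, !C_q in Hq. cbn [vscal vadd C_space] in Hq.
    assert (E1 : Cadd (Cmul (poly2 n m a z1 z2) C1) (Cmul (poly2 n m b z1 z2) (Cmul z3 C1)) =
       eval3 n m p z1 z2 z3) by (rewrite eval3_poly; fold a b; ring).
    assert (E2 : Cadd (Cmul (poly2 n m (reflect2 n m b) z1 z2) C1)
         (Cmul (poly2 n m (reflect2 n m a) z1 z2) (Cmul z3 C1)) =
       eval3 n m (reflect3 n m p) z1 z2 z3).
    { rewrite eval3_poly.
      rewrite (poly2_ext n m _ (reflect2 n m b) z1 z2 (reflect3_reflect2 n m p 0 ltac:(lia))).
      rewrite (poly2_ext n m _ (reflect2 n m a) z1 z2 (reflect3_reflect2 n m p 1 ltac:(lia))).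
      ring. }
    rewrite E1, E2 in Hq. apply Cmod_le1.
    set (P := eval3 n m p z1 z2 z3) in *.
    set (Q := Cmul (Cpow z1 r) (Cmul (Cpow z2 s) (eval3 n m (reflect3 n m p) z1 z2 z3))) in *.
    assert (HP : 0 < Cnorm2 P).
    { pose proof (Cnorm2_ge0 P). destruct (Req_dec (Cnorm2 P) 0) as [E|]; [|lra].
      elim Hne. apply Cnorm2_eq0, E. }
    replace (Cnorm2 (Cdiv Q P)) with (Cnorm2 Q / Cnorm2 P).
    + apply (Rmult_le_reg_r (Cnorm2 P)); [exact HP|].
      unfold Rdiv. rewrite Rmult_assoc, Rinv_l by lra. lra.
    + unfold Cdiv. rewrite Cnorm2_mul. unfold Rdiv. f_equal.
      unfold Cnorm2 in *; simpl; field; lra.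
  - intros H T1 T2 T3 HT1 HT2 HT3 H12 H13 H23.
    destruct (Hmain (hilbert_space H) T1 T2 T3 (hilbert_complete H) (hinner_def H)
      (hilbert_strict H T1 HT1) (hilbert_strict H T2 HT2) (hilbert_strict H T3 HT3) H12 H13 H23)
      as [Hq [X [HX1 HX2]]].
    assert (Hp : forall x, opeval3 n m p T1 T2 T3 x = hadd H
      (@poly_op (hilbert_space H) n m a T1 T2 x) (@poly_op (hilbert_space H) n m b T1 T2 (T3 x)))
      by (intros; apply opeval3_poly).
    exists X. split; [|split].
    + intros x. rewrite Hp. apply HX1.
    + intros x. rewrite Hp. apply HX2.
    + intros x. unfold hnorm, gen_norm. apply sqrt_le_1; try apply hinner_pos.
      rewrite opeval3_poly.
      rewrite (poly_op_ext n m _ (reflect2 n m b) _ _ _ (reflect3_reflect2 n m p 0 ltac:(lia))).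
      rewrite (poly_op_ext n m _ (reflect2 n m a) _ _ _ (reflect3_reflect2 n m p 1 ltac:(lia))).
      (* At [X x] the right-hand side p(T) X x is [x] itself. *)
      specialize (Hq (X x)). rewrite HX1 in Hq. exact Hq.
Qed.
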